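(* Let $E/F$ be a non-isotrivial elliptic curve and let $H=F^{ab}$ be the maximal abelian extension of $F$ (inside $\bar F$). Then the group $E_{\mathrm{tors}}(H)$ of torsion points of $E$ rational over $H$ is finite.
   Context: Let $p$ be a prime, $\mathbb F_r$ a finite field of characteristic $p$, $\mathcal C$ a geometrically irreducible smooth projective curve over $\mathbb F_r$, and $F=\mathbb F_r(\mathcal C)$ its function field, with a fixed algebraic closure $\bar F$. An elliptic curve $E/F$ is isotrivial if it becomes isomorphic to an elliptic curve defined over a finite field after a finite extension of $F$; equivalently $j(E)\in\bar{\mathbb F}_r$. *)

(* Defs.v *)
From HB Require Import structures.
From mathcomp Require Import all_boot all_order all_algebra all_field.
Set Implicit Arguments. Unset Strict Implicit. Unset Printing Implicit Defensive.
Import Order.TTheory GRing.Theory Num.Theory.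
Local Open Scope ring_scope.

(* F = F_r(C), C a geometrically irreducible smooth projective curve   *)
(* over the finite field F_r, is (up to isomorphism) exactly a field   *)
(* of characteristic p > 0 that is a finite extension of F_p(t) for    *)
(* some t transcendental over the prime field F_p (the exact constant  *)
(* field F_r being the algebraic closure of F_p in F).                 *)

Definition ieval (F : fieldType) (P : {poly int}) (x : F) : F :=
  (map_poly (fun z : int => z%:~R) P).[x].

Definition transcendental_prime (F : fieldType) (x : F) : Prop :=
  forall P : {poly int}, ieval P x = 0 -> map_poly (fun z : int => z%:~R : F) P = 0.

Definition in_prime_rat (F : fieldType) (t c : F) : Prop :=
  exists P Q : {poly int}, ieval Q t != 0 /\ c = ieval P t / ieval Q t.

Definition global_function_field (F : fieldType) : Prop :=
  (exists p : nat, prime p /\ p \in [pchar F]) /\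
  exists t : F, transcendental_prime t /\
    exists bs : seq F, forall y : F, exists cs : seq F,
      [/\ size cs = size bs, (forall c, c \in cs -> in_prime_rat t c) &
          y = \sum_(i < size bs) cs`_i * bs`_i].

Definition is_algebraic_closure (F : fieldType) (L : closedFieldType)
  (iota : {rmorphism F -> L}) : Prop :=
  forall x : L, exists P : {poly F}, P != 0 /\ root (map_poly iota P) x.

Section MaxAb.
Variables (F : fieldType) (L : closedFieldType) (iota : {rmorphism F -> L}).

Definition is_subfield (K : L -> Prop) : Prop :=
  [/\ K 1,
      forall x y, K x -> K y -> K (x - y),
      forall x y, K x -> K y -> K (x * y) &
      forall x, K x -> K x^-1].

Definition contains_base (K : L -> Prop) : Prop := forall a : F, K (iota a).

Definition finite_over (K : L -> Prop) : Prop :=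
  exists bs : seq L, (forall b, b \in bs -> K b) /\
    forall y, K y -> exists cs : seq F,
      size cs = size bs /\ y = \sum_(i < size bs) iota cs`_i * bs`_i.

Definition separable_over (K : L -> Prop) : Prop :=
  forall y, K y -> exists P : {poly F}, separable_poly P /\ root (map_poly iota P) y.

Definition normal_over (K : L -> Prop) : Prop :=
  forall y, K y -> exists P : {poly F}, exists rs : seq L,
    [/\ P != 0, root (map_poly iota P) y, (forall r, r \in rs -> K r) &
        map_poly iota P = (lead_coef (map_poly iota P)) *: \prod_(r <- rs) ('X - r%:P)].

Definition is_Faut (K : L -> Prop) (g : L -> L) : Prop :=
  [/\ forall x, K x -> K (g x),
      forall z, K z -> (exists x, K x /\ g x = z),
      forall x y, K x -> K y -> g (x + y) = g x + g y,
      forall x y, K x -> K y -> g (x * y) = g x * g y &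
      forall a : F, g (iota a) = iota a].

Definition abelian_over (K : L -> Prop) : Prop :=
  forall g h, is_Faut K g -> is_Faut K h -> forall x, K x -> g (h x) = h (g x).

Definition finite_abelian_galois (K : L -> Prop) : Prop :=
  [/\ is_subfield K, contains_base K, finite_over K,
      separable_over K /\ normal_over K & abelian_over K].

Definition in_Fab (x : L) : Prop :=
  exists K : L -> Prop, finite_abelian_galois K /\ K x.

End MaxAb.

Section Weierstrass.
Variable K : fieldType.
Variables a1 a2 a3 a4 a6 : K.

Definition ec_b2 := a1 ^+ 2 + 4%:R * a2.
Definition ec_b4 := 2%:R * a4 + a1 * a3.
Definition ec_b6 := a3 ^+ 2 + 4%:R * a6.
Definition ec_b8 := a1 ^+ 2 * a6 + 4%:R * a2 * a6 - a1 * a3 * a4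
                    + a2 * a3 ^+ 2 - a4 ^+ 2.
Definition ec_c4 := ec_b2 ^+ 2 - 24%:R * ec_b4.
Definition ec_disc := - ec_b2 ^+ 2 * ec_b8 - 8%:R * ec_b4 ^+ 3
                      - 27%:R * ec_b6 ^+ 2 + 9%:R * ec_b2 * ec_b4 * ec_b6.
Definition ec_j := ec_c4 ^+ 3 / ec_disc.

(* projective points: None is the point at infinity O *)
Definition on_curve (P : option (K * K)) : bool :=
  if P is Some (x, y) then
    y ^+ 2 + a1 * x * y + a3 * y == x ^+ 3 + a2 * x ^+ 2 + a4 * x + a6
  else true.

(* chord-and-tangent addition (Silverman, III.2.3) *)
Definition ec_add (P Q : option (K * K)) : option (K * K) :=
  match P, Q with
  | None, _ => Q
  | _, None => P
  | Some (x1, y1), Some (x2, y2) =>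
    if (x1 == x2) && (y1 + y2 + a1 * x2 + a3 == 0) then None else
    let: (lam, nu) :=
      if x1 != x2 then ((y2 - y1) / (x2 - x1), (y1 * x2 - y2 * x1) / (x2 - x1))
      else ((3%:R * x1 ^+ 2 + 2%:R * a2 * x1 + a4 - a1 * y1) / (2%:R * y1 + a1 * x1 + a3),
            (- x1 ^+ 3 + a4 * x1 + 2%:R * a6 - a3 * y1) / (2%:R * y1 + a1 * x1 + a3)) in
    let x3 := lam ^+ 2 + a1 * lam - a2 - x1 - x2 in
    Some (x3, - (lam + a1) * x3 - nu - a3)
  end.

Definition ec_mul (n : nat) (P : option (K * K)) : option (K * K) :=
  iter n (ec_add P) None.

Definition is_torsion (P : option (K * K)) : Prop :=
  on_curve P /\ exists n : nat, (0 < n)%N /\ ec_mul n P = None.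

End Weierstrass.

Definition in_tors_over (L : fieldType) (a1 a2 a3 a4 a6 : L) (H : L -> Prop)
  (P : option (L * L)) : Prop :=
  is_torsion a1 a2 a3 a4 a6 P /\
  (if P is Some (x, y) then H x /\ H y else True).

(* Main.v *)
Require Import Defs.
From HB Require Import structures.
From mathcomp Require Import all_boot all_order all_fingroup all_algebra all_field.
From mathcomp Require Import boolp classical_sets.
From mathcomp Require Import ring lra zify.
Set Implicit Arguments. Unset Strict Implicit. Unset Printing Implicit Defensive.
Import Order.TTheory GRing.Theory Num.Theory.
Local Open Scope ring_scope.

(** Let L be the algebraic closure of F and s = 1 / (j - 1728). Replacing x by a suitable
    affine coordinate X makes the Kummer formulas of E depend on s only. Fix a Q-valued
    valuation w of L with w(s) = 1, a place of multiplicative reduction.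

    For torsion P, Q of order prime to p and X(P) <> X(Q), the function
    (X(P) - X(Q))^6 / (s (1 + 1728 s)^2) is a unit wherever j is finite, because E has
    potentially good reduction there. The product formula over F_p(j) then computes the
    average of min(f_P, f_Q) over the conjugate valuations v of w, f_P = min(v(X(P)), 1/2): it
    is 1/6. Likewise, by duplication, the average of f_P - f_P^2 is 1/6 up to an error of
    4^-k / 6 if 2^k P <> 0. Since min(x, y) - (x - x^2) - (y - y^2) + 1/6 is a positive kernel, few
    points can have the same f_P at a positive proportion of the places, or values of f_P of
    bounded denominator.

    If X(P) lies in an abelian extension K of F, its conjugates under a decomposition
    group have the same f at a positive proportion of the places, as Gal(K/F) is commutative;
    so there are boundedly many of them. Their product lies in the decomposition field, where
    the values of w are those of F, so f_P has bounded denominator, and there are finitely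
    many such points. For p-power torsion, P |-> f_P is injective up to sign, since by
    periodicity of the sequence X(kP) points of order p have singular reduction; hence X(P) is
    fixed by the decomposition group, and again f_P has bounded denominator. *)

(** Why the kernel bounds the number of points: sum it over all pairs of [n] points and average over
    the conjugate valuations. An off-diagonal pair contributes 1/6 - 1/6 - 1/6 + 1/6 = 0 up to the
    duplication error, and the diagonal at most [n / 3] in all, so a lower bound of order [n^2] for
    the same sum bounds [n]. Coinciding values, or values on a fixed grid, provide that lower bound.
    Two groups have to be kept apart. The averages run over automorphisms over [F_p(j)], since only
    there do the conjugates of one place exhaust the places where [j] is infinite; such
    automorphisms fix the coefficients of the normal form but need not preserve the curve.
    Commutativity and the action on points concern automorphisms over [F] only. Hence the conjugate
    valuations are sorted by restriction to [F]: two automorphisms in one class differ by an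
    automorphism over [F]. Inseparability is harmless for the averages: an element fixed by all
    automorphisms has a power in the base field, and valuations only need that power. *)

(** * Places *)

(* The graph of a ring morphism from a subring of [L] to [L]. *)
Definition place_graph (L : fieldType) (G : L -> L -> Prop) :=
  [/\ G 1 1, forall a b c d, G a b -> G c d -> G (a - c) (b - d),
      forall a b c d, G a b -> G c d -> G (a * c) (b * d) &
      forall b, G 0 b -> b = 0].

Definition valring (L : fieldType) (O : L -> Prop) :=
  [/\ O 1, forall x y, O x -> O y -> O (x - y),
      forall x y, O x -> O y -> O (x * y) & forall x, O x \/ O x^-1].

Section PlaceGraph.
Variables (L : fieldType) (G : L -> L -> Prop).
Hypothesis plG : place_graph G.

Let G1 : G 1 1. Proof. by case: plG. Qed.
Let GB a b c d : G a b -> G c d -> G (a - c) (b - d).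
Proof. by case: plG => _ h _ _; apply: h. Qed.
Let GM a b c d : G a b -> G c d -> G (a * c) (b * d).
Proof. by case: plG => _ _ h _; apply: h. Qed.

Lemma place_graph0 : G 0 0. Proof. by rewrite -(subrr 1); apply: GB. Qed.

Lemma place_graphN a b : G a b -> G (- a) (- b).
Proof. by rewrite -(sub0r a) -(sub0r b); apply: GB; apply: place_graph0. Qed.

Lemma place_graphD a b c d : G a b -> G c d -> G (a + c) (b + d).
Proof.
by move=> ab /place_graphN; rewrite -{2}(opprK c) -{2}(opprK d); apply: GB.
Qed.

Lemma place_graph_sum (I : Type) (r : seq I) (P : pred I) (f g : I -> L) :
  (forall i, P i -> G (f i) (g i)) ->
  G (\sum_(i <- r | P i) f i) (\sum_(i <- r | P i) g i).
Proof.
move=> fg; apply: (big_ind2 (fun x y => G x y)) => //; first exact: place_graph0.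
exact: place_graphD.
Qed.

Lemma place_graph_prod (I : Type) (r : seq I) (P : pred I) (f g : I -> L) :
  (forall i, P i -> G (f i) (g i)) ->
  G (\prod_(i <- r | P i) f i) (\prod_(i <- r | P i) g i).
Proof. by move=> fg; apply: (big_ind2 (fun x y => G x y)). Qed.

Lemma place_graphX n a b : G a b -> G (a ^+ n) (b ^+ n).
Proof. by move=> ab; elim: n => [|n IH] //; rewrite !exprS; apply: GM. Qed.

Lemma place_graph_det n (A B : 'M[L]_n) :
  (forall i j, G (A i j) (B i j)) -> G (\det A) (\det B).
Proof.
move=> AB; apply: place_graph_sum => s _; apply: GM.
  by case: (odd_perm s); rewrite ?expr0 ?expr1 //; apply: place_graphN.
by apply: place_graph_prod.
Qed.

Lemma place_graph_fun a b c : G a b -> G a c -> b = c.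
Proof.
case: plG => _ _ _ h ab ac; apply/eqP; rewrite -subr_eq0; apply/eqP/h.
by rewrite -(subrr a); apply: GB.
Qed.

Definition coef_graph (P Q : {poly L}) := forall i, G P`_i Q`_i.

Lemma coef_graphC a b : G a b -> coef_graph a%:P b%:P.
Proof.
by move=> ab i; rewrite !coefC; case: eqP => // _; apply: place_graph0.
Qed.

Lemma coef_graphX : coef_graph 'X 'X.
Proof.
by move=> i; rewrite !coefX; case: eqP => // _; apply: place_graph0.
Qed.

Lemma coef_graphB P Q P' Q' :
  coef_graph P Q -> coef_graph P' Q' -> coef_graph (P - P') (Q - Q').
Proof. by move=> h h' i; rewrite !coefB; apply: GB. Qed.

Lemma coef_graphM P Q P' Q' :
  coef_graph P Q -> coef_graph P' Q' -> coef_graph (P * P') (Q * Q').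
Proof. by move=> h h' i; rewrite !coefM; apply: place_graph_sum => k _; apply: GM. Qed.

Lemma coef_graphXn n : coef_graph 'X^n 'X^n.
Proof.
elim: n => [|n IH]; first by rewrite !expr0; apply: coef_graphC.
by rewrite !exprS; apply: coef_graphM => //; apply: coef_graphX.
Qed.

End PlaceGraph.

Section PlaceMax.
Variables (L : closedFieldType) (G : L -> L -> Prop).
Hypothesis plG : place_graph G.
Hypothesis maxG : forall G' : L -> L -> Prop, place_graph G' ->
  (forall a b, G a b -> G' a b) -> forall a b, G' a b -> G a b.

Let G1 : G 1 1. Proof. by case: plG. Qed.
Let GM a b c d : G a b -> G c d -> G (a * c) (b * d).
Proof. by case: plG => _ _ h _; apply: h. Qed.

(** The values at [x] and [c] of paired polynomials form a larger graph, which the hypothesis keeps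
    well defined; maximality puts it back into [G]. *)
Lemma place_adjoin x c :
  (forall P Q, coef_graph G P Q -> P.[x] = 0 -> Q.[c] = 0) -> G x c.
Proof.
move=> xc.
apply: (maxG (G' := fun a b => exists P Q, [/\ coef_graph G P Q, a = P.[x] & b = Q.[c]])).
- split.
  + by exists 1%:P, 1%:P; split; rewrite ?hornerC //; apply: coef_graphC.
  + move=> _ _ _ _ [P [Q [h -> ->]]] [P' [Q' [h' -> ->]]].
    exists (P - P'), (Q - Q'); rewrite !hornerE; split=> //; exact: coef_graphB.
  + move=> _ _ _ _ [P [Q [h -> ->]]] [P' [Q' [h' -> ->]]].
    exists (P * P'), (Q * Q'); rewrite !hornerE; split=> //; exact: coef_graphM.
  + by move=> _ [P [Q [h /esym P0 ->]]]; apply: (xc P).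
- by move=> a b ab; exists a%:P, b%:P; rewrite !hornerC; split=> //; apply: coef_graphC.
- by exists 'X, 'X; rewrite !hornerX; split=> //; apply: coef_graphX.
Qed.

(** Multiplying a relation of [a^-1] by [a ^+ n] gives a relation of [a], whose specialization at
    [b] is known. *)
Lemma place_inv a b : b != 0 -> G a b -> G a^-1 b^-1.
Proof.
move=> b0 ab; have a0 : a != 0.
  by apply: contraNneq b0 => a0; case: plG => _ _ _ /(_ b); rewrite -a0 => /(_ ab) ->.
apply: place_adjoin => P Q PQ P0.
pose n := maxn (size P) (size Q).
have key c (R : {poly L}) : c != 0 -> (size R <= n)%N ->
    c ^+ n * R.[c^-1] = \sum_(i < n) R`_i * c ^+ (n - i).
  move=> c0 sR; rewrite (horner_coef_wide _ sR) mulr_sumr; apply: eq_bigr => i _.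
  rewrite mulrCA; congr (_ * _); rewrite -{1}(subnK (ltnW (ltn_ord i))) exprD.
  by rewrite -mulrA exprVn mulfV ?mulr1 // expf_neq0.
have h : G (a ^+ n * P.[a^-1]) (b ^+ n * Q.[b^-1]).
  rewrite !key ?leq_maxl ?leq_maxr //; apply: place_graph_sum => // i _.
  by apply: GM => //; apply: place_graphX.
rewrite P0 mulr0 in h; case: plG => _ _ _ /(_ _ h) /eqP.
by rewrite mulf_eq0 expf_eq0 (negPf b0) andbF => /eqP.
Qed.

(** The obstruction to a finite value at [x]: the kernel of the place generates the unit ideal once
    [x] is adjoined. The constant term has been moved to the left and divided out. *)
Definition place_rel x n (m : nat -> L) :=
  (forall i, G (m i) 0) /\ 1 = \sum_(i < n) m i * x ^+ i.+1.

(** The specializations [Q] of the polynomials vanishing at [x] form an ideal. A root of its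
    generator is a possible value of [x]; a constant generator yields the relation. *)
Lemma place_or_rel x : (exists c, G x c) \/ exists n m, place_rel x n m.
Proof.
pose I P Q := coef_graph G P Q /\ P.[x] = 0.
have [all0|] := pselect (forall P Q, I P Q -> Q = 0).
  by left; exists 0; apply: place_adjoin => P Q PQ P0; rewrite (all0 P Q (conj PQ P0)) horner0.
move=> /existsNP[P0] /existsNP[Q0] /not_implyP[IP0 /eqP Q0n0].
have exs : exists n, `[< exists P Q, [/\ I P Q, Q != 0 & size Q = n] >].
  by exists (size Q0); apply/asboolP; exists P0, Q0.
case: (ex_minnP exs) => n /asboolP[P [Q [[PQ Px] Qn0 sQ]]] minn.
have lQ : lead_coef Q != 0 by rewrite lead_coef_eq0.
(* [P] may have larger degree than [Q], its higher coefficients lying in the kernel, so the lift of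
   the leading coefficient of [Q] is not the leading coefficient of [P]. *)
pose a := P`_(size Q).-1; have la : G a (lead_coef Q) by apply: PQ.
have iG := place_inv lQ la.
have [n1|n1] := leqP n 1.
  right; have Qc : Q = (lead_coef Q)%:P.
    have /size_poly1P[c _ ->] : size Q == 1%N by rewrite eqn_leq size_poly_gt0 Qn0 sQ n1.
    by rewrite lead_coefC.
  have aE : a = P`_0.
    by rewrite /a sQ; congr (nth 0 P _); case: n {sQ minn} n1 => [|[]].
  have a0 : a != 0.
    by apply: contraNneq lQ => a0; rewrite a0 in la; case: plG => _ _ _ /(_ _ la) ->.
  exists (size P).-1, (fun i => - (a^-1 * P`_i.+1)); split.
    move=> i; rewrite -[X in G _ X]oppr0; apply: place_graphN => //.
    by have := GM iG (PQ i.+1); rewrite {2}Qc coefC mulr0.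
  have : P.[x] = a + \sum_(i < (size P).-1) P`_i.+1 * x ^+ i.+1.
    rewrite (@horner_coef_wide _ (size P).-1.+1) ?leqSpred // big_ord_recl expr0 mulr1 aE.
    by [].
  rewrite Px => /esym/eqP; rewrite addrC addr_eq0 => /eqP e.
  apply: (mulfI a0); rewrite mulr1 mulr_sumr.
  rewrite -[LHS]opprK -e -sumrN; apply: eq_bigr => i _.
  by rewrite mulNr mulrN mulrA mulrA mulfV // mul1r.
left; have /closed_rootP[c /rootP Qc] : size Q != 1%N by rewrite sQ; case: n n1 {sQ minn} => [|[]].
exists c; apply: place_adjoin => P' Q' h' P'x.
(* Euclidean division of [Q'] by [Q], carried out in parallel on the lifts; minimality of [Q] lets
   it continue down to 0. *)
have [k] := ubnP (size Q'); elim: k => // k IH in P' Q' h' P'x *; rewrite ltnS => sk.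
have [->|Q'n0] := eqVneq Q' 0; first by rewrite horner0.
have nle : (size Q <= size Q')%N.
  by rewrite sQ; apply: minn; apply/asboolP; exists P', Q'.
pose u := P'`_(size Q').-1.
have uG : G u (lead_coef Q') by apply: h'.
pose T1 : {poly L} := (u * a^-1)%:P * 'X^(size Q' - size Q).
pose T2 : {poly L} := (lead_coef Q' * (lead_coef Q)^-1)%:P * 'X^(size Q' - size Q).
have TG : coef_graph G T1 T2.
  apply: coef_graphM => //; last exact: coef_graphXn.
  by apply: coef_graphC => //; apply: GM.
have := IH (P' - T1 * P) (Q' - T2 * Q).
rewrite !hornerD !hornerN !hornerM Px mulr0 subr0 Qc mulr0 subr0; apply => //.
  by apply: coef_graphB => //; apply: coef_graphM.
apply: leq_trans sk.
have sQ0 : (0 < size Q)%N by rewrite size_poly_gt0.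
have sQ'0 : (0 < size Q')%N by rewrite size_poly_gt0.
have sT : (size (T2 * Q)%R <= size Q')%N.
  rewrite /T2 -mulrA; apply: leq_trans (size_polyMleq _ _) _.
  rewrite size_polyC size_monicM ?monicXn // size_polyXn.
  by rewrite addSn /= subnK //; case: eqP => _; rewrite ?add0n ?leq_pred ?add1n.
rewrite -(prednK sQ'0) ltnS; apply/leq_sizeP => i.
rewrite leq_eqVlt => /orP[/eqP <-|hi].
  rewrite coefB /T2 -mulrA coefCM mulrC coefXnM.
  rewrite ltnNge leq_subLR (_ : _ <= _)%N /=; last first.
    by move: nle sQ0 sQ'0; set u1 := size Q; set u2 := size Q'; lia.
  rewrite (_ : _ - _ = (size Q).-1)%N; last first.
    by move: nle sQ0 sQ'0; set u1 := size Q; set u2 := size Q'; lia.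
  by rewrite -!lead_coefE; field.
rewrite nth_default //; apply: leq_trans (size_polyD _ _) _.
by rewrite -(prednK sQ'0) in sT *; rewrite size_polyN geq_max hi (leq_trans sT).
Qed.

(* Both relations present every monomial [x ^+ e], [e < n + k], as a
   combination of such monomials with coefficients in the kernel of the place,
   so [1 - A] is singular while its determinant specializes to 1. *)
Lemma place_rel_contra x n k m m' :
  x != 0 -> place_rel x n m -> place_rel x^-1 k m' -> False.
Proof.
move=> x0 [mG m1] [m'G m'1].
pose N := (k + n)%N.
(* For [e < k] the first relation times [x ^+ e] reaches exponents at most [e + n < N]; for [e >= k]
   the second one goes down to [e - k] at worst. So [k + n] powers are closed under the
   rewriting. *)
pose C (e i : nat) := if (e < k)%N
  then \sum_(l < n) (if i == (e + l.+1)%N then m l else 0)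
  else \sum_(l < k) (if i == (e - l.+1)%N then m' l else 0).
have CG e i : G (C e i) 0.
  have G0 := place_graph0 plG.
  have Gs (r : nat) (u : nat -> L) (P : pred nat) : (forall l, G (u l) 0) ->
      G (\sum_(l < r) (if P l then u l else 0)) 0.
    move=> uG; apply: (big_ind (fun y => G y 0)) => // [y z yG zG|l _].
      by rewrite -[X in G _ X](addr0 0); apply: place_graphD.
    by case: ifP.
  by rewrite /C; case: ifP => _;
    [exact: (Gs n m (fun l => i == e + l.+1)%N)|exact: (Gs k m' (fun l => i == e - l.+1)%N)].
have pick (r : nat) (u : nat -> L) (v : nat -> nat) :
    (forall l, (l < r)%N -> (v l < N)%N) ->
    \sum_(i < N) (\sum_(l < r) (if val i == v l then u l else 0)) * x ^+ i =
    \sum_(l < r) u l * x ^+ v l.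
  move=> vN; under eq_bigr do rewrite mulr_suml.
  rewrite exchange_big /=; apply: eq_bigr => l _.
  rewrite (bigD1 (Ordinal (vN _ (ltn_ord l)))) //= eqxx big1 ?addr0 // => i /negPf.
  by rewrite -val_eqE /= => ->; rewrite mul0r.
have Cx e : (e < N)%N -> x ^+ e = \sum_(i < N) C e i * x ^+ i.
  move=> eN; rewrite /C; case: ltnP => ek.
    rewrite (pick _ _ (fun l => e + l.+1)%N) => [|l ln]; last by rewrite /N; lia.
    rewrite -[LHS]mulr1 m1 mulr_sumr; apply: eq_bigr => l _.
    by rewrite mulrCA -exprD.
  rewrite (pick _ _ (fun l => e - l.+1)%N) => [|l ln]; last by lia.
  rewrite -[LHS]mulr1 m'1 mulr_sumr; apply: eq_bigr => l _.
  rewrite mulrCA; congr (_ * _); rewrite exprVn.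
  rewrite -{1}(subnK (leq_trans (ltn_ord l) ek)).
  by rewrite exprD mulfK ?expf_neq0.
pose A := \matrix_(i < N, j < N) ((i == j)%:R - C i j).
have N0 : (0 < N)%N.
  rewrite lt0n; apply/eqP => N0.
  by move: m1; rewrite (_ : n = 0%N) ?big_ord0 => [/eqP|]; rewrite ?oner_eq0 //; rewrite /N in N0; lia.
have detA : G (\det A) (\det (1%:M : 'M[L]_N)).
  apply: place_graph_det => // i j; rewrite !mxE -[X in G _ X]subr0.
  case: plG => _ h _ _; apply: h => //.
  by case: eqP => _ /=; [exact: G1|exact: place_graph0].
have v0 : A *m (\col_i x ^+ (val i)) = 0.
  apply/matrixP => i j; rewrite !mxE.
  under eq_bigr do rewrite !mxE mulrBl.
  rewrite sumrB (bigD1 i) //= eqxx mul1r big1 => [|l /negPf h]; last by rewrite eq_sym h mul0r.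
  by rewrite addr0 {1}(Cx i) // subrr.
have : \det A = 0.
  apply/eqP; rewrite -[_ == 0]negbK -unitfE -/(A \in unitmx); apply/negP => uA.
  have := congr1 (mulmx (invmx A)) v0; rewrite mulKmx // mulmx0 => /matrixP/(_ (Ordinal N0) 0).
  by rewrite !mxE expr0 => /eqP; rewrite oner_eq0.
move=> d0; rewrite d0 det1 in detA.
by case: plG => _ _ _ /(_ _ detA)/eqP; rewrite oner_eq0.
Qed.

Lemma place_valring : valring (fun x => exists b, G x b).
Proof.
split; first by exists 1.
- by move=> x y [b xb] [c yc]; exists (b - c); case: plG => _ h _ _; apply: h.
- by move=> x y [b xb] [c yc]; exists (b * c); apply: GM.
move=> x; have [->|x0] := eqVneq x 0.
  by left; exists 0; apply: place_graph0.
have [|[n [m h]]] := place_or_rel x; first by left.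
have [|[k [m' h']]] := place_or_rel x^-1; first by right.
by case: (place_rel_contra x0 h h').
Qed.

End PlaceMax.

Lemma place_extend (L : closedFieldType) (G0 : L -> L -> Prop) :
  place_graph G0 -> exists G : L -> L -> Prop,
  [/\ place_graph G, forall a b, G0 a b -> G a b,
      valring (fun x => exists b, G x b) &
      forall a b, G a b -> b != 0 -> G a^-1 b^-1].
Proof.
move=> pl0.
(* Zorn's lemma runs over the added pairs only, so that the empty chain corresponds to [G0]
   itself. *)
pose U (A : set (L * L)) a b := G0 a b \/ A (a, b).
have [F FP totF|A [PA maxA]] := @Zorn_bigcup _ [set A | place_graph (U A)].
  have two a b c d : U (\bigcup_(X in F) X)%classic a b ->
      U (\bigcup_(X in F) X)%classic c d ->
      (G0 a b /\ G0 c d) \/ exists2 X, F X & U X a b /\ U X c d.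
    move=> [ab|[X FX ab]] [cd|[Y FY cd]]; [by left|right|right|right].
    - by exists Y => //; split; [left|right].
    - by exists X => //; split; [right|left].
    - by have [XY|YX] := totF _ _ FX FY; [exists Y|exists X] => //; split; right; auto.
  split.
  - by left; case: pl0.
  - move=> a b c d h1 h2; have [[g1 g2]|[X FX [g1 g2]]] := two _ _ _ _ h1 h2.
      by left; case: pl0 => _ h _ _; apply: h.
    case: (FP _ FX) => _ h _ _; have [|] := h _ _ _ _ g1 g2; first by left.
    by right; exists X.
  - move=> a b c d h1 h2; have [[g1 g2]|[X FX [g1 g2]]] := two _ _ _ _ h1 h2.
      by left; case: pl0 => _ _ h _; apply: h.
    case: (FP _ FX) => _ _ h _; have [|] := h _ _ _ _ g1 g2; first by left.
    by right; exists X.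
  - move=> b [h|[X FX h]]; first by case: pl0 => _ _ _; apply.
    by case: (FP _ FX) => _ _ _; apply; right.
have maxU (G' : L -> L -> Prop) : place_graph G' ->
    (forall a b, U A a b -> G' a b) -> forall a b, G' a b -> U A a b.
  move=> pl' sub a b ab; apply: contrapT => nab.
  have := maxA [set z | G' z.1 z.2]%classic; apply.
    split; first by move=> [c d] h; apply: sub; right.
    by move=> /(_ (a, b) ab) h; apply: nab; right.
  rewrite /= (_ : U _ = G') //; apply/funext => c; apply/funext => d.
  by apply/propext; split=> [[h|]//|h]; [apply: sub; left|right].
exists (U A); split=> //; first by left.
  exact: place_valring.
by move=> a b ab b0; apply: place_inv.
Qed.

(** * Automorphisms of an algebraic closure *)

Lemma valring_integral (L : fieldType) (O : L -> Prop) (P : {poly L}) x :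
  valring O -> P \is monic -> (forall i, O P`_i) -> root P x -> O x.
Proof.
move=> [O1 OB OM OV] Pm OP /rootP Px.
have O0 : O 0 by rewrite -(subrr 1); apply: OB.
have OD a b : O a -> O b -> O (a + b).
  by move=> Oa Ob; rewrite -(opprK b); apply: (OB) => //; rewrite -sub0r; apply: OB.
have [//|Ox] := OV x; have [->//|x0] := eqVneq x 0.
case sP : (size P) => [|n].
  by move/eqP: sP; rewrite size_poly_eq0 => /eqP P0; move: Pm; rewrite P0 monicE lead_coef0 eq_sym oner_eq0.
have Pn : P`_n = 1 by move/monicP: Pm; rewrite lead_coefE sP.
case: n => [|n] in sP Pn *.
  have /size_poly1P[c c0 Pc] : size P == 1%N by rewrite sP.
  by move: Px c0; rewrite Pc hornerC => ->; rewrite eqxx.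
rewrite horner_coef sP big_ord_recr /= Pn mul1r in Px.
have xE : x = - \sum_(i < n.+1) P`_i * x^-1 ^+ (n - i).
  have xn0 : x ^+ n != 0 by rewrite expf_neq0.
  apply: (mulfI xn0); rewrite mulrN mulr_sumr -exprSr.
  apply/eqP; rewrite -addr_eq0 addrC -[X in _ == X]Px; apply/eqP; congr (_ + _).
  apply: eq_bigr => i _; rewrite mulrCA; congr (_ * _).
  have le_in : (i <= n)%N by rewrite -ltnS.
  by rewrite -{1}(subnKC le_in) exprD exprVn mulfK ?expf_neq0.
have OX k : O (x^-1 ^+ k) by elim: k => [|k IH]; rewrite ?expr0 ?exprS //; apply: OM.
rewrite xE -sub0r; apply: (OB) => //.
by apply: (big_ind O) => // i _; apply: OM.
Qed.

Lemma root_list (L : closedFieldType) (P : {poly L}) : P != 0 ->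
  exists rs : seq L, uniq rs /\ forall x, root P x = (x \in rs).
Proof.
move=> P0; have [r rE] := closed_field_poly_normal P.
exists (undup r); split; first exact: undup_uniq.
by move=> x; rewrite {1}rE rootZ ?lead_coef_eq0 // root_prod_XsubC mem_undup.
Qed.

Section Aut.
Variables (B : fieldType) (L : closedFieldType) (iB : {rmorphism B -> L}).
Hypothesis algL : is_algebraic_closure iB.
Implicit Types (s : {rmorphism L -> L}).

Definition fixes s := forall b, s (iB b) = iB b.

Lemma fixes_root s P x : fixes s -> root (map_poly iB P) x -> root (map_poly iB P) (s x).
Proof.
move=> sB /rootP Px; apply/rootP.
have -> : map_poly iB P = map_poly s (map_poly iB P).
  by rewrite -map_poly_comp; apply: eq_map_poly => b /=; rewrite sB.
by rewrite horner_map Px rmorph0.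
Qed.

Lemma fixes_comp s t : fixes s -> fixes t -> fixes (s \o t).
Proof. by move=> sB tB b /=; rewrite tB sB. Qed.

Lemma rmorphism_of (s : L -> L) : s 1 = 1 -> {morph s : x y / x - y} ->
  {morph s : x y / x * y} -> exists s' : {rmorphism L -> L}, s' =1 s.
Proof.
move=> s1 sB sM.
pose mA := GRing.isZmodMorphism.Build L L s sB.
pose mM := GRing.isMonoidMorphism.Build L L s (s1, sM).
pose f : {rmorphism L -> L} := HB.pack s mA mM.
by exists f.
Qed.

(** Relations of [z] hold for [z'], so some place sends [z] to [z'] and is the identity on the base.
    By integrality it is defined on all of [L], hence it is an endomorphism. *)
Lemma conj_aut z z' :
  (forall P, root (map_poly iB P) z -> root (map_poly iB P) z') ->
  exists s, fixes s /\ s z = z'.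
Proof.
move=> zz'.
have [|G [plG G0 vG _]] := @place_extend L (fun a b =>
    exists P, a = (map_poly iB P).[z] /\ b = (map_poly iB P).[z']).
  split.
  - by exists 1; rewrite rmorph1 !hornerC.
  - by move=> _ _ _ _ [P [-> ->]] [Q [-> ->]]; exists (P - Q); rewrite rmorphB !hornerE.
  - by move=> _ _ _ _ [P [-> ->]] [Q [-> ->]]; exists (P * Q); rewrite rmorphM !hornerE.
  - by move=> _ [P [/esym/rootP/zz'/rootP e ->]].
have Gb b : G (iB b) (iB b) by apply: G0; exists b%:P; rewrite map_polyC !hornerC.
have tot x : exists b, G x b.
  have [P [P0 Px]] := algL x.
  pose Q := (lead_coef P)^-1 *: P.
  have Qm : Q \is monic by rewrite monicE lead_coefZ mulVf // lead_coef_eq0.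
  apply: (valring_integral vG (P := map_poly iB Q)).
  - by rewrite map_monic.
  - by move=> i; rewrite coef_map; exists (iB Q`_i); apply: Gb.
  - by rewrite map_polyZ rootZ // fmorph_eq0 invr_eq0 lead_coef_eq0.
pose f x := sval (cid (tot x)); have fG x : G x (f x) := svalP (cid (tot x)).
have fE x b : G x b -> f x = b by move=> h; apply: (place_graph_fun plG) h.
have [s sf] : exists s : {rmorphism L -> L}, s =1 f.
  case: plG => g1 gB gM _; apply: rmorphism_of.
  - exact: fE.
  - by move=> x y; apply: fE; apply: gB.
  - by move=> x y; apply: fE; apply: gM.
exists s; split; first by move=> b; rewrite sf; apply: fE.
by rewrite sf; apply: fE; apply: G0; exists 'X; rewrite map_polyX !hornerX.
Qed.

Lemma conj_list x : exists rs : seq L, forall s, fixes s -> s x \in rs.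
Proof.
have [P [P0 Px]] := algL x.
have [|rs [_ rsE]] := @root_list L (map_poly iB P); first by rewrite map_poly_eq0.
by exists rs => s sB; rewrite -rsE; apply: fixes_root.
Qed.

(** An injective map permutes the finite root set of each polynomial over [B]. *)
Lemma fixes_inv s : fixes s ->
  exists t : {rmorphism L -> L}, [/\ fixes t, cancel s t & cancel t s].
Proof.
move=> sB.
have surj y : exists x, s x = y.
  have [P [P0 Py]] := algL y.
  have [|rs [urs rsE]] := @root_list L (map_poly iB P); first by rewrite map_poly_eq0.
  have sub : {subset map s rs <= rs}.
    by move=> _ /mapP[x xr ->]; rewrite -rsE; apply: fixes_root; rewrite ?rsE.
  have u : uniq (map s rs) by rewrite map_inj_uniq //; apply: fmorph_inj.
  have [_ e] := uniq_min_size u sub (eq_leq (esym (size_map s rs))).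
  have : y \in map s rs by rewrite e -rsE.
  by case/mapP => x _ ->; exists x.
pose t y := sval (cid (surj y)); have tK y : s (t y) = y := svalP (cid (surj y)).
have sI : injective s := fmorph_inj s.
have [t' tE] : exists t' : {rmorphism L -> L}, t' =1 t.
  apply: rmorphism_of; first by apply: sI; rewrite tK rmorph1.
  - by move=> x y; apply: sI; rewrite rmorphB !tK.
  - by move=> x y; apply: sI; rewrite rmorphM !tK.
exists t'; split.
- by move=> b; apply: sI; rewrite tE tK sB.
- by move=> x; apply: sI; rewrite tE tK.
- by move=> x; rewrite tE tK.
Qed.

(** Every root of the minimal polynomial is conjugate to [z], hence equal to it; the exponent [k.+1]
    is the purely inseparable degree. *)
Lemma fixed_minpoly z : (forall s, fixes s -> s z = z) ->
  exists m k, [/\ m \is monic, map_poly iB m = ('X - z%:P) ^+ k.+1 &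
    forall P, root (map_poly iB P) z -> m %| P].
Proof.
move=> zfix.
have exn : exists n, `[< exists P : {poly B}, [/\ P != 0, root (map_poly iB P) z & size P = n] >].
  by have [P [P0 Pz]] := algL z; exists (size P); apply/asboolP; exists P.
case: (ex_minnP exn) => n /asboolP[P [P0 Pz sP]] minn.
pose m : {poly B} := (lead_coef P)^-1 *: P.
have l0 : (lead_coef P)^-1 != 0 by rewrite invr_eq0 lead_coef_eq0.
have mm : m \is monic by rewrite monicE lead_coefZ mulVf // lead_coef_eq0.
have mdvd Q : root (map_poly iB Q) z -> m %| Q.
  move=> Qz; rewrite dvdpZl // /dvdp; apply: contraT => R0.
  have /negP[] : ~~ (size (Q %% P)%R < size P)%N.
    rewrite -leqNgt sP; apply: minn; apply/asboolP; exists (Q %% P); split=> //.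
    move: Qz; rewrite {1}(divp_eq Q P) rmorphD rmorphM /= !rootE !hornerE.
    by move/rootP: Pz => ->; rewrite mulr0 add0r.
  by rewrite ltn_modp.
have [r rE] := closed_field_poly_normal (map_poly iB m).
rewrite (monicP _) ?map_monic // scale1r in rE.
have rz x : x \in r -> x = z.
  rewrite -root_prod_XsubC -rE => mx.
  have [|s [sB <-]] := @conj_aut z x; last exact: zfix.
  move=> Q /mdvd/dvdpP[T ->]; rewrite rmorphM /= rootM.
  by rewrite mx orbT.
have mz : root (map_poly iB m) z by rewrite map_polyZ rootZ // fmorph_eq0.
exists m, (size r).-1; split=> //.
have r0 : (0 < size r)%N by case: r rE {rz} => // e; move: mz; rewrite e big_nil (negPf (root1 _)).
rewrite rE prednK // (eq_big_seq (fun=> 'X - z%:P)) ?big_const_seq ?count_predT.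
  by elim: (size r) => //= k ->; rewrite exprS.
by move=> x /rz ->.
Qed.

Lemma fixed_pow z : (forall s, fixes s -> s z = z) ->
  exists k b, z ^+ k.+1 = iB b.
Proof.
move=> /fixed_minpoly[m [k [_ mE _]]]; exists k, ((-1) ^+ k.+1 * m.[0]).
rewrite rmorphM rmorphXn rmorphN rmorph1 -[iB m.[0]]horner_map mE rmorph0 horner_exp !hornerE.
by rewrite -exprMn mulN1r opprK.
Qed.

Lemma fixed_separable z P : (forall s, fixes s -> s z = z) ->
  separable_poly P -> root (map_poly iB P) z -> exists b, z = iB b.
Proof.
move=> /fixed_minpoly[m [k [_ mE dvd]]] sepP /dvd mP.
have : separable_poly (('X - z%:P) ^+ k.+1).
  by rewrite -mE separable_map; apply: dvdp_separable sepP.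
case: k mE => [mE _|k mE /separable_nosquare sq]; last first.
  by have := sq ('X - z%:P) k.+2 isT; rewrite dvdpp size_XsubC => /(_ isT).
exists (- m`_0); rewrite expr1 in mE.
by rewrite rmorphN -coef_map mE coefB coefX coefC /= sub0r opprK.
Qed.

(** Sums over this finite list of automorphisms, taken up to equality on [S], stand for sums over
    conjugate places of the field generated by [S]. *)
Lemma finite_restrictions (S : seq L) :
  exists n (s : 'I_n -> {rmorphism L -> L}),
  [/\ forall i, fixes (s i),
      forall t, fixes t -> exists i, {in S, s i =1 t} &
      forall i j, {in S, s i =1 s j} -> i = j].
Proof.
have [cand candP] : exists cand : seq (seq L), forall s, fixes s -> map s S \in cand.
  elim: S => [|x S [cand candP]]; first by exists [:: [::]].
  have [rs rsP] := conj_list x.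
  exists [seq a :: c | a <- rs, c <- cand] => s sB /=.
  by apply/allpairsP; exists (s x, map s S); rewrite rsP // candP.
pose c' := undup [seq c <- cand | `[< exists s, fixes s /\ map s S = c >]].
have wit (i : 'I_(size c')) : exists s, fixes s /\ map s S = nth [::] c' i.
  have : nth [::] c' i \in c' by rewrite mem_nth.
  by rewrite mem_undup mem_filter => /andP[/asboolP].
exists (size c'), (fun i => sval (cid (wit i))); split.
- by move=> i; case: (svalP (cid (wit i))).
- move=> t tB; have tc : map t S \in c'.
    by rewrite mem_undup mem_filter candP // andbT; apply/asboolP; exists t.
  have ht : (index (map t S) c' < size c')%N by rewrite index_mem.
  have [_ h] := svalP (cid (wit (Ordinal ht))).
  exists (Ordinal ht); apply/eq_in_map; apply: (etrans h).
  exact: nth_index.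
- move=> i j ij; have [_ hi] := svalP (cid (wit i)); have [_ hj] := svalP (cid (wit j)).
  apply/val_inj/eqP; rewrite -(nth_uniq [::] (ltn_ord i) (ltn_ord j) (undup_uniq _)).
  by rewrite -/c' -hi -hj; apply/eqP/eq_in_map.
Qed.

End Aut.

(* Distinct but convertible canonical types on [size] defeat [lia]. *)
Ltac slia := repeat match goal with
  |- context [@size ?T ?p] => let n := fresh "n" in set n := (@size T p); clearbody n end; lia.

(** * The group law *)

Section CoordRing.
Variables (L : fieldType) (a1 a2 a3 a4 a6 : L).

(* [L[x, y]] modulo the Weierstrass equation; [(a, b)] stands for [a + b y]. *)
Definition cring (a1 a2 a3 a4 a6 : L) : Type := ({poly L} * {poly L})%type.
Local Notation A := (cring a1 a2 a3 a4 a6).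

HB.instance Definition _ := GRing.Zmodule.on A.

Definition cr_h : {poly L} := a1 *: 'X + a3%:P.
Definition cr_g : {poly L} := 'X^3 + a2 *: 'X^2 + a4 *: 'X + a6%:P.

Definition cr_one : A := (1, 0).
Definition cr_mul (u v : A) : A :=
  (u.1 * v.1 + u.2 * v.2 * cr_g, u.1 * v.2 + u.2 * v.1 - u.2 * v.2 * cr_h).

Fact cr_mulA : associative cr_mul.
Proof. by move=> [a b] [c d] [e f]; rewrite /cr_mul /=; congr (_, _); ring. Qed.
Fact cr_mulC : commutative cr_mul.
Proof. by move=> [a b] [c d]; rewrite /cr_mul /=; congr (_, _); ring. Qed.
Fact cr_mul1 : left_id cr_one cr_mul.
Proof. by move=> [a b]; rewrite /cr_mul /=; congr (_, _); ring. Qed.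
Fact cr_mulDl : left_distributive cr_mul +%R.
Proof.
move=> [a b] [c d] [e f].
rewrite /cr_mul [LHS]/= [RHS]/=.
transitivity ((a + c) * e + (b + d) * f * cr_g, (a + c) * f + (b + d) * e - (b + d) * f * cr_h); first by [].
transitivity (a * e + b * f * cr_g + (c * e + d * f * cr_g), a * f + b * e - b * f * cr_h + (c * f + d * e - d * f * cr_h)); last by [].
by congr (_, _); ring.
Qed.
Fact cr_one_neq0 : cr_one != 0.
Proof. by apply/eqP => -[/eqP]; rewrite oner_eq0. Qed.

HB.instance Definition _ :=
  GRing.Zmodule_isComNzRing.Build A cr_mulA cr_mulC cr_mul1 cr_mulDl cr_one_neq0.

Lemma cr_mulE (u v : A) : u * v = cr_mul u v. Proof. by []. Qed.

Lemma cr_addE (u v : A) : u + v = (u.1 + v.1, u.2 + v.2). Proof. by []. Qed.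

Definition cr_eval (x y : L) (u : A) := u.1.[x] + u.2.[x] * y.

Lemma cr_evalD x y (u v : A) : cr_eval x y (u + v) = cr_eval x y u + cr_eval x y v.
Proof. by rewrite /cr_eval cr_addE /= !hornerD mulrDl addrACA. Qed.

Lemma cr_evalM x y (u v : A) : on_curve a1 a2 a3 a4 a6 (Some (x, y)) ->
  cr_eval x y (u * v) = cr_eval x y u * cr_eval x y v.
Proof.
move=> /eqP e; rewrite cr_mulE; case: u v => [a b] [c d].
rewrite /cr_eval /cr_mul /cr_g /cr_h /= !hornerE /=.
have -> : x ^+ 3 + a2 * x * x + a4 * x + a6 = y ^+ 2 + a1 * x * y + a3 * y by rewrite e; ring.
move: a.[x] b.[x] c.[x] d.[x] => u v w t; ring.
Qed.

(** The norm to [L[x]], that is the product with the conjugate under [y |-> - y - h]. *)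
Definition cr_norm (u : A) : {poly L} := u.1 ^+ 2 - u.1 * u.2 * cr_h - u.2 ^+ 2 * cr_g.

Lemma cr_normM u v : cr_norm (u * v) = cr_norm u * cr_norm v.
Proof. by rewrite cr_mulE; case: u v => [a b] [c d]; rewrite /cr_norm /cr_mul /=; ring. Qed.

Lemma size_cr_g : size cr_g = 4%N.
Proof.
rewrite /cr_g -!addrA size_polyDl size_polyXn //.
apply: leq_ltn_trans (size_polyD _ _) _; rewrite gtn_max.
rewrite (leq_ltn_trans (size_scale_leq _ _)) ?size_polyXn //=.
apply: leq_ltn_trans (size_polyD _ _) _; rewrite gtn_max.
rewrite (leq_ltn_trans (size_scale_leq _ _)) ?size_polyX //=.
by rewrite (leq_ltn_trans (size_polyC_leq1 _)).
Qed.

Lemma size_cr_h : (size cr_h <= 2)%N.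
Proof.
apply: leq_trans (size_polyD _ _) _; rewrite geq_max.
rewrite (leq_trans (size_scale_leq _ _)) ?size_polyX //=.
by rewrite (leq_trans (size_polyC_leq1 _)).
Qed.

(** The degrees of [a^2] and [b^2 g] have different parity, so these terms cannot cancel, and the
    mixed term has smaller degree than the larger of the two. *)
Lemma size_cr_norm_ge4 (u : A) : u.2 != 0 -> (4 <= size (cr_norm u))%N.
Proof.
case: u => a b /= b0.
have g0 : cr_g != 0 by rewrite -size_poly_gt0 size_cr_g.
have sb : (0 < size b)%N by rewrite size_poly_gt0.
have sbg : size (b ^+ 2 * cr_g) = (2 * size b + 2)%N.
  by rewrite size_mul ?expf_neq0 // size_cr_g expr2 size_mul //; move: sb; slia.
have [->|a0] := eqVneq a 0.
  rewrite /cr_norm /= expr0n /= mul0r mul0r subrr sub0r size_polyN sbg; move: sb; slia.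
have sa : (0 < size a)%N by rewrite size_poly_gt0.
have saa : size (a ^+ 2) = (2 * size a).-1 by rewrite expr2 size_mul // mul2n addnn.
have sab : (size (a * b * cr_h)%R <= size a + size b)%N.
  apply: leq_trans (size_polyMleq _ _) _; rewrite size_mul //.
  move: size_cr_h sa sb; slia.
rewrite /cr_norm /=; have [le|lt] := leqP (size a) (size b).+1.
  rewrite addrC size_polyDl size_polyN sbg; first by move: sb; slia.
  apply: leq_ltn_trans (size_polyD _ _) _; rewrite size_polyN gtn_max saa.
  by move: le sa sb sab; slia.
rewrite -addrA size_polyDl saa; first by move: lt sb; slia.
rewrite -opprD size_polyN; apply: leq_ltn_trans (size_polyD _ _) _; rewrite gtn_max sbg.
by move: lt sa sb sab; slia.
Qed.

Lemma cr_norm_poly (p : {poly L}) : cr_norm ((p, 0) : A) = p ^+ 2.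
Proof. by rewrite /cr_norm /=; ring. Qed.

Lemma cr_norm_neq0 u : u != 0 -> cr_norm u != 0.
Proof.
case: u => a b; have [->|b0] := eqVneq b 0; last first.
  by move=> _; rewrite -size_poly_gt0 (leq_trans _ (@size_cr_norm_ge4 (a, b) b0)).
by move=> a0; rewrite cr_norm_poly expf_neq0 //; apply: contraNneq a0 => ->.
Qed.

Lemma cr_mulf_neq0 (u v : A) : u != 0 -> v != 0 -> u * v != 0.
Proof.
move=> /cr_norm_neq0 u0 /cr_norm_neq0 v0; apply/eqP => uv.
by have := mulf_neq0 u0 v0; rewrite -cr_normM uv (cr_norm_poly 0) expr0n eqxx.
Qed.

Lemma cr_mulfI (u : A) : u != 0 -> injective ( *%R u).
Proof.
move=> u0 v w e; apply/eqP; rewrite -subr_eq0; apply: contraT => vw.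
by have := cr_mulf_neq0 u0 vw; rewrite mulrBr e subrr eqxx.
Qed.

(** The order of the pole at infinity: 2 for [x], 3 for [y], and never 1. This gap, peculiar to
    genus one, is what separates points by their ideals. *)
Definition cr_deg (u : A) := (size (cr_norm u)).-1.

Lemma cr_degM u v : u != 0 -> v != 0 -> cr_deg (u * v) = (cr_deg u + cr_deg v)%N.
Proof.
move=> /cr_norm_neq0 u0 /cr_norm_neq0 v0; rewrite /cr_deg cr_normM size_mul //.
by move: u0 v0; rewrite -!size_poly_gt0; slia.
Qed.

Lemma cr_deg_poly (p : {poly L}) : cr_deg ((p, 0) : A) = (2 * (size p).-1)%N.
Proof.
rewrite /cr_deg cr_norm_poly; have [->|p0] := eqVneq p 0; first by rewrite expr0n /= size_poly0.
by rewrite expr2 size_mul //; move: p0; rewrite -size_poly_gt0; slia.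
Qed.

Lemma cr_deg_small u : u != 0 -> (cr_deg u < 3)%N ->
  u = (u.1, 0) /\ cr_deg u = (2 * (size u.1).-1)%N.
Proof.
case: u => a b u0; have [->|b0] := eqVneq b 0; first by rewrite cr_deg_poly.
by have := @size_cr_norm_ge4 (a, b) b0; rewrite /cr_deg; case: size => //= n h1 h2; slia.
Qed.

Definition ideal (I : A -> Prop) :=
  [/\ I 0, forall u v, I u -> I v -> I (u + v) & forall u v, I u -> I (v * u)].

Definition princ (f : A) : A -> Prop := fun u => exists k, u = f * k.

(** The product ideal, as the least ideal containing the products; this avoids finite sums, and
    inclusions are proved by choosing [K]. *)
Definition mulI (I J : A -> Prop) : A -> Prop := fun u =>
  forall K, ideal K -> (forall a b, I a -> J b -> K (a * b)) -> K u.

Lemma eqI (I J : A -> Prop) : (forall u, I u -> J u) -> (forall u, J u -> I u) -> I = J.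
Proof. by move=> h1 h2; apply/funext => u; apply/propext; split; auto. Qed.

Lemma ideal_princ f : ideal (princ f).
Proof.
split; first by exists 0; rewrite mulr0.
- by move=> _ _ [k ->] [l ->]; exists (k + l); rewrite mulrDr.
- by move=> _ v [k ->]; exists (v * k); rewrite mulrCA.
Qed.

Lemma ideal_mulI I J : ideal (mulI I J).
Proof.
split.
- by move=> K [].
- by move=> u v hu hv K iK h; case: (iK) => _ KD _; exact: (KD _ _ (hu K iK h) (hv K iK h)).
- by move=> u v hu K iK h; case: (iK) => _ _ KM; exact: (KM _ _ (hu K iK h)).
Qed.

Lemma mulI_in (I J : A -> Prop) u v : I u -> J v -> mulI I J (u * v).
Proof. by move=> Iu Jv K _; apply. Qed.

Lemma mulIC I J : mulI I J = mulI J I.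
Proof.
by apply: eqI => u h; apply: h; try exact: ideal_mulI; move=> a b *;
  rewrite mulrC; apply: mulI_in.
Qed.

Lemma mulIA I J K : mulI I (mulI J K) = mulI (mulI I J) K.
Proof.
(* Quotient ideals allow the factors to be treated one at a time. *)
have tr M (P : A -> Prop) : ideal M -> ideal (fun u => forall v, P v -> M (u * v)).
  move=> [M0 MD MM]; split; first by move=> v _; rewrite mul0r.
  - by move=> u v hu hv w Pw; rewrite mulrDl; apply: MD; auto.
  - by move=> u v hu w Pw; rewrite -mulrA; apply: MM; auto.
have half I' J' K' u : mulI (mulI I' J') K' u -> mulI I' (mulI J' K') u.
  move=> h; apply: (h); first exact: ideal_mulI.
  move=> a b hab Kb; apply: (hab _ (tr _ K' (ideal_mulI _ _))) => // c d Ic Jd e Ke.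
  by rewrite -mulrA; apply: mulI_in => //; apply: mulI_in.
apply: eqI => u; last exact: half.
by rewrite mulIC (mulIC J) => /half; rewrite mulIC (mulIC J).
Qed.

Lemma mulI_princE f I u : ideal I -> mulI (princ f) I u -> exists2 v, I v & u = f * v.
Proof.
move=> [I0 ID IM] h; apply: (h (fun u => exists2 v, I v & u = f * v)); first split.
- by exists 0; rewrite ?mulr0.
- by move=> _ _ [v Iv ->] [w Iw ->]; exists (v + w); [exact: ID|rewrite mulrDr].
- by move=> _ w [v Iv ->]; exists (w * v); [exact: IM|rewrite mulrCA].
- by move=> _ b [k ->] Ib; exists (k * b); [exact: IM|rewrite mulrA].
Qed.

Lemma princ_in f : princ f f. Proof. by exists 1; rewrite mulr1. Qed.

Lemma mul_princ f g : mulI (princ f) (princ g) = princ (f * g).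
Proof.
apply: eqI => u.
  by move=> /(mulI_princE (ideal_princ g))[_ [k ->] ->]; exists k; rewrite mulrA.
move=> [k ->]; rewrite -mulrA; apply: mulI_in; first exact: princ_in.
by exists k.
Qed.

Lemma mul1I I : ideal I -> mulI (princ 1) I = I.
Proof.
move=> iI; apply: eqI => u; first by move=> /(mulI_princE iI)[v Iv ->]; rewrite mul1r.
by move=> Iu; rewrite -[u]mul1r; apply: mulI_in => //; apply: princ_in.
Qed.

Lemma mulI_cancel f I J : f != 0 -> ideal I -> ideal J ->
  mulI (princ f) I = mulI (princ f) J -> I = J.
Proof.
move=> f0 iI iJ e; apply: eqI => u hu.
  have : mulI (princ f) I (f * u) by apply: mulI_in => //; apply: princ_in.
  by rewrite e => /(mulI_princE iJ)[v Jv /(cr_mulfI f0) ->].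
have : mulI (princ f) J (f * u) by apply: mulI_in => //; apply: princ_in.
by rewrite -e => /(mulI_princE iI)[v Jv /(cr_mulfI f0) ->].
Qed.

(** Equality of ideal classes. Associativity of the chord-and-tangent law is transported from
    multiplication of ideals, along the injection of points into classes. *)
Definition cleq I J := exists f g : A, [/\ f != 0, g != 0 & mulI (princ f) I = mulI (princ g) J].

Lemma cleq_sym I J : cleq I J -> cleq J I.
Proof. by move=> [f [g [f0 g0 e]]]; exists g, f. Qed.

Lemma cleq_trans I J K : cleq I J -> cleq J K -> cleq I K.
Proof.
move=> [f [g [f0 g0 e]]] [f' [g' [f'0 g'0 e']]].
exists (f' * f), (g * g'); split; try exact: cr_mulf_neq0.
rewrite -!mul_princ -!mulIA e -e' !mulIA; congr (mulI _ J); exact: mulIC.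
Qed.

Lemma cleqM I J K : cleq I J -> cleq (mulI I K) (mulI J K).
Proof. by move=> [f [g [f0 g0 e]]]; exists f, g; split=> //; rewrite !mulIA e. Qed.

Lemma cleqM' I J K : cleq I J -> cleq (mulI K I) (mulI K J).
Proof. by rewrite !(mulIC K); apply: cleqM. Qed.

Definition Ip (P : option (L * L)) : A -> Prop := fun u =>
  if P is Some (x, y) then cr_eval x y u = 0 else True.

Lemma ideal_Ip P : on_curve a1 a2 a3 a4 a6 P -> ideal (Ip P).
Proof.
case: P => [[x y]|_]; last by split.
move=> cP; split.
- transitivity ((0 : {poly L}).[x] + (0 : {poly L}).[x] * y); first by [].
  by rewrite !horner0 mul0r addr0.
- by move=> u v hu hv; apply: (etrans (cr_evalD x y u v)); rewrite hu hv addr0.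
- by move=> u v hu; apply: (etrans (cr_evalM v u cP)); rewrite hu mulr0.
Qed.

Definition ec_opp (P : option (L * L)) :=
  if P is Some (x, y) then Some (x, - y - a1 * x - a3) else None.

Lemma on_curve_opp P : on_curve a1 a2 a3 a4 a6 P -> on_curve a1 a2 a3 a4 a6 (ec_opp P).
Proof. by case: P => [[x y]|] //= /eqP e; apply/eqP; rewrite -e; ring. Qed.

Lemma mulI_sub_Ip P (J : A -> Prop) u : on_curve a1 a2 a3 a4 a6 P -> mulI (Ip P) J u -> Ip P u.
Proof.
move=> cP; apply=> [|a b ha _]; first exact: ideal_Ip.
by rewrite mulrC; case: (ideal_Ip cP) => _ _; apply.
Qed.

Lemma cr_evalX x y c : cr_eval x y (('X - c%:P, 0) : A) = x - c.
Proof. by rewrite /cr_eval /= !hornerE; ring. Qed.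

Lemma cr_evalY x y c : cr_eval x y ((- c%:P, 1) : A) = y - c.
Proof. by rewrite /cr_eval /= !hornerE; ring. Qed.

Lemma cr_degX c : cr_deg (('X - c%:P, 0) : A) = 2%N.
Proof. by rewrite cr_deg_poly size_XsubC. Qed.

Lemma cr_degY c : cr_deg ((- c%:P, 1) : A) = 3%N.
Proof.
rewrite /cr_deg /cr_norm /= expr1n mul1r addrC size_polyDl size_polyN size_cr_g //.
apply: leq_ltn_trans (size_polyD _ _) _; rewrite size_polyN gtn_max.
rewrite sqrrN expr2 -polyCM (leq_ltn_trans (size_polyC_leq1 _)) //=.
rewrite mulr1 mulNr size_polyN mul_polyC (leq_ltn_trans (size_scale_leq _ _)) //.
exact: leq_ltn_trans size_cr_h _.
Qed.

Lemma cr_deg_gt0 u : cr_deg u != 0%N -> u != 0.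
Proof. by apply: contraNneq => ->; rewrite /cr_deg (cr_norm_poly 0) expr0n size_poly0. Qed.

Lemma cr_deg_neq1 u : cr_deg u != 1%N.
Proof.
have [->|u0] := eqVneq u 0; first by rewrite (cr_deg_poly 0) size_poly0.
by apply/eqP => d1; have [|_] := cr_deg_small u0; rewrite d1 //; lia.
Qed.

Lemma cr_deg0 (u : A) : u != 0 -> cr_deg u = 0%N -> exists2 c, c != 0 & u = (c%:P, 0).
Proof.
move=> u0 d0; have [|uE] := cr_deg_small u0; rewrite d0 // => s1.
have /size_poly1P[c c0 uc] : size u.1 == 1%N.
  have : u.1 != 0 by apply: contraNneq u0 => e; rewrite uE e.
  by rewrite -size_poly_gt0; move: s1; case: size => [|[|n]] //; lia.
by exists c => //; rewrite uE uc.
Qed.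

(** A generator divides elements of degree 2 and 3. As neither it nor a cofactor can have degree 1,
    it has degree 0 and is a constant, which vanishes nowhere. *)
Lemma princ_pt P h : on_curve a1 a2 a3 a4 a6 P -> Ip P = princ h -> P = None.
Proof.
case: P => [[x y]|] // cP e.
have [k1 /esym e1] : princ h ('X - x%:P, 0) by rewrite -e /= cr_evalX subrr.
have [k2 /esym e2] : princ h (- y%:P, 1) by rewrite -e /= cr_evalY subrr.
have h0 : h != 0.
  by apply/eqP => h0; move: e2; rewrite h0 mul0r => -[_ /esym/eqP]; rewrite oner_eq0.
have k10 : k1 != 0.
  by apply/eqP => k0; move: e1; rewrite k0 mulr0 => -[/esym/eqP]; rewrite polyXsubC_eq0.
have k20 : k2 != 0.
  by apply/eqP => k0; move: e2; rewrite k0 mulr0 => -[_ /esym/eqP]; rewrite oner_eq0.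
have d1 := cr_degM h0 k10; have d2 := cr_degM h0 k20.
rewrite e1 cr_degX in d1; rewrite e2 cr_degY in d2.
have d0 : cr_deg h = 0%N.
  by move: (cr_deg_neq1 k1) (cr_deg_neq1 k2) d1 d2 (cr_deg_neq1 h); lia.
have [c c0 hc] := cr_deg0 h0 d0.
have : Ip (Some (x, y)) h by rewrite e; apply: princ_in.
by rewrite /= hc /cr_eval /= !hornerE => c00; rewrite c00 eqxx in c0.
Qed.

(** The generator divides elements of degree 4 and 5, so its degree is 0 or 2 because 1 never
    occurs. It vanishes at [P], so it is linear in [x], and both points lie on one vertical line. *)
Lemma princ_pair P Q h : on_curve a1 a2 a3 a4 a6 (Some P) -> on_curve a1 a2 a3 a4 a6 (Some Q) ->
  mulI (Ip (Some P)) (Ip (Some Q)) = princ h -> Some Q = ec_opp (Some P).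
Proof.
case: P Q => [x1 y1] [x2 y2] cP cQ e.
have [k1 /esym e1] : princ h ((('X - x1%:P, 0) : A) * (('X - x2%:P, 0) : A)).
  by rewrite -e; apply: mulI_in; rewrite /= cr_evalX subrr.
have [k2 /esym e2] : princ h ((('X - x1%:P, 0) : A) * ((- y2%:P, 1) : A)).
  by rewrite -e; apply: mulI_in; rewrite /= ?cr_evalX ?cr_evalY subrr.
have X0 c : (('X - c%:P, 0) : A) != 0 by apply: cr_deg_gt0; rewrite cr_degX.
have Y0 c : ((- c%:P, 1) : A) != 0 by apply: cr_deg_gt0; rewrite cr_degY.
have p1 := cr_mulf_neq0 (X0 x1) (X0 x2); have p2 := cr_mulf_neq0 (X0 x1) (Y0 y2).
have h0 : h != 0 by apply: contraNneq p1 => h0; rewrite -e1 h0 mul0r.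
have k10 : k1 != 0 by apply: contraNneq p1 => h1; rewrite -e1 h1 mulr0.
have k20 : k2 != 0 by apply: contraNneq p2 => h1; rewrite -e2 h1 mulr0.
have d1 := cr_degM h0 k10; have d2 := cr_degM h0 k20.
rewrite e1 (cr_degM (X0 _) (X0 _)) !cr_degX in d1.
rewrite e2 (cr_degM (X0 _) (Y0 _)) cr_degX cr_degY in d2.
have hP : cr_eval x1 y1 h = 0.
  by apply: (@mulI_sub_Ip _ (Ip (Some (x2, y2))) h cP); rewrite e; apply: princ_in.
have hQ : cr_eval x2 y2 h = 0.
  by apply: (@mulI_sub_Ip _ (Ip (Some (x1, y1))) h cQ); rewrite mulIC e; apply: princ_in.
have dh : cr_deg h = 0%N \/ cr_deg h = 2%N.
  by move: (cr_deg_neq1 k1) (cr_deg_neq1 k2) d1 d2 (cr_deg_neq1 h); lia.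
case: dh => dh.
  have [c c0 hc] := cr_deg0 h0 dh.
  by move: hP; rewrite hc /cr_eval /= !hornerE => c00; rewrite c00 eqxx in c0.
have [|hE] := cr_deg_small h0; rewrite dh // => sh.
have {}sh : size h.1 = 2%N by lia.
have rt x y : cr_eval x y h = 0 -> root h.1 x.
  by rewrite hE /cr_eval /= horner0 mul0r addr0 => /eqP.
have x12 : x1 = x2.
  apply/eqP; rewrite -[_ == _]negbK; apply/negP => x12.
  have := @max_poly_roots _ h.1 [:: x1; x2].
  rewrite sh /= inE x12 (rt _ _ hP) (rt _ _ hQ) /= => /(_ _ isT isT).
  by rewrite -size_poly_gt0 sh => /(_ isT).
subst x2; rewrite /=; congr (Some (_, _)).
move: (cP) (cQ) => /eqP cP' /eqP cQ'.
have : (y2 - y1) * (y2 + y1 + a1 * x1 + a3) = 0.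
  have -> : (y2 - y1) * (y2 + y1 + a1 * x1 + a3) =
    (y2 ^+ 2 + a1 * x1 * y2 + a3 * y2) - (y1 ^+ 2 + a1 * x1 * y1 + a3 * y1) by ring.
  by rewrite cP' cQ' subrr.
move/eqP; rewrite mulf_eq0 => /orP[/eqP y12|/eqP y12]; last first.
  by apply/eqP; rewrite -subr_eq0 -y12; apply/eqP; ring.
have {}y12 : y2 = y1 by apply/eqP; rewrite -subr_eq0 y12.
subst y2.
(* For [Q = P] the generator divides [(y - y1)^2], whose coefficient of [y] at [x1] is, up to sign,
   [2 y1 + a1 x1 + a3]; so [P] is its own opposite. *)
have [k /esym e3] : princ h (((- y1%:P, 1) : A) * ((- y1%:P, 1) : A)).
  by rewrite -e; apply: mulI_in; rewrite /= cr_evalY subrr.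
have : root ((((- y1%:P, 1) : A) * ((- y1%:P, 1) : A)).2) x1.
  rewrite -e3 hE cr_mulE /cr_mul /=; rewrite !mul0r addr0 subr0 rootM.
  by rewrite (rt x1 y1).
rewrite cr_mulE /cr_mul /cr_h rootE /= !hornerE => /eqP y0.
by apply/eqP; rewrite -subr_eq0 -oppr_eq0 -y0; apply/eqP; ring.
Qed.

Lemma cleq_of_princ I f : ideal I -> f != 0 -> (exists g, mulI (princ f) I = princ g) ->
  exists h, I = princ h.
Proof.
move=> iI f0 [g e].
have : mulI (princ f) I g by rewrite e; apply: princ_in.
move=> /(mulI_princE iI)[h Ih gE]; exists h.
apply: (mulI_cancel f0) => //; first exact: ideal_princ.
by rewrite e gE mul_princ.
Qed.

End CoordRing.

Lemma poly_ideal1 (L : closedFieldType) (D : {poly L} -> Prop) p1 p2 p3 p4 :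
  (forall p q, D p -> D q -> D (p + q)) -> (forall p q, D p -> D (q * p)) ->
  D p1 -> D p2 -> D p3 -> D p4 ->
  (forall e, root p1 e -> root p2 e -> root p3 e -> root p4 e -> False) -> D 1.
Proof.
move=> DD DM D1 D2 D3 D4 nr.
have Dg p q : D p -> D q -> D (gcdp p q).
  move=> Dp Dq; have [[u v] /= /eqpP[[a b] /= /andP[a0 b0] e]] := Bezoutp p q.
  have -> : gcdp p q = (b^-1 * a)%:P * (u * p + v * q).
    by rewrite mul_polyC -scalerA e scalerA mulVf // scale1r.
  by apply/DM/DD; apply: DM.
pose d := gcdp (gcdp p1 p2) (gcdp p3 p4).
have Dd : D d by apply: (Dg); apply: Dg.
have sd : size d = 1%N.
  apply/eqP; rewrite -[_ == _]negbK; apply/negP => /closed_rootP[e].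
  rewrite !root_gcd => /andP[/andP[r1 r2] /andP[r3 r4]]; exact: (nr e).
have /size_poly1P[c c0 dc] : size d == 1%N by rewrite sd.
have -> : 1 = c^-1%:P * d by rewrite dc -polyCM mulVf.
exact: DM.
Qed.

Section GroupLaw.
Variables (L : closedFieldType) (a1 a2 a3 a4 a6 : L).
Hypothesis nzD : ec_disc a1 a2 a3 a4 a6 != 0.

Local Notation A := (cring a1 a2 a3 a4 a6).
Local Notation on_curve := (on_curve a1 a2 a3 a4 a6).
Local Notation ec_add := (ec_add a1 a2 a3 a4 a6).
Local Notation ec_opp := (ec_opp a1 a3).
Local Notation Ip := (@Ip L a1 a2 a3 a4 a6).
Local Notation mulI := (@mulI L a1 a2 a3 a4 a6).
Local Notation princ := (@princ L a1 a2 a3 a4 a6).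
Local Notation ideal := (@ideal L a1 a2 a3 a4 a6).
Local Notation cleq := (@cleq L a1 a2 a3 a4 a6).
Local Notation g := (cr_g a2 a4 a6).
Local Notation h := (cr_h a1 a3).

Lemma ec_nonsing x y : y ^+ 2 + a1 * x * y + a3 * y = x ^+ 3 + a2 * x ^+ 2 + a4 * x + a6 ->
  2%:R * y + a1 * x + a3 = 0 -> a1 * y = 3%:R * x ^+ 2 + 2%:R * a2 * x + a4 -> False.
Proof.
move=> e1 e2 e3; move/eqP: nzD; apply.
have a3E : a3 = - (2%:R * y + a1 * x) by apply/eqP; rewrite -subr_eq0 -e2; apply/eqP; ring.
have a4E : a4 = a1 * y - 3%:R * x ^+ 2 - 2%:R * a2 * x by rewrite e3; ring.
have a6E : a6 = y ^+ 2 + a1 * x * y + a3 * y - (x ^+ 3 + a2 * x ^+ 2 + a4 * x) by rewrite e1; ring.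
by rewrite /ec_disc /ec_b2 /ec_b4 /ec_b6 /ec_b8 a6E a4E a3E; ring.
Qed.

Lemma line_data x1 y1 x2 y2 : on_curve (Some (x1, y1)) -> on_curve (Some (x2, y2)) ->
  ~~ ((x1 == x2) && (y1 + y2 + a1 * x2 + a3 == 0)) ->
  exists lam nu x3,
  [/\ ec_add (Some (x1, y1)) (Some (x2, y2)) = ec_opp (Some (x3, lam * x3 + nu)),
      lam * x1 + nu = y1, lam * x2 + nu = y2,
      lam = (if x1 != x2 then (y2 - y1) / (x2 - x1) else
        (3%:R * x1 ^+ 2 + 2%:R * a2 * x1 + a4 - a1 * y1) / (2%:R * y1 + a1 * x1 + a3)) &
      [/\ x1 + x2 + x3 = lam ^+ 2 + a1 * lam - a2,
          a4 - 2%:R * lam * nu - a1 * nu - a3 * lam = x1 * x2 + x1 * x3 + x2 * x3 &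
          a6 - nu ^+ 2 - a3 * nu = - (x1 * x2 * x3)]].
Proof.
move=> /eqP c1 /eqP c2 nopp; rewrite /Defs.ec_add (negPf nopp).
pose lam := if x1 != x2 then (y2 - y1) / (x2 - x1) else
  (3%:R * x1 ^+ 2 + 2%:R * a2 * x1 + a4 - a1 * y1) / (2%:R * y1 + a1 * x1 + a3).
pose nu := y1 - lam * x1.
pose x3 := lam ^+ 2 + a1 * lam - a2 - x1 - x2.
have l1 : lam * x1 + nu = y1 by rewrite /nu; ring.
have l2 : lam * x2 + nu = y2.
  have [e|ne] := eqVneq x1 x2; last by rewrite /nu /lam ne; field; rewrite subr_eq0 eq_sym.
  have : (y2 - y1) * (y1 + y2 + a1 * x2 + a3) = 0.
    have -> : (y2 - y1) * (y1 + y2 + a1 * x2 + a3) =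
      (y2 ^+ 2 + a1 * x2 * y2 + a3 * y2) - (y1 ^+ 2 + a1 * x2 * y1 + a3 * y1) by ring.
    by have := c1; rewrite c2 e => ->; rewrite subrr.
  move: nopp; rewrite e eqxx /= => /negPf ne /eqP.
  by rewrite mulf_eq0 ne orbF subr_eq0 => /eqP ->; rewrite -e.
(* The choice of [x3] matches the coefficients of [x^2], so the cubic of the line and the product of
   the three factors differ by a linear polynomial [r1 x + r0]; two zeros, or one zero and the
   tangent slope, kill it. *)
have lin x y : y ^+ 2 + a1 * x * y + a3 * y = x ^+ 3 + a2 * x ^+ 2 + a4 * x + a6 ->
    lam * x + nu = y -> (x - x1) * (x - x2) * (x - x3) = 0 ->
    (a4 - 2%:R * lam * nu - a1 * nu - a3 * lam - (x1 * x2 + x1 * x3 + x2 * x3)) * x +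
    (a6 - nu ^+ 2 - a3 * nu + x1 * x2 * x3) = 0.
  move=> cx lx px.
  transitivity ((x ^+ 3 + a2 * x ^+ 2 + a4 * x + a6) - ((lam * x + nu) ^+ 2 +
    a1 * x * (lam * x + nu) + a3 * (lam * x + nu)) - (x - x1) * (x - x2) * (x - x3)).
    by rewrite /x3; ring.
  by rewrite px lx cx; ring.
set r1 := a4 - _ - _ - _ - _ in lin; set r0 := a6 - _ - _ + _ in lin.
have e1 := lin _ _ c1 l1; rewrite subrr !mul0r in e1; have {}e1 := e1 erefl.
have e2 := lin _ _ c2 l2; rewrite subrr mulr0 mul0r in e2; have {}e2 := e2 erefl.
have r10 : r1 = 0.
  have [e|ne] := eqVneq x1 x2; last first.
    apply/eqP; have /eqP : r1 * (x1 - x2) = 0.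
      by transitivity ((r1 * x1 + r0) - (r1 * x2 + r0)); [ring|rewrite e1 e2 subrr].
    by rewrite mulf_eq0 => /orP[//|]; rewrite subr_eq0 (negPf ne).
  have y12 : y2 = y1 by rewrite -l1 -l2 e.
  have d0 : 2%:R * y1 + a1 * x1 + a3 != 0.
    by move: nopp; rewrite e eqxx /= y12; apply: contraNneq => <-; apply/eqP; ring.
  have lE : lam * (2%:R * y1 + a1 * x1 + a3) = 3%:R * x1 ^+ 2 + 2%:R * a2 * x1 + a4 - a1 * y1.
    by rewrite /lam e eqxx /= -e mulfVK.
  have -> : r1 = (3%:R * x1 ^+ 2 + 2%:R * a2 * x1 + a4 - a1 * y1) - lam * (2%:R * y1 + a1 * x1 + a3).
    by rewrite /r1 /x3 -e /nu; ring.
  by rewrite lE subrr.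
have r00 : r0 = 0 by rewrite r10 mul0r add0r in e1.
exists lam, nu, x3; split=> //; last first.
  split; first by rewrite /x3; ring.
    by apply/eqP; rewrite -subr_eq0; apply/eqP.
  by apply/eqP; rewrite -subr_eq0 opprK; apply/eqP.
have nuE : (if x1 != x2 then (y1 * x2 - y2 * x1) / (x2 - x1) else
   (- x1 ^+ 3 + a4 * x1 + 2%:R * a6 - a3 * y1) / (2%:R * y1 + a1 * x1 + a3)) = nu.
  have [e|ne] := eqVneq x1 x2 => /=; last first.
    by rewrite /nu /lam ne; field; rewrite subr_eq0 eq_sym.
  have y12 : y2 = y1 by rewrite -l1 -l2 e.
  have d0 : 2%:R * y1 + a1 * x1 + a3 != 0.
    by move: nopp; rewrite e eqxx /= y12; apply: contraNneq => <-; apply/eqP; ring.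
  apply: (mulIf d0); rewrite mulfVK // /nu /lam e eqxx /= -e mulrBl mulrAC mulfVK //.
  have a6E : a6 = y1 ^+ 2 + a1 * x1 * y1 + a3 * y1 - (x1 ^+ 3 + a2 * x1 ^+ 2 + a4 * x1) by rewrite c1; ring.
  by rewrite a6E; ring.
rewrite (_ : (if x1 != x2 then (_, _) else _) = (lam, nu)); last first.
  by rewrite -nuE /lam; case: ifP.
by rewrite -/x3 /=; congr (Some (_, _)); ring.
Qed.

Lemma line_poly x1 x2 x3 lam nu :
  [/\ x1 + x2 + x3 = lam ^+ 2 + a1 * lam - a2,
      a4 - 2%:R * lam * nu - a1 * nu - a3 * lam = x1 * x2 + x1 * x3 + x2 * x3 &
      a6 - nu ^+ 2 - a3 * nu = - (x1 * x2 * x3)] ->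
  let l := lam%:P * 'X + nu%:P in
  g - l ^+ 2 - l * h = ('X - x1%:P) * ('X - x2%:P) * ('X - x3%:P).
Proof.
move=> [e2 e1 e0] /=.
have a2E : a2 = lam ^+ 2 + a1 * lam - (x1 + x2 + x3) by rewrite e2; ring.
have a4E : a4 = x1 * x2 + x1 * x3 + x2 * x3 + 2%:R * lam * nu + a1 * nu + a3 * lam.
  by rewrite -e1; ring.
have a6E : a6 = nu ^+ 2 + a3 * nu - x1 * x2 * x3.
  by apply/eqP; rewrite -subr_eq0 -(subrr (a6 - nu ^+ 2 - a3 * nu)) {2}e0; apply/eqP; ring.
rewrite /cr_g /cr_h a2E a4E a6E -!mul_polyC !(polyCD, polyCN, polyCM, polyC_exp, polyCMn).
ring.
Qed.

Lemma Ip_gen lam nu x (u : A) :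
  let l := lam%:P * 'X + nu%:P in
  cr_eval x (lam * x + nu) u = 0 ->
  exists p : {poly L}, u = ((p, 0) : A) * (('X - x%:P, 0) : A) + ((u.2, 0) : A) * ((- l, 1) : A).
Proof.
move=> l; case: u => a b; rewrite /cr_eval /= => e.
have /factor_theorem[p pE] : root (a + b * l) x.
  rewrite rootE /l !hornerE; apply/eqP/(etrans _ e); move: a.[x] b.[x] => u v; ring.
exists p; rewrite !cr_mulE cr_addE /cr_mul /=; congr (_, _); last by ring.
by rewrite !(mul0r, mulr0, addr0, mulr1) -pE; ring.
Qed.

Lemma inX_mul (p q : {poly L}) : ((p * q, 0) : A) = ((p, 0) : A) * ((q, 0) : A).
Proof. by rewrite cr_mulE /cr_mul /=; congr (_, _); ring. Qed.

Lemma line_on_curve lam nu x1 x2 x3 :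
  let l := lam%:P * 'X + nu%:P in
  g - l ^+ 2 - l * h = ('X - x1%:P) * ('X - x2%:P) * ('X - x3%:P) ->
  on_curve (Some (x3, lam * x3 + nu)).
Proof.
move=> l /(congr1 (horner^~ x3)); rewrite /l /cr_g /cr_h !hornerE /= subrr mulr0 => e.
by rewrite /= -subr_eq0 -oppr_eq0; apply/eqP/(etrans _ e); ring.
Qed.

(* The quotient of [I1 I2 I3] by the line contains the [X - xi] in pairs and
   the squared tangency polynomial [(2 l + h)^2]; a common root of these is a
   singular point. *)
Lemma line_ideal lam nu x1 x2 x3 :
  let l := lam%:P * 'X + nu%:P in
  g - l ^+ 2 - l * h = ('X - x1%:P) * ('X - x2%:P) * ('X - x3%:P) ->
  mulI (mulI (Ip (Some (x1, lam * x1 + nu))) (Ip (Some (x2, lam * x2 + nu))))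
    (Ip (Some (x3, lam * x3 + nu))) = princ ((- l, 1) : A).
Proof.
move=> l lE; set Y : A := (- l, 1).
pose X c : A := ('X - c%:P, 0).
pose Y' : A := (l + h, 1).
have YY' : Y * Y' = X x1 * X x2 * X x3.
  rewrite -!inX_mul -lE cr_mulE /cr_mul /=; congr (_, _); ring.
have XI c : Ip (Some (c, lam * c + nu)) (X c) by rewrite /= cr_evalX subrr.
have YI c : Ip (Some (c, lam * c + nu)) Y.
  rewrite /= /cr_eval /= /l !hornerE /=; ring.
have [K0 KD KM] := ideal_princ Y.
apply: eqI => u.
  move=> h3; apply: h3; first exact: ideal_princ.
  move=> a b h2 /Ip_gen[p3 ->].
  apply: (h2 (fun a => princ Y (a * (((p3, 0) : A) * X x3 + ((b.2, 0) : A) * Y)))).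
    split; first by rewrite mul0r.
    - by move=> v w hv hw; rewrite mulrDl; apply: KD.
    - by move=> v w hv; rewrite -mulrA; apply: KM.
  move=> c d /Ip_gen[p1 ->] /Ip_gen[p2 ->].
  rewrite -/(X x1) -/(X x2) -/l -/Y.
  move: ((p1, 0) : A) ((p2, 0) : A) ((p3, 0) : A) ((c.2, 0) : A) ((d.2, 0) : A) ((b.2, 0) : A).
  move=> u1 u2 u3 v1 v2 v3.
  have -> : (u1 * X x1 + v1 * Y) * (u2 * X x2 + v2 * Y) * (u3 * X x3 + v3 * Y) =
    u1 * u2 * u3 * (X x1 * X x2 * X x3) + Y * (v1 * (u2 * X x2 + v2 * Y) * (u3 * X x3 + v3 * Y) +
      u1 * X x1 * (v2 * (u3 * X x3 + v3 * Y) + u2 * X x2 * v3)).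
    by ring.
  by rewrite -YY'; apply: KD; [apply: KM; exists Y'|exists (v1 * (u2 * X x2 + v2 * Y) * (u3 * X x3 + v3 * Y) +
      u1 * X x1 * (v2 * (u3 * X x3 + v3 * Y) + u2 * X x2 * v3))].
move=> [k ->]; set P := mulI _ _.
have [P0 PD PM] : ideal P := ideal_mulI _ _.
suff : P (Y * 1) by rewrite mulr1 mulrC; apply: PM.
pose B (v : A) := P (Y * v).
have BD v w : B v -> B w -> B (v + w) by move=> hv hw; rewrite /B mulrDr; apply: PD.
have BM v w : B v -> B (w * v) by move=> hv; rewrite /B mulrCA; apply: PM.
have in3 u1 u2 u3 : Ip (Some (x1, lam * x1 + nu)) u1 -> Ip (Some (x2, lam * x2 + nu)) u2 ->
    Ip (Some (x3, lam * x3 + nu)) u3 -> P (u1 * u2 * u3).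
  by move=> i1 i2 i3; apply: mulI_in => //; apply: mulI_in.
have BY' : B Y' by rewrite /B YY'; apply: in3.
have BYY : B (Y * Y) by rewrite /B mulrA; apply: in3.
apply: (@poly_ideal1 L (fun p => B ((p, 0) : A)) ((l + l + h) ^+ 2)
  (('X - x1%:P) * ('X - x2%:P)) (('X - x1%:P) * ('X - x3%:P)) (('X - x2%:P) * ('X - x3%:P))).
- move=> p q hp hq; have -> : ((p + q, 0) : A) = ((p, 0) : A) + ((q, 0) : A); last exact: BD.
  by rewrite cr_addE /= addr0.
- by move=> p q hp; rewrite inX_mul; apply: BM.
(* Since [Y' - Y = 2 l + h], this is [(Y' - Y)^2] rewritten to use only [Y'] and [Y^2], both known
   to lie in the quotient. *)
- have -> : (((l + l + h) ^+ 2, 0) : A) = (((l + l + h) + (l + l + h), 0) : A) * Y' - Y' * Y' + Y * Y.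
    rewrite !cr_mulE /cr_mul /=.
    transitivity (((l + l + h + (l + l + h)) * (l + h) + 0 * 1 * g - ((l + h) * (l + h) + 1 * 1 * g) + (- l * - l + 1 * 1 * g),
     (l + l + h + (l + l + h)) * 1 + 0 * (l + h) - 0 * 1 * h - ((l + h) * 1 + 1 * (l + h) - 1 * 1 * h) + (- l * 1 + 1 * - l - 1 * 1 * h)) : A); last by [].
    by congr (_, _); ring.
  apply: (BD) => //; apply: (BD); first exact: BM.
  by rewrite -mulNr; apply: BM.
- by rewrite inX_mul /B mulrC; apply: in3.
- by rewrite inX_mul /B mulrC mulrAC; apply: in3.
- by rewrite inX_mul /B mulrA; apply: in3.
move=> e; rewrite rootE horner_exp expf_eq0 /=.
rewrite !rootM !root_XsubC => /eqP C0 h12 h13 h23.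
have h2 : cr_h a1 a3 = h by [].
have ev := congr1 (horner^~ e) lE; have dv := congr1 (fun p => p^`().[e]) lE.
have e0 : (e - x1) * (e - x2) * (e - x3) = 0.
  by case/orP: h12 => /eqP ->; rewrite subrr !(mul0r, mulr0).
have d0 : (e - x2) * (e - x3) + (e - x1) * (e - x3) + (e - x1) * (e - x2) = 0.
  have z x y : (e == x) || (e == y) -> (e - x) * (e - y) = 0.
    by case/orP => /eqP ->; rewrite subrr ?mul0r ?mulr0.
  by rewrite !z // !addr0.
apply: (@ec_nonsing e (lam * e + nu)).
- apply/eqP; rewrite -subr_eq0 -oppr_eq0; move: ev; rewrite /l /cr_g /cr_h !hornerE /= e0 => ev; apply/eqP/(etrans _ ev); ring.
- by move: C0; rewrite /l /cr_h !hornerE /= => C0; apply: (etrans _ C0); ring.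
- have C0' : 2%:R * (lam * e + nu) + a1 * e + a3 = 0.
    by move: C0; rewrite /l /cr_h !hornerE /= => C0; apply: (etrans _ C0); ring.
  move: dv; rewrite /l /cr_g /cr_h !derivE !hornerE /= => dv.
  apply/eqP; rewrite -subr_eq0 -oppr_eq0; apply/eqP.
  set lhs := (X in X = _) in dv; set rhs := (X in _ = X) in dv.
  transitivity (lhs - rhs + lam * (2%:R * (lam * e + nu) + a1 * e + a3) +
    ((e - x2) * (e - x3) + (e - x1) * (e - x3) + (e - x1) * (e - x2))).
    by rewrite /lhs /rhs; ring.
  by rewrite dv C0' d0 subrr mulr0 !addr0.
Qed.

(** The quotient of the product by [X - x] contains, up to sign, the values at the point of both
    partial derivatives of the Weierstrass equation. By nonsingularity one of these constants is
    nonzero. *)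
Lemma vertical_ideal x y : on_curve (Some (x, y)) ->
  mulI (Ip (Some (x, y))) (Ip (ec_opp (Some (x, y)))) = princ (('X - x%:P, 0) : A).
Proof.
move=> /eqP cP; rewrite [ec_opp _]/=; set y' := - y - a1 * x - a3.
pose X : A := ('X - x%:P, 0); pose Y c : A := (- c%:P, 1).
pose Q : {poly L} := 'X^2 + x%:P * 'X + (x ^+ 2)%:P + a2%:P * ('X + x%:P) + a4%:P.
pose R : A := (Q, - a1%:P).
have YY : Y y * Y y' = X * R.
  have a6E : a6 = y ^+ 2 + a1 * x * y + a3 * y - (x ^+ 3 + a2 * x ^+ 2 + a4 * x) by rewrite cP; ring.
  rewrite !cr_mulE /cr_mul /= /cr_g /cr_h /Q -!mul_polyC a6E /y'.
  by rewrite !(polyCD, polyCN, polyCM, polyC_exp); congr (_, _); ring.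
have gen c u : cr_eval x c u = 0 -> exists v w, u = v * X + w * Y c.
  have -> : c = 0 * x + c by ring.
  move=> /Ip_gen[p ->]; exists ((p, 0) : A), ((u.2, 0) : A).
  by rewrite polyC0 !mul0r !add0r.
have XI c : cr_eval x c X = 0 by rewrite cr_evalX subrr.
have YI c : cr_eval x c (Y c) = 0 by rewrite cr_evalY subrr.
have [K0 KD KM] := ideal_princ X.
apply: eqI => u.
  move=> h2; apply: h2; first exact: ideal_princ.
  move=> a b /gen[u1 [v1 ->]] /gen[u2 [v2 ->]].
  have -> : (u1 * X + v1 * Y y) * (u2 * X + v2 * Y y') =
    v1 * v2 * (Y y * Y y') + X * (u1 * (u2 * X + v2 * Y y') + v1 * Y y * u2) by ring.
  rewrite YY; apply: KD; first by apply: KM; exists R.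
  by exists (u1 * (u2 * X + v2 * Y y') + v1 * Y y * u2).
move=> [k ->]; set P := mulI _ _.
have [P0 PD PM] : ideal P := ideal_mulI _ _.
suff : P (X * 1) by rewrite mulr1 mulrC; apply: PM.
pose B (v : A) := P (X * v).
have BD v w : B v -> B w -> B (v + w) by move=> hv hw; rewrite /B mulrDr; apply: PD.
have BM v w : B v -> B (w * v) by move=> hv; rewrite /B mulrCA; apply: PM.
have BX : B X by apply: mulI_in; apply: XI.
have BY : B (Y y) by rewrite /B mulrC; apply: mulI_in; [apply: YI|apply: XI].
have BY' : B (Y y') by apply: mulI_in; [apply: XI|apply: YI].
have BR : B R by rewrite /B -YY; apply: mulI_in; apply: YI.
have Bc c : c != 0 -> B ((c%:P, 0) : A) -> B 1.
  move=> c0 hc; have -> : 1 = ((c^-1%:P, 0) : A) * ((c%:P, 0) : A); last exact: BM.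
  by rewrite -inX_mul -polyCM mulVf.
have [e0|] := eqVneq (2%:R * y + a1 * x + a3) 0; last first.
  move=> ne; apply: (Bc _ ne).
  have -> : (((2%:R * y + a1 * x + a3)%:P, 0) : A) = - 1 * Y y + Y y'.
    transitivity ((y%:P + - y'%:P, - 1 + 1) : A).
      by rewrite addNr -polyCN -polyCD /y'; congr (_%:P, _); ring.
    rewrite mulN1r; transitivity ((- - y%:P + - y'%:P, - 1 + 1) : A); last by [].
    by rewrite opprK.
  by apply: (BD) => //; apply: BM.
have [e1|ne] := eqVneq (3%:R * x ^+ 2 + 2%:R * a2 * x + a4 - a1 * y) 0.
  by case: (@ec_nonsing x y) => //; apply/eqP; rewrite eq_sym -subr_eq0 e1.
apply: (Bc _ ne).
have -> : (((3%:R * x ^+ 2 + 2%:R * a2 * x + a4 - a1 * y)%:P, 0) : A) =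
   R + (((a1%:P, 0) : A) * Y y + (((- ('X + (2%:R * x + a2)%:P), 0) : A) * X)).
  rewrite !cr_mulE !cr_addE /cr_mul /= /Q !(polyCD, polyCN, polyCM, polyC_exp, polyCMn).
  by congr (_, _); ring.
by apply: (BD) => //; apply: (BD); apply: BM.
Qed.

Lemma ec_oppK P : ec_opp (ec_opp P) = P.
Proof. by case: P => [[x y]|] //=; congr (Some (_, _)); ring. Qed.

Lemma Ip_None : Ip None = princ 1.
Proof. by apply: eqI => u // _; exists u; rewrite mul1r. Qed.

Lemma cr_X_neq0 x : (('X - x%:P, 0) : A) != 0.
Proof. by apply: cr_deg_gt0; rewrite cr_degX. Qed.

Lemma cr_oner_neq0 : (1 : A) != 0.
Proof. exact: cr_one_neq0. Qed.

Lemma cleq_refl I : cleq I I.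
Proof. by exists 1, 1; split=> //; exact: cr_oner_neq0. Qed.

Lemma on_curve_add P Q : on_curve P -> on_curve Q -> on_curve (ec_add P Q).
Proof.
case: P => [[x1 y1]|] //; case: Q => [[x2 y2]|] // cP cQ.
have [e|ne] := boolP ((x1 == x2) && (y1 + y2 + a1 * x2 + a3 == 0)).
  by rewrite /Defs.ec_add e.
have [lam [nu [x3 [-> _ _ _ eqs]]]] := line_data cP cQ ne.
exact/on_curve_opp/(line_on_curve (line_poly eqs)).
Qed.

(** If [T] is the third point of the line, the ideals of [P], [Q], [T] have principal product, and
    so have those of [T] and its opposite; the ideal of [T] is then traded for that of the sum. *)
Lemma add_cleq P Q : on_curve P -> on_curve Q ->
  cleq (mulI (Ip P) (Ip Q)) (Ip (ec_add P Q)).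
Proof.
case: P => [[x1 y1]|]; last first.
  move=> _ cQ; rewrite Ip_None mul1I; first exact: cleq_refl.
  exact: ideal_Ip.
case: Q => [[x2 y2]|] cP cQ; last first.
  by rewrite Ip_None mulIC mul1I; [exact: cleq_refl|exact: ideal_Ip].
have [e|ne] := boolP ((x1 == x2) && (y1 + y2 + a1 * x2 + a3 == 0)).
  rewrite /Defs.ec_add e; case/andP: e => /eqP e1 /eqP e2.
  have -> : Some (x2, y2) = ec_opp (Some (x1, y1)).
    rewrite /= e1; congr (Some (_, _)); apply/eqP; rewrite -subr_eq0; apply/eqP.
    by apply: etrans e2; ring.
  rewrite vertical_ideal // Ip_None; exists 1, (('X - x1%:P, 0) : A); split.
  - exact: cr_oner_neq0.
  - exact: cr_X_neq0.
  - by rewrite !mul_princ mul1r mulr1.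
have [lam [nu [x3 [-> l1 l2 _ eqs]]]] := line_data cP cQ ne.
have lE := line_poly eqs; have := line_ideal lE; rewrite l1 l2.
have cT := line_on_curve lE.
set T := Some (x3, lam * x3 + nu) in cT *; set l := _ + _ => PQT.
have cU := on_curve_opp cT.
exists (('X - x3%:P, 0) : A), ((- l, 1) : A); split.
- exact: cr_X_neq0.
- by apply: contraTneq (oner_neq0 {poly L}) => -[_ ->]; rewrite eqxx.
- by rewrite -(vertical_ideal cT) -PQT -/T mulIC mulIA.
Qed.

(** Equivalent ideals make the product of the ideals of [P] and of the opposite of [Q] principal,
    which [princ_pair] decides; the origin is treated apart by [half]. *)
Lemma cleq_inj P Q : on_curve P -> on_curve Q -> cleq (Ip P) (Ip Q) -> P = Q.
Proof.
move=> cP cQ [f [g0 [nf ng e]]].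
have half P' Q' f' g' : on_curve P' -> on_curve Q' -> f' != 0 ->
    mulI (princ f') (Ip P') = mulI (princ g') (Ip Q') -> Q' = None -> P' = None.
  move=> cP' cQ' nf' e' Q0; rewrite Q0 Ip_None mul_princ mulr1 in e'.
  have [|k] := cleq_of_princ (ideal_Ip cP') nf'; first by exists g'.
  exact: princ_pt.
case: Q => [Q|] in cQ e *; last exact: half e _.
case: P => [P|] in cP e *; last first.
  by have := half _ _ _ _ cQ cP ng (esym e) erefl.
have vQ := vertical_ideal (x := Q.1) (y := Q.2).
rewrite -surjective_pairing in vQ.
have [||k ke] := @cleq_of_princ _ _ _ _ _ _ (mulI (Ip (Some P)) (Ip (ec_opp (Some Q)))) f _ nf.
- exact: ideal_mulI.
- exists (g0 * (('X - Q.1%:P, 0) : A)).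
  by rewrite mulIA e -mulIA vQ // mul_princ.
have := ke; case: (ec_opp (Some Q)) (on_curve_opp cQ) (ec_oppK (Some Q)) => [Q'|] cQ' // QE.
move=> /(princ_pair cP cQ') Q'E.
by rewrite -QE Q'E ec_oppK.
Qed.

Lemma ec_addC P Q : on_curve P -> on_curve Q -> ec_add P Q = ec_add Q P.
Proof.
move=> cP cQ; apply: cleq_inj; try exact: on_curve_add.
by apply: cleq_trans (cleq_sym (add_cleq cP cQ)) _; rewrite mulIC; apply: add_cleq.
Qed.

Lemma ec_addA P Q R : on_curve P -> on_curve Q -> on_curve R ->
  ec_add P (ec_add Q R) = ec_add (ec_add P Q) R.
Proof.
move=> cP cQ cR; have cPQ := on_curve_add cP cQ; have cQR := on_curve_add cQ cR.
apply: cleq_inj; try exact: on_curve_add.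
apply: cleq_trans (cleq_sym (add_cleq cP cQR)) _.
apply: cleq_trans (cleqM' _ (cleq_sym (add_cleq cQ cR))) _.
by rewrite mulIA; apply: cleq_trans (cleqM _ (add_cleq cP cQ)) _; apply: add_cleq.
Qed.

Lemma ec_addN P : on_curve P -> ec_add (ec_opp P) P = None.
Proof.
case: P => [[x y]|] // _; rewrite /Defs.ec_add /= eqxx /=.
by rewrite (_ : _ == 0) //; apply/eqP; ring.
Qed.

End GroupLaw.

(** The nonvanishing of the discriminant is a parameter of the type, so that the group structure can
    be attached to it. *)
Definition ec_pt (L : closedFieldType) (a1 a2 a3 a4 a6 : L)
  (nzD : ec_disc a1 a2 a3 a4 a6 != 0) := {P | on_curve a1 a2 a3 a4 a6 P}.

Section PointGroup.
Variables (L : closedFieldType) (a1 a2 a3 a4 a6 : L).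
Hypothesis nzD : ec_disc a1 a2 a3 a4 a6 != 0.
Local Notation M := (ec_pt nzD).

HB.instance Definition _ := Choice.on M.

Definition pt0 : M := exist (on_curve a1 a2 a3 a4 a6) None isT.
Definition pt_opp (P : M) : M := exist (on_curve a1 a2 a3 a4 a6) _ (on_curve_opp (svalP P)).
Definition pt_add (P Q : M) : M := exist (on_curve a1 a2 a3 a4 a6) _ (on_curve_add (svalP P) (svalP Q)).

Fact pt_addA : associative pt_add.
Proof. by move=> P Q R; apply/val_inj/ec_addA; try exact: valP. Qed.
Fact pt_addC : commutative pt_add.
Proof. by move=> P Q; apply/val_inj/ec_addC; try exact: valP. Qed.
Fact pt_add0 : left_id pt0 pt_add.
Proof. by move=> P; apply/val_inj. Qed.
Fact pt_addN : left_inverse pt0 pt_opp pt_add.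
Proof. by move=> P; apply/val_inj/ec_addN/valP. Qed.

HB.instance Definition _ := GRing.isZmodule.Build M pt_addA pt_addC pt_add0 pt_addN.

Definition pt_x (P : M) : L := if val P is Some (x, _) then x else 0.

Lemma pt_mulrn n (P : M) : val (P *+ n) = ec_mul a1 a2 a3 a4 a6 n (val P).
Proof. by elim: n => // n IH; rewrite mulrS /ec_mul iterS -[iter n _ _]IH. Qed.

End PointGroup.

(** * Kummer coordinates *)

Section KummerPoly.
Variable L : fieldType.
Variables b2 b4 b6 b8 : L.

Definition km_S x y := 2%:R * x * y * (x + y) + b2 * x * y + b4 * (x + y) + b6.
Definition km_P x y := x ^+ 2 * y ^+ 2 - b4 * x * y - b6 * (x + y) - b8.
Definition km_psi x := 4%:R * x ^+ 3 + b2 * x ^+ 2 + 2%:R * b4 * x + b6.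
Definition km_phi x := x ^+ 4 - b4 * x ^+ 2 - 2%:R * b6 * x - b8.
Definition km_disc := - b2 ^+ 2 * b8 - 8%:R * b4 ^+ 3 - 27%:R * b6 ^+ 2 + 9%:R * b2 * b4 * b6.

(** What remains of the group law once [y] is forgotten: [km_S] and [km_P] give the sum and the
    product of [X (P + Q)] and [X (P - Q)], and [km_phi / km_psi] is duplication. The value of [X]
    at the origin is arbitrary. *)
Definition kummer (M : zmodType) (X : M -> L) :=
  [/\ 4%:R * b8 = b2 * b6 - b4 ^+ 2,
      forall P, X (- P) = X P,
      forall P Q, P != 0 -> Q != 0 -> X P = X Q -> P = Q \/ P = - Q,
      (forall P Q, P != 0 -> Q != 0 -> X P != X Q ->
        (X (P + Q) + X (P - Q)) * (X P - X Q) ^+ 2 = km_S (X P) (X Q) /\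
        X (P + Q) * X (P - Q) * (X P - X Q) ^+ 2 = km_P (X P) (X Q)) &
      (forall P, P != 0 -> if P + P == 0 then km_psi (X P) = 0 else
        km_psi (X P) != 0 /\ X (P + P) * km_psi (X P) = km_phi (X P))].

End KummerPoly.

Section PointKummer.
Variables (L : closedFieldType) (a1 a2 a3 a4 a6 : L).
Hypothesis nzD : ec_disc a1 a2 a3 a4 a6 != 0.
Local Notation M := (ec_pt nzD).
Local Notation b2 := (ec_b2 a1 a2).
Local Notation b4 := (ec_b4 a1 a3 a4).
Local Notation b6 := (ec_b6 a3 a6).
Local Notation b8 := (ec_b8 a1 a2 a3 a4 a6).

Lemma ec_discE : ec_disc a1 a2 a3 a4 a6 = km_disc b2 b4 b6 b8.
Proof. by []. Qed.

Lemma pt_cases (P : M) : P != 0 -> exists x y, [/\ val P = Some (x, y), pt_x P = x &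
  y ^+ 2 + a1 * x * y + a3 * y = x ^+ 3 + a2 * x ^+ 2 + a4 * x + a6].
Proof.
case: P => -[[x y]|] cP; last by case/eqP; apply/val_inj.
by move=> _; exists x, y; split=> //; apply/eqP.
Qed.

Lemma kummer_sum_aux x1 y1 x2 y2 : x1 != x2 ->
  y1 ^+ 2 + a1 * x1 * y1 + a3 * y1 = x1 ^+ 3 + a2 * x1 ^+ 2 + a4 * x1 + a6 ->
  y2 ^+ 2 + a1 * x2 * y2 + a3 * y2 = x2 ^+ 3 + a2 * x2 ^+ 2 + a4 * x2 + a6 ->
  let l := (y2 - y1) / (x2 - x1) in
  let l' := (- y2 - a1 * x2 - a3 - y1) / (x2 - x1) in
  let x3 := l ^+ 2 + a1 * l - a2 - x1 - x2 in
  let x4 := l' ^+ 2 + a1 * l' - a2 - x1 - x2 in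
  (x3 + x4) * (x1 - x2) ^+ 2 = km_S b2 b4 b6 x1 x2 /\
  x3 * x4 * (x1 - x2) ^+ 2 = km_P b4 b6 b8 x1 x2.
Proof.
move=> ne c1 c2 /=; have d0 : x2 - x1 != 0 by rewrite subr_eq0 eq_sym.
have a6E : a6 = y1 ^+ 2 + a1 * x1 * y1 + a3 * y1 - (x1 ^+ 3 + a2 * x1 ^+ 2 + a4 * x1) by rewrite c1; ring.
have a4E : a4 = ((y2 ^+ 2 + a1 * x2 * y2 + a3 * y2 - x2 ^+ 3 - a2 * x2 ^+ 2) -
  (y1 ^+ 2 + a1 * x1 * y1 + a3 * y1 - x1 ^+ 3 - a2 * x1 ^+ 2)) / (x2 - x1).
  by rewrite c1 c2; field.
rewrite /km_S /km_P /ec_b2 /ec_b4 /ec_b6 /ec_b8 a6E a4E; split; field; exact: d0.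
Qed.

Lemma pt_kummer : kummer b2 b4 b6 b8 (@pt_x L a1 a2 a3 a4 a6 nzD).
Proof.
split.
- by rewrite /ec_b8 /ec_b2 /ec_b4 /ec_b6; ring.
- by case=> -[[x y]|].
- move=> P Q /pt_cases[x1 [y1 [vP -> cP]]] /pt_cases[x2 [y2 [vQ -> cQ]]] e; subst x2.
  have : (y1 - y2) * (y1 - (- y2 - a1 * x1 - a3)) = 0.
    transitivity ((y1 ^+ 2 + a1 * x1 * y1 + a3 * y1) - (y2 ^+ 2 + a1 * x1 * y2 + a3 * y2)); first by ring.
    by rewrite cP cQ subrr.
  move/eqP; rewrite mulf_eq0 !subr_eq0 => /orP[] /eqP e; [left|right]; apply/val_inj.
    by rewrite vP vQ e.
  by rewrite /= [sval P]vP [sval Q]vQ e.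
- move=> P Q /pt_cases[x1 [y1 [vP -> cP]]] /pt_cases[x2 [y2 [vQ -> cQ]]] ne.
  have [<- <-] := kummer_sum_aux ne cP cQ.
  rewrite /pt_x /= [sval P]vP [sval Q]vQ /= (negPf ne) /=.
  by split.
- move=> P /pt_cases[x [y [vP -> c]]].
  have a6E : a6 = y ^+ 2 + a1 * x * y + a3 * y - (x ^+ 3 + a2 * x ^+ 2 + a4 * x) by rewrite c; ring.
  have pE : km_psi b2 b4 b6 x = (2%:R * y + a1 * x + a3) ^+ 2.
    by rewrite /km_psi /ec_b2 /ec_b4 /ec_b6 a6E; ring.
  have e2 : (y + y + a1 * x + a3 == 0) = (2%:R * y + a1 * x + a3 == 0) by congr (_ == _); ring.
  have v2 : val (P + P) = ec_add a1 a2 a3 a4 a6 (Some (x, y)) (Some (x, y)) by rewrite -vP.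
  rewrite /Defs.ec_add eqxx [true && _]/= e2 in v2.
  rewrite -val_eqE v2 pE; have [->|d0] := eqVneq (2%:R * y + a1 * x + a3) 0.
    by rewrite /= expr0n.
  rewrite expf_neq0 //; split=> //; rewrite /pt_x v2 /=.
  by rewrite (negPf d0) /km_phi /ec_b4 /ec_b6 /ec_b8 a6E; field.
Qed.

End PointKummer.

(** As [y] is absent, [u] need not be a square: quadratic twists are affine changes of [X] here. *)
Lemma kummer_affine (L : fieldType) (M : zmodType) (X : M -> L) b2 b4 b6 b8 u r :
  u != 0 -> kummer b2 b4 b6 b8 X ->
  kummer ((b2 + 12%:R * r) / u) ((b4 + r * b2 + 6%:R * r ^+ 2) / u ^+ 2)
    ((b6 + 2%:R * r * b4 + r ^+ 2 * b2 + 4%:R * r ^+ 3) / u ^+ 3)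
    ((b8 + 3%:R * r * b6 + 3%:R * r ^+ 2 * b4 + r ^+ 3 * b2 + 3%:R * r ^+ 4) / u ^+ 4)
    (fun P => (X P - r) / u).
Proof.
move=> u0 [hb hN hI hS hD]; split.
- have z : (4%:R * b8 - (b2 * b6 - b4 ^+ 2)) / u ^+ 4 = 0 by rewrite hb subrr mul0r.
  by apply/eqP; rewrite -subr_eq0; apply/eqP/(etrans _ z); field.
- by move=> P; rewrite hN.
- by move=> P Q P0 Q0 /(mulIf (invr_neq0 u0)) /addIr; apply: hI.
- move=> P Q P0 Q0 ne.
  have {}ne : X P != X Q by apply: contraNneq ne => ->.
  have [eS eP] := hS _ _ P0 Q0 ne; move: eS eP.
  move: (X (P + Q)) (X (P - Q)) (X P) (X Q) => x3 x4 x1 x2 eS eP.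
  split.
    transitivity (((x3 + x4) * (x1 - x2) ^+ 2 - 2%:R * r * (x1 - x2) ^+ 2) / u ^+ 3).
      by field.
    by rewrite eS /km_S; field.
  transitivity ((x3 * x4 * (x1 - x2) ^+ 2 - r * ((x3 + x4) * (x1 - x2) ^+ 2) +
    r ^+ 2 * (x1 - x2) ^+ 2) / u ^+ 4).
    by field.
  by rewrite eS eP /km_S /km_P; field.
- move=> P P0; have := hD _ P0; move: (X P) (X (P + P)) => x x2.
  have -> : km_psi ((b2 + 12%:R * r) / u) ((b4 + r * b2 + 6%:R * r ^+ 2) / u ^+ 2)
    ((b6 + 2%:R * r * b4 + r ^+ 2 * b2 + 4%:R * r ^+ 3) / u ^+ 3) ((x - r) / u) =
    km_psi b2 b4 b6 x / u ^+ 3 by rewrite /km_psi; field.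
  case: ifP => _; first by move=> ->; rewrite mul0r.
  move=> [p0 e]; split; first by rewrite mulf_neq0 // invr_neq0 // expf_neq0.
  transitivity ((x2 * km_psi b2 b4 b6 x - r * km_psi b2 b4 b6 x) / u ^+ 4); first by field.
  by rewrite e /km_phi /km_psi; field.
Qed.

(** * Valuation rings and torsion *)

Section Valring.
Variables (L : fieldType) (O : L -> Prop).
Hypothesis vO : valring O.

Let O1 : O 1. Proof. by case: vO. Qed.
Let OB x y : O x -> O y -> O (x - y). Proof. by case: vO => _ h _ _; apply: h. Qed.

Lemma vr0 : O 0. Proof. by rewrite -(subrr 1); apply: OB. Qed.
Lemma vrN x : O x -> O (- x). Proof. by rewrite -sub0r => h; apply: OB => //; apply: vr0. Qed.
Lemma vrD x y : O x -> O y -> O (x + y).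
Proof. by move=> hx hy; rewrite -(opprK y); apply: OB => //; apply: vrN. Qed.
Lemma vrM x y : O x -> O y -> O (x * y). Proof. by case: vO => _ _ h _; apply: h. Qed.
Lemma vrX x n : O x -> O (x ^+ n).
Proof. by move=> hx; elim: n => [|n IH]; rewrite ?expr0 ?exprS //; apply: vrM. Qed.
Lemma vrn n : O n%:R.
Proof. by elim: n => [|n IH]; [exact: vr0|rewrite mulrS; apply: vrD]. Qed.
Lemma vrV x : O x \/ O x^-1. Proof. by case: vO. Qed.

(** The maximal ideal; 0 is listed apart because its inverse is 0 by convention. *)
Definition vmax x := x = 0 \/ ~ O x^-1.

Lemma vmaxW x : vmax x -> O x.
Proof. by case=> [->|h]; [exact: vr0|case: (vrV x)]. Qed.

Lemma vmax0 : vmax 0. Proof. by left. Qed.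

Lemma vmax1 : ~ vmax 1.
Proof. by case=> [/eqP|]; rewrite ?oner_eq0 // invr1; apply. Qed.

Lemma vmaxM x y : vmax x -> O y -> vmax (x * y).
Proof.
case=> [->|hx] hy; first by left; rewrite mul0r.
have [->|y0] := eqVneq y 0; first by left; rewrite mulr0.
right => h; apply: hx; have -> : x^-1 = y * (x * y)^-1; last exact: vrM.
have [->|x0] := eqVneq x 0; first by rewrite mul0r !invr0 mulr0.
by field; apply/andP.
Qed.

Lemma vmaxMr x y : O x -> vmax y -> vmax (x * y).
Proof. by rewrite mulrC => hx hy; apply: vmaxM. Qed.

Lemma vmaxN x : vmax x -> vmax (- x).
Proof. by rewrite -mulN1r => h; apply: vmaxMr => //; apply: vrN. Qed.

Lemma vmaxD x y : vmax x -> vmax y -> vmax (x + y).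
Proof.
wlog hxy : x y / O (x / y).
  move=> wl hx hy; have [h|h] := vrV (x / y); first exact: wl.
  by rewrite addrC; apply: wl => //; rewrite invf_div in h.
have [->|y0] := eqVneq y 0; first by rewrite addr0.
move=> _ hy; have -> : x + y = y * (x / y + 1) by field.
by apply: vmaxM => //; apply: vrD.
Qed.

Lemma vmaxB x y : vmax x -> vmax y -> vmax (x - y).
Proof. by move=> hx hy; apply: vmaxD => //; apply: vmaxN. Qed.

Lemma vr_unit x : ~ vmax x -> x != 0 /\ O x^-1.
Proof.
move=> h; split; first by apply/eqP => x0; apply: h; left.
by apply: contrapT => h'; apply: h; right.
Qed.

Lemma vmax_prime x y : O x -> vmax (x * y) -> vmax x \/ vmax y.
Proof.
move=> hx hxy; have [h|h] := pselect (vmax x); first by left.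
have [x0 xV] := vr_unit h; right.
by rewrite -[y](mulKf x0); apply: vmaxMr.
Qed.

Lemma vmax1D x : vmax x -> ~ vmax (1 + x).
Proof. by move=> hx h; apply: vmax1; rewrite -(addrK x 1); apply: vmaxB. Qed.

Lemma vr_quad s p t : O s -> O p -> t ^+ 2 = s * t - p -> O t.
Proof.
move=> hs hp e; have [//|h] := vrV t; have [->|t0] := eqVneq t 0; first exact: vr0.
have -> : t = s - p * t^-1 by apply: (mulIf t0); rewrite -expr2 e; field.
by apply: OB => //; apply: vrM.
Qed.

Lemma vmax_quad s p t : vmax s -> vmax p -> t ^+ 2 = s * t - p -> vmax t.
Proof.
move=> hs hp e; apply: contrapT => /vr_unit[t0 tV]; apply: vmax1.
have -> : 1 = s * t^-1 - p * (t^-1) ^+ 2.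
  by apply: (mulIf (expf_neq0 2 t0)); rewrite mul1r {1}e; field.
by apply: vmaxB; apply: vmaxM => //; apply: vrX.
Qed.

Lemma vr_root n x : (0 < n)%N -> O (x ^+ n) -> O x.
Proof.
case: n => // n _ h; have [//|hV] := vrV x; have [->|x0] := eqVneq x 0; first exact: vr0.
have -> : x = x ^+ n.+1 * x^-1 ^+ n by rewrite exprS exprVn mulfK ?expf_neq0.
by apply: vrM => //; apply: vrX.
Qed.

Lemma vr_natV p n : p \in [pchar L] -> O n%:R^-1.
Proof.
move=> pL; have [->|n0] := eqVneq (n%:R : L) 0; first by rewrite invr0; apply: vr0.
have [p1 p0] := (prime_gt1 (pcharf_prime pL), prime_gt0 (pcharf_prime pL)).
have e : (n%:R : L) ^+ p = n%:R by rewrite -(pFrobenius_autE pL) pFrobenius_aut_nat.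
have -> : (n%:R^-1 : L) = n%:R ^+ (p - 2); last exact/vrX/vrn.
apply: (mulIf (expf_neq0 2 n0)); rewrite -exprD subnK // e.
by rewrite expr2 mulrA mulVf // mul1r.
Qed.

End Valring.

Ltac vr vO := first [assumption | lazymatch goal with
  | |- _ (_ + _) => apply: (vrD vO); vr vO
  | |- _ (- _) => apply: (vrN vO); vr vO
  | |- _ (_ * _) => apply: (vrM vO); vr vO
  | |- _ (_ ^+ _) => apply: (vrX vO); vr vO
  | |- _ (_ *+ _) => apply: (vrn vO)
  | |- _ 1 => apply: (vrn vO 1)
  | _ => try done
  end].

(** * The local parameter at the origin and the kernel of reduction *)

Section Tau.
Variables (L : fieldType) (M : zmodType) (X : M -> L) (b2 b4 b6 b8 : L).
Hypothesis kX : kummer b2 b4 b6 b8 X.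

(** The even local parameter at the origin. [tau_dom] excludes points with [X P = 0], where the
    inverse is a default value and [tau] should be infinite. *)
Definition tau (P : M) : L := if P == 0 then 0 else (X P)^-1.
Definition tau_dom (P : M) := (P == 0) || (X P != 0).
Definition km_U (t u : L) := 1 - b4 * t * u - b6 * t * u * (t + u) - b8 * t ^+ 2 * u ^+ 2.
Definition km_V (t u : L) := 2%:R * (t + u) + b2 * t * u + b4 * t * u * (t + u) + b6 * t ^+ 2 * u ^+ 2.

Lemma tauE P : P != 0 -> tau P = (X P)^-1.
Proof. by rewrite /tau => /negPf ->. Qed.

Lemma tau_eq0 P : tau_dom P -> tau P = 0 -> P = 0.
Proof.
rewrite /tau /tau_dom; case: eqP => //= _ X0 /eqP; by rewrite invr_eq0 (negPf X0).
Qed.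

Lemma tau0 : tau 0 = 0. Proof. by rewrite /tau eqxx. Qed.
Lemma tau_dom0 : tau_dom 0. Proof. by rewrite /tau_dom eqxx. Qed.

Lemma tauN P : tau (- P) = tau P.
Proof. by case: kX => _ hN _ _ _; rewrite /tau oppr_eq0 hN. Qed.
Lemma tau_domN P : tau_dom (- P) = tau_dom P.
Proof. by case: kX => _ hN _ _ _; rewrite /tau_dom oppr_eq0 hN. Qed.

(** In terms of [tau] one pair of identities covers every case of the group law, including the
    origin and [P = Q] or [P = - Q], where the formulas in [X] degenerate. *)
Lemma tau_addsub P Q : tau_dom P -> tau_dom Q -> km_U (tau P) (tau Q) != 0 ->
  [/\ tau_dom (P + Q), tau_dom (P - Q),
      (tau (P + Q) + tau (P - Q)) * km_U (tau P) (tau Q) = km_V (tau P) (tau Q) &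
      tau (P + Q) * tau (P - Q) * km_U (tau P) (tau Q) = (tau P - tau Q) ^+ 2].
Proof.
have [->|P0] := eqVneq P 0.
  rewrite tau0 add0r sub0r => _ dQ _; rewrite tau_domN tauN; split=> //; rewrite /km_U /km_V; ring.
have [->|Q0] := eqVneq Q 0.
  rewrite tau0 addr0 subr0 => dP _ _; split=> //; rewrite /km_U /km_V; ring.
case: (kX) => _ hN hI hS hD.
rewrite {1 2}/tau_dom (negPf P0) (negPf Q0) /= => x0 y0.
have tP : tau P = (X P)^-1 by rewrite /tau (negPf P0).
have tQ : tau Q = (X Q)^-1 by rewrite /tau (negPf Q0).
rewrite tP tQ; set x := X P in x0 tP *; set y := X Q in y0 tQ *.
have dbl R : R != 0 -> X R = x -> km_U x^-1 x^-1 != 0 ->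
    tau_dom (R + R) /\ tau (R + R) * km_U x^-1 x^-1 = km_V x^-1 x^-1.
  move=> R0 Rx U0; have := hD _ R0; rewrite /tau_dom /tau; case: ifP => _; rewrite Rx.
    move=> p0; split=> //; rewrite mul0r; apply/esym.
    by transitivity (km_psi b2 b4 b6 x / x ^+ 4); [rewrite /km_V /km_psi; field|rewrite p0 mul0r].
  move=> [p0 e].
  have UE : km_U x^-1 x^-1 = km_phi b4 b6 b8 x / x ^+ 4 by rewrite /km_U /km_phi; field.
  have X0 : X (R + R) != 0.
    by apply: contraNneq U0 => z; rewrite UE -e z !mul0r.
  split=> //; rewrite UE -e.
  transitivity (km_psi b2 b4 b6 x / x ^+ 4); last by rewrite /km_V /km_psi; field.
  by field; apply/andP.
have [e|ne] := eqVneq x y; last first.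
  move=> U0; have [eS eP] := hS _ _ P0 Q0 ne; rewrite -/x -/y in eS eP.
  have d0 : x - y != 0 by rewrite subr_eq0.
  have UE : km_U x^-1 y^-1 = km_P b4 b6 b8 x y / (x * y) ^+ 2.
    by rewrite /km_U /km_P; field; apply/andP.
  have VE : km_V x^-1 y^-1 = km_S b2 b4 b6 x y / (x * y) ^+ 2.
    by rewrite /km_V /km_S; field; apply/andP.
  have [X3 X4] : X (P + Q) != 0 /\ X (P - Q) != 0.
    by split; apply: contraNneq U0 => z; rewrite UE -eP z !(mul0r, mulr0).
  have s3 : P + Q != 0.
    rewrite addr_eq0; apply: contraNneq ne => z; by rewrite /x z hN.
  have s4 : P - Q != 0 by rewrite subr_eq0; apply: contraNneq ne => z; rewrite /x z.
  rewrite /tau_dom /tau (negPf s3) (negPf s4) X3 X4 UE VE -eS -eP; split=> //.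
    by field; apply/and4P.
  by field; apply/and4P.
rewrite -e => U0; have [PQ|PQ] := hI _ _ P0 Q0 e.
  have [d2 e2] := dbl _ Q0 (esym e) U0.
  by rewrite PQ subrr tau0 tau_dom0 addr0 mulr0 mul0r subrr expr0n.
have Px : X (- Q) = x by rewrite hN.
have NQ0 : - Q != 0 by rewrite oppr_eq0.
have [d2 e2] := dbl _ NQ0 Px U0.
by rewrite PQ addNr tau0 tau_dom0 add0r !mul0r subrr expr0n.
Qed.

Section TauO.
Variable O : L -> Prop.
Hypothesis vO : valring O.
Hypotheses (Ob2 : O b2) (Ob4 : O b4) (Ob6 : O b6) (Ob8 : O b8).

Definition formal P := tau_dom P /\ vmax O (tau P).

Lemma km_U_formal t u : vmax O t -> O u -> vmax O (km_U t u - 1).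
Proof.
move=> ht hu; have Ot := vmaxW vO ht.
have -> : km_U t u - 1 = t * (- (b4 * u + b6 * u * (t + u) + b8 * t * u ^+ 2)).
  by rewrite /km_U; ring.
apply: (vmaxM vO) => //; apply: (vrN vO); do ?apply: (vrD vO); do ?[apply: (vrM vO) => //];
  by [apply: (vrD vO)|apply: (vrX vO)].
Qed.

Lemma km_U_unit t u : vmax O t -> O u -> km_U t u != 0 /\ O (km_U t u)^-1.
Proof.
move=> ht hu; apply: vr_unit; rewrite -(subrK 1 (km_U t u)) addrC.
by apply: (vmax1D vO); apply: km_U_formal.
Qed.

(** The sum and the product of [tau (P + Q)] and [tau (P - Q)] lie in the maximal ideal, hence so do
    both roots of the quadratic equation they define. *)
Lemma formal_addsub P Q : formal P -> formal Q -> formal (P + Q) /\ formal (P - Q).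
Proof.
move=> [dP mP] [dQ mQ]; have [OP OQ] := (vmaxW vO mP, vmaxW vO mQ).
have [U0 UV] := km_U_unit mP OQ.
have [dS dD eS eP] := tau_addsub dP dQ U0.
have mV : vmax O (km_V (tau P) (tau Q)).
  have m1 : vmax O (tau P + tau Q) by apply: (vmaxD vO).
  rewrite /km_V; do ?apply: (vmaxD vO).
  - by apply: (vmaxMr vO) => //; apply: (vrn vO).
  - by apply: (vmaxMr vO) => //; apply: (vrM vO).
  - by apply: (vmaxMr vO) => //; do ?apply: (vrM vO).
  - rewrite [tau Q ^+ 2]expr2 mulrA; apply: (vmaxMr vO) => //.
    by do ?apply: (vrM vO) => //; apply: (vrX vO).
have sE : tau (P + Q) + tau (P - Q) = km_V (tau P) (tau Q) / km_U (tau P) (tau Q).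
  by rewrite -eS mulfK.
have pE : tau (P + Q) * tau (P - Q) = (tau P - tau Q) ^+ 2 / km_U (tau P) (tau Q).
  by rewrite -eP mulfK.
have ms : vmax O (tau (P + Q) + tau (P - Q)) by rewrite sE; apply: (vmaxM vO).
have mp : vmax O (tau (P + Q) * tau (P - Q)).
  rewrite pE; apply: (vmaxM vO) => //; rewrite expr2; apply: (vmaxM vO); first exact: (vmaxB vO).
  by apply: (vmaxW vO); apply: (vmaxB vO).
by split; split=> //; apply: (vmax_quad vO ms mp); ring.
Qed.

Lemma formal0 : formal 0.
Proof. by split; [exact: tau_dom0|rewrite tau0; left]. Qed.

(* In the formal group [t = 1 / x] is quadratic to first order:
   [t (n P) = n ^ 2 t (P)] up to higher terms. *)
Lemma formal_torsion P n : formal P -> P *+ n = 0 -> ~ vmax O n%:R -> P = 0.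
Proof.
move=> fP nP n0; apply: contrapT => /eqP P0.
have [dP mP] := fP; have t0 : tau P != 0 by apply: contra_neq P0; apply: tau_eq0.
pose y k := tau (P *+ k) / tau P.
have fk k : formal (P *+ k).
  elim: k => [|k IH]; first by rewrite mulr0n; apply: formal0.
  by rewrite mulrS; case: (formal_addsub fP IH).
have OP := vmaxW vO mP.
have mt k : vmax O (tau (P *+ k)) by case: (fk k).
have Ot k : O (tau (P *+ k)) by apply: (vmaxW vO).
suff key k : vmax O (y k - k%:R ^+ 2) /\ vmax O (y k.+1 - k.+1%:R ^+ 2).
  have [+ _] := key n; rewrite /y nP tau0 mul0r sub0r => /(vmaxN vO); rewrite opprK expr2.
  by move=> h; apply: n0; case: (vmax_prime vO (vrn vO n) h).
elim: k => [|k [IH0 IH1]].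
  rewrite /y mulr0n tau0 mul0r expr0n subrr mulr1n divff // expr1n subrr.
  by split; exact: vmax0.
split=> //.
have [dS dD eS _] := tau_addsub (fk k.+1).1 dP (km_U_unit (mt k.+1) OP).1.
have Psub : P *+ k.+1 - P = P *+ k by rewrite mulrSr addrK.
rewrite Psub -(mulrSr P k.+1) in eS.
have mU := km_U_formal (mt k.+1) OP; have [U0 UV] := km_U_unit (mt k.+1) OP.
set U := km_U _ _ in U0 UV eS mU.
pose t := tau (P *+ k.+1); pose u := tau P; rewrite -/t -/u in eS.
pose c : L := k.+1%:R.
have k2 : k.+2%:R = c + 1 :> L by rewrite /c -natr1.
have k0 : k%:R = c - 1 :> L by rewrite /c -natr1 addrK.
have e : (y k.+2 - (c + 1) ^+ 2) = (2%:R * (y k.+1 - c ^+ 2) - U * (y k - (c - 1) ^+ 2) +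
    t * (b2 + b4 * (t + u) + b6 * t * u) -
    (U - 1) * ((c - 1) ^+ 2 + (c + 1) ^+ 2)) * U^-1.
  apply: (mulIf U0); rewrite mulfVK //.
  have e1 : y k.+2 * U = km_V t u / u - y k * U.
    by rewrite -eS /y -/u; field.
  rewrite mulrBl e1 /km_V /y -/t -/u; field; exact: t0.
rewrite k2 e; apply: (vmaxM vO) => //.
have Oc : O c by apply: (vrn vO).
rewrite k0 in IH0; rewrite -/c in IH1.
apply: (vmaxB vO); [apply: (vmaxD vO); [apply: (vmaxB vO)|]|].
- by apply: (vmaxMr vO) => //; apply: (vrn vO).
- apply: (vmaxMr vO) => //; rewrite -(subrK 1 U); apply: (vrD vO); last by case: vO.
  exact: (vmaxW vO).
- apply: (vmaxM vO); first exact: mt.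
  have Ott : O t := Ot k.+1; have Ou : O u := OP.
  apply: (vrD vO); [apply: (vrD vO) => //|]; do ?[apply: (vrM vO) => //].
  exact: (vrD vO).
- apply: (vmaxM vO) => //; apply: (vrD vO); apply: (vrX vO).
    by case: (vO) => _ h _ _; apply: h => //; case: vO.
  by apply: (vrD vO) => //; case: vO.
Qed.

End TauO.
End Tau.

(** * Torsion of invertible order under good reduction *)

Section GoodReduction.
Variables (L : fieldType) (M : zmodType) (X : M -> L) (b2 b4 b6 b8 : L).
Hypothesis kX : kummer b2 b4 b6 b8 X.
Variable O : L -> Prop.
Hypothesis vO : valring O.
Hypotheses (Ob2 : O b2) (Ob4 : O b4) (Ob6 : O b6) (Ob8 : O b8).
Variable n : nat.
Hypothesis n_unit : ~ vmax O n%:R.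

Let OD := vrD vO.
Let OM := vrM vO.
Let ON := vrN vO.
Let OB x y : O x -> O y -> O (x - y). Proof. by move=> hx hy; apply: OD => //; apply: ON. Qed.

(** A pole would put [P] in the kernel of reduction, which has no torsion of invertible order. *)
Lemma torsion_integral P : P != 0 -> P *+ n = 0 -> O (X P).
Proof.
move=> P0 nP; apply: contrapT => nO; apply/negP: P0; rewrite negbK; apply/eqP.
have X0 : X P != 0 by apply/eqP => X0; apply: nO; rewrite X0; apply: (vr0 vO).
apply: (formal_torsion kX vO Ob2 Ob4 Ob6 Ob8 _ nP n_unit); split.
  by rewrite /tau_dom X0 orbT.
by rewrite /tau; case: ifP => _; [left|right; rewrite invrK].
Qed.

Lemma O_psi x : O x -> O (km_psi b2 b4 b6 x).
Proof.
by move=> hx; rewrite /km_psi; vr vO.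
Qed.

(** An explicit Bezout identity writes the discriminant as a combination of [km_psi] and [km_phi],
    modulo the relation that defines [b8]. *)
Lemma psi_phi_disc x : O x -> vmax O (km_psi b2 b4 b6 x) -> vmax O (km_phi b4 b6 b8 x) ->
  vmax O (km_disc b2 b4 b6 b8).
Proof.
move=> hx h1 h2; have hb : 4%:R * b8 = b2 * b6 - b4 ^+ 2 by case: kX.
have -> : km_disc b2 b4 b6 b8 =
   (12%:R * x ^+ 3 - b2 * x ^+ 2 - 10%:R * b4 * x + b2 * b4 - 27%:R * b6) * km_psi b2 b4 b6 x
   - (48%:R * x ^+ 2 + 8%:R * b2 * x + 32%:R * b4 - b2 ^+ 2) * km_phi b4 b6 b8 x.
  transitivity ((12%:R * x ^+ 3 - b2 * x ^+ 2 - 10%:R * b4 * x + b2 * b4 - 27%:R * b6) * km_psi b2 b4 b6 x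
   - (48%:R * x ^+ 2 + 8%:R * b2 * x + 32%:R * b4 - b2 ^+ 2) * km_phi b4 b6 b8 x
   - (4%:R * b8 - (b2 * b6 - b4 ^+ 2)) * (12%:R * x ^+ 2 + 2%:R * b2 * x + 8%:R * b4)).
    by rewrite /km_disc /km_psi /km_phi; ring.
  by rewrite hb subrr mul0r subr0.
by apply: (vmaxB vO); apply: (vmaxMr vO) => //; vr vO.
Qed.

Hypothesis disc_unit : ~ vmax O (km_disc b2 b4 b6 b8).

(** Modulo [d = X P - X Q] the polynomials [km_S] and [km_P] become [km_psi] and [km_phi]. If [d]
    were not a unit, integrality of [X (P + Q)] and [X (P - Q)] would force both into the maximal
    ideal. *)
Lemma torsion_sep P Q : P != 0 -> Q != 0 -> P *+ n = 0 -> Q *+ n = 0 -> X P != X Q ->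
  O (X P - X Q) /\ ~ vmax O (X P - X Q).
Proof.
move=> P0 Q0 nP nQ ne; have OP := torsion_integral P0 nP; have OQ := torsion_integral Q0 nQ.
split; first exact: OB.
move=> md; apply: disc_unit; have [_ hN _ hS _] := kX; have [eS eP] := hS _ _ P0 Q0 ne.
have s3 : P + Q != 0 by rewrite addr_eq0; apply: contraNneq ne => ->; rewrite hN.
have s4 : P - Q != 0 by rewrite subr_eq0; apply: contraNneq ne => ->.
have O3 : O (X (P + Q)) by apply: torsion_integral; rewrite // mulrnDl nP nQ addr0.
have O4 : O (X (P - Q)) by apply: torsion_integral; rewrite // mulrnBl nP nQ subr0.
set d := X P - X Q in md eS eP.
have Od : O d := vmaxW vO md.
have yE : X Q = X P - d by rewrite /d; ring.
rewrite yE in eS eP; set x := X P in OP eS eP *.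
apply: (@psi_phi_disc x) => //.
  have -> : km_psi b2 b4 b6 x = (X (P + Q) + X (P - Q)) * d ^+ 2 +
    d * (2%:R * x * (x + x - d) + 2%:R * x * x + b2 * x + b4).
    by rewrite eS /km_S /km_psi; ring.
  apply: (vmaxD vO).
    by rewrite expr2 mulrA; apply: (vmaxMr vO) => //; apply: OM => //; apply: OD.
  apply: (vmaxM vO) => //.
  by vr vO.
have -> : km_phi b4 b6 b8 x = X (P + Q) * X (P - Q) * d ^+ 2 +
    d * (x ^+ 2 * (x + x - d) - b4 * x - b6).
  by rewrite eP /km_P /km_phi; ring.
apply: (vmaxD vO).
  by rewrite expr2 mulrA; apply: (vmaxMr vO) => //; apply: OM => //; apply: OM.
apply: (vmaxM vO) => //.
by vr vO.
Qed.

Lemma torsion_psi P : P != 0 -> P + P != 0 -> P *+ n = 0 ->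
  O (km_psi b2 b4 b6 (X P)) /\ ~ vmax O (km_psi b2 b4 b6 (X P)).
Proof.
move=> P0 P2 nP; have OP := torsion_integral P0 nP.
split; first exact: O_psi.
have [_ _ _ _ hD] := kX; have := hD _ P0; rewrite (negPf P2) => -[p0 e] mp.
apply: disc_unit; apply: (psi_phi_disc OP) => //; rewrite -e.
apply: (vmaxMr vO) => //; apply: torsion_integral => //.
by rewrite mulrnDl nP addr0.
Qed.

End GoodReduction.

(** * The normal form determined by the invariant [j] *)

Section NormalForm.
Variables (L : fieldType) (M : zmodType) (X : M -> L) (b2 b4 b6 b8 : L).
Variables c4 c6 D : L.
Hypotheses (c4E : c4 = b2 ^+ 2 - 24%:R * b4)
  (c6E : c6 = - b2 ^+ 3 + 36%:R * b2 * b4 - 216%:R * b6) (DE : D = km_disc b2 b4 b6 b8).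

Definition normal_kummer (s : L) (M : zmodType) (X : M -> L) :=
  kummer 1 (- 72%:R * s) (- 4%:R * s) (- s - 1296%:R * s ^+ 2) X.

Lemma c4_c6 : 4%:R * b8 = b2 * b6 - b4 ^+ 2 -> c4 ^+ 3 - c6 ^+ 2 = 1728%:R * D.
Proof.
move=> hb; transitivity (1728%:R * D + 432%:R * b2 ^+ 2 * (4%:R * b8 - (b2 * b6 - b4 ^+ 2))).
  by rewrite c4E c6E DE /km_disc; ring.
by rewrite hb subrr mulr0 addr0.
Qed.

(* The quadratic twist by [- c4 / c6], centred at the limit of the nodes. *)
Lemma kummer_normal : c4 != 0 -> c6 != 0 -> kummer b2 b4 b6 b8 X ->
  normal_kummer (D / c6 ^+ 2) (fun P => (X P - (18%:R * b6 - b2 * b4) / c4) / (- c6 / c4)).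
Proof.
move=> c40 c60 kX; have u0 : - c6 / c4 != 0 by rewrite mulf_neq0 ?oppr_eq0 ?invr_eq0.
set r0 := 18%:R * b6 - b2 * b4; have := kummer_affine (r0 / c4) u0 kX.
have hb : 4%:R * b8 - (b2 * b6 - b4 ^+ 2) = 0 by case: kX => ->; rewrite subrr.
(* The coefficients agree only modulo the relation between the [b]'s; the long polynomials passed
   below as [w] are the cofactors of that relation. *)
have C u v (q : L) : q != 0 -> forall w : L, u - v = w * (4%:R * b8 - (b2 * b6 - b4 ^+ 2)) -> u / q = v / q.
  by move=> q0 w e; congr (_ / _); apply/eqP; rewrite -subr_eq0 e hb mulr0.
rewrite /normal_kummer.
have c6n : c6 ^+ 2 != 0 by rewrite expf_neq0.
have -> : (b2 + 12%:R * (r0 / c4)) / (- c6 / c4) = 1.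
  have e : b2 * c4 + 12%:R * r0 = - c6 by rewrite c4E c6E /r0; ring.
  transitivity ((b2 * c4 + 12%:R * r0) / (- c6)); first by field; rewrite ?oppr_eq0 ?expf_eq0 ?c40 ?c60.
  by rewrite e divff // oppr_eq0.
have -> : (b4 + r0 / c4 * b2 + 6%:R * (r0 / c4) ^+ 2) / (- c6 / c4) ^+ 2 = - 72%:R * (D / c6 ^+ 2).
  transitivity ((b4 * c4 ^+ 2 + r0 * b2 * c4 + 6%:R * r0 ^+ 2) / c6 ^+ 2).
    by field; rewrite ?oppr_eq0 ?expf_eq0 ?c40 ?c60.
  rewrite [RHS]mulrA; apply: (C _ _ _ c6n (- 18%:R * b2 ^+ 2)).
  by rewrite /r0 c4E DE /km_disc; ring.
have -> : (b6 + 2%:R * (r0 / c4) * b4 + (r0 / c4) ^+ 2 * b2 + 4%:R * (r0 / c4) ^+ 3) /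
    (- c6 / c4) ^+ 3 = - 4%:R * (D / c6 ^+ 2).
  transitivity ((b6 * c4 ^+ 3 + 2%:R * r0 * b4 * c4 ^+ 2 + r0 ^+ 2 * b2 * c4 + 4%:R * r0 ^+ 3) / (- c6 ^+ 3)).
    by field; rewrite ?oppr_eq0 ?expf_eq0 ?c40 ?c60.
  transitivity ((4%:R * D * c6) / (- c6 ^+ 3)); last by field; rewrite ?oppr_eq0 ?expf_eq0 ?c60.
  have c6n3 : - c6 ^+ 3 != 0 by rewrite oppr_eq0 expf_neq0.
  apply: (C _ _ _ c6n3 (- b2 ^+ 5 + 36%:R * b2 ^+ 3 * b4 - 216%:R * b2 ^+ 2 * b6)).
  by rewrite /r0 c4E c6E DE /km_disc; ring.
have -> : (b8 + 3%:R * (r0 / c4) * b6 + 3%:R * (r0 / c4) ^+ 2 * b4 + (r0 / c4) ^+ 3 * b2 +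
    3%:R * (r0 / c4) ^+ 4) / (- c6 / c4) ^+ 4 = - (D / c6 ^+ 2) - 1296%:R * (D / c6 ^+ 2) ^+ 2.
  transitivity ((b8 * c4 ^+ 4 + 3%:R * r0 * b6 * c4 ^+ 3 + 3%:R * r0 ^+ 2 * b4 * c4 ^+ 2 +
     r0 ^+ 3 * b2 * c4 + 3%:R * r0 ^+ 4) / c6 ^+ 4).
    by field; rewrite ?oppr_eq0 ?expf_eq0 ?c40 ?c60.
  transitivity ((- D * c6 ^+ 2 - 1296%:R * D ^+ 2) / c6 ^+ 4); last by field; rewrite ?oppr_eq0 ?expf_eq0 ?c60.
  have c6n4 : c6 ^+ 4 != 0 by rewrite expf_neq0.
  apply: (C _ _ _ c6n4 (- 6%:R * b2 ^+ 6 * b4 - 27%:R * b2 ^+ 5 * b6 + 459%:R * b2 ^+ 4 * b4 ^+ 2 +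
    324%:R * b2 ^+ 4 * b8 - 1944%:R * b2 ^+ 3 * b4 * b6 - 8640%:R * b2 ^+ 2 * b4 ^+ 3 +
    5832%:R * b2 ^+ 2 * b6 ^+ 2 + 82944%:R * b4 ^+ 4)).
  by rewrite /r0 c4E c6E DE /km_disc; ring.
by [].
Qed.

End NormalForm.

Lemma km_psi_affine (L : fieldType) (b2 b4 b6 u r x : L) : u != 0 ->
  km_psi ((b2 + 12%:R * r) / u) ((b4 + r * b2 + 6%:R * r ^+ 2) / u ^+ 2)
    ((b6 + 2%:R * r * b4 + r ^+ 2 * b2 + 4%:R * r ^+ 3) / u ^+ 3) ((x - r) / u) =
  km_psi b2 b4 b6 x / u ^+ 3.
Proof. by move=> u0; rewrite /km_psi; field. Qed.

Lemma km_disc_affine (L : fieldType) (b2 b4 b6 b8 u r : L) : u != 0 ->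
  4%:R * b8 = b2 * b6 - b4 ^+ 2 ->
  km_disc ((b2 + 12%:R * r) / u) ((b4 + r * b2 + 6%:R * r ^+ 2) / u ^+ 2)
    ((b6 + 2%:R * r * b4 + r ^+ 2 * b2 + 4%:R * r ^+ 3) / u ^+ 3)
    ((b8 + 3%:R * r * b6 + 3%:R * r ^+ 2 * b4 + r ^+ 3 * b2 + 3%:R * r ^+ 4) / u ^+ 4) =
  km_disc b2 b4 b6 b8 / u ^+ 6.
Proof.
move=> u0 hb.
transitivity ((km_disc b2 b4 b6 b8 + (4%:R * b8 - (b2 * b6 - b4 ^+ 2)) *
   (- 6%:R * b2 * r - 36%:R * r ^+ 2)) / u ^+ 6); first by rewrite /km_disc; field.
by rewrite hb subrr mul0r addr0.
Qed.

Lemma closed_field_root (L : closedFieldType) (c : L) n : (0 < n)%N -> exists u, u ^+ n = c.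
Proof.
move=> n0; have : size ('X^n - c%:P) != 1%N by rewrite size_XnsubC // eqSS -lt0n.
by case/closed_rootP => u; rewrite rootE !hornerE subr_eq0 => /eqP; exists u.
Qed.

(** * Potential good reduction where [j] is finite *)

Section GoodModel.
Variables (L : closedFieldType) (p : nat) (pL : p \in [pchar L]) (s : L) (O : L -> Prop).
Hypotheses (vO : valring O) (s0 : s != 0) (t0 : 1 + 1728%:R * s != 0).
Hypothesis Oj : O (s^-1 + 1728%:R).

Lemma normal_disc : km_disc 1 (- 72%:R * s) (- 4%:R * s) (- s - 1296%:R * s ^+ 2) =
  s * (1 + 1728%:R * s) ^+ 2.
Proof. by rewrite /km_disc; ring. Qed.

Definition good_coef u r (b2 b4 b6 b8 : L) :=
  [/\ b2 = (1 + 12%:R * r) / u, b4 = (- 72%:R * s + r * 1 + 6%:R * r ^+ 2) / u ^+ 2,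
     b6 = (- 4%:R * s + 2%:R * r * (- 72%:R * s) + r ^+ 2 * 1 + 4%:R * r ^+ 3) / u ^+ 3 &
     b8 = (- s - 1296%:R * s ^+ 2 + 3%:R * r * (- 4%:R * s) + 3%:R * r ^+ 2 * (- 72%:R * s) +
       r ^+ 3 * 1 + 3%:R * r ^+ 4) / u ^+ 4].

(** In characteristic 2, [r] is chosen to make [b8] vanish. Then [1 / u] is integral since
    [u^-6 = s^-1 = j], [B = r^2 / u^3] satisfies [(B^2 + 1)^2 = B^3 / u^3], and [b4^2 = B / u]. *)
Lemma good_coef2 u : 2%:R = 0 :> L -> u != 0 -> u ^+ 6 = s * (1 + 1728%:R * s) ^+ 2 ->
  exists r b2 b4 b6 b8, good_coef u r b2 b4 b6 b8 /\ [/\ O b2, O b4, O b6 & O b8].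
Proof.
move=> z2 u0 u6.
have u6s : u ^+ 6 = s.
  by rewrite u6 -[RHS]addr0 -(mul0r (s * (1728%:R * s + 864%:R * 1728%:R * s ^+ 2))) -z2; ring.
have [r re] : exists r, r ^+ 4 + r ^+ 3 + s = 0.
  have : size ('X^4 + ('X^3 + s%:P)) != 1%N.
    by rewrite size_polyDl !size_polyXn // size_polyDl ?size_polyXn // (leq_ltn_trans (size_polyC_leq1 _)).
  by case/closed_rootP => r; rewrite rootE !hornerE /= => /eqP re; exists r; apply: (etrans _ re); ring.
exists r, (1 / u), (r / u ^+ 2), (r ^+ 2 / u ^+ 3), 0; split.
  split.
  - rewrite -[LHS]addr0 -(mul0r (6%:R * r / u)) -z2; field; exact: u0.
  - rewrite -[LHS]addr0 -(mul0r ((- 36%:R * s + 3%:R * r ^+ 2) / u ^+ 2)) -z2; field; exact: u0.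
  - rewrite -[LHS]addr0 -(mul0r ((- 2%:R * s - 72%:R * r * s + 2%:R * r ^+ 3) / u ^+ 3)) -z2.
    by field.
  - transitivity ((r ^+ 4 + r ^+ 3 + s + 2%:R * (- s - 648%:R * s ^+ 2 - 6%:R * r * s -
      108%:R * r ^+ 2 * s + r ^+ 4)) / u ^+ 4); last by field.
    by rewrite re z2 mul0r addr0 mul0r.
have O2 : O (1 / u).
  apply: (vr_root vO (n := 6)) => //; rewrite expr_div_n expr1n u6s mul1r.
  by rewrite -[X in O X]addr0 -(mul0r 864%:R) -z2 -natrM.
have O6 : O (r ^+ 2 / u ^+ 3).
  set B := r ^+ 2 / u ^+ 3; have [//|OV] := vrV vO B.
  have [->|B0] := eqVneq B 0; first exact: (vr0 vO).
  have r0 : r != 0 by apply: contra_neq B0 => r0; rewrite /B r0 expr0n mul0r.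
  have -> : B = (1 / u) ^+ 3 - 2%:R * B^-1 - B^-1 ^+ 3; last by vr vO.
  have B2 : B ^+ 2 + 1 = - (r ^+ 3 / u ^+ 6).
    apply/eqP; rewrite -addr_eq0; apply/eqP.
    transitivity ((r ^+ 4 + r ^+ 3 + u ^+ 6) / u ^+ 6); first by rewrite /B; field.
    by rewrite u6s re mul0r.
  have B4 : (B ^+ 2 + 1) ^+ 2 = (1 / u) ^+ 3 * B ^+ 3 by rewrite B2 /B; field.
  apply: (mulIf (expf_neq0 3 B0)).
  transitivity ((B ^+ 2 + 1) ^+ 2 - 2%:R * B ^+ 2 - 1); first by ring.
  rewrite B4; field; exact/andP.
split=> //; last exact: (vr0 vO).
apply: (vr_root vO (n := 2)) => //.
have -> : (r / u ^+ 2) ^+ 2 = 1 / u * (r ^+ 2 / u ^+ 3) by field.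
by vr vO.
Qed.

(** In characteristic 3, [r] is chosen to make [b6] vanish. Then [x = r / u^2] satisfies
    [x^3 + x^2 / u^2 = 1], and [1 / u] is integral since [u^-6 = j]. *)
Lemma good_coef3 u : 3%:R = 0 :> L -> u != 0 -> u ^+ 6 = s * (1 + 1728%:R * s) ^+ 2 ->
  exists r b2 b4 b6 b8, good_coef u r b2 b4 b6 b8 /\ [/\ O b2, O b4, O b6 & O b8].
Proof.
move=> z3 u0 u6.
have u6s : u ^+ 6 = s.
  by rewrite u6 -[RHS]addr0 -(mul0r (s * (1152%:R * s + 576%:R * 1728%:R * s ^+ 2))) -z3; ring.
have [r re] : exists r, r ^+ 3 + r ^+ 2 - s = 0.
  have : size ('X^3 + ('X^2 - s%:P)) != 1%N.
    by rewrite size_polyDl !size_polyXn // size_polyDl ?size_polyXn // size_polyN (leq_ltn_trans (size_polyC_leq1 _)).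
  by case/closed_rootP => r; rewrite rootE !hornerE /= => /eqP re; exists r; apply: (etrans _ re); ring.
exists r, (1 / u), (r / u ^+ 2), 0, (- (r / u ^+ 2) ^+ 2); split.
  split.
  - rewrite -[LHS]addr0 -(mul0r (4%:R * r / u)) -z3; field; exact: u0.
  - rewrite -[LHS]addr0 -(mul0r ((- 24%:R * s + 2%:R * r ^+ 2) / u ^+ 2)) -z3; field; exact: u0.
  - transitivity ((r ^+ 3 + r ^+ 2 - s + 3%:R * (- s - 48%:R * r * s + r ^+ 3)) / u ^+ 3); last by field.
    by rewrite re z3 mul0r addr0 mul0r.
  - transitivity ((- r ^+ 2 + (r ^+ 3 + r ^+ 2 - s) +
      3%:R * (- 432%:R * s ^+ 2 - 4%:R * r * s - 72%:R * r ^+ 2 * s + r ^+ 4)) / u ^+ 4).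
      by rewrite re z3 mul0r !addr0; field.
    by field.
have O2 : O (1 / u).
  apply: (vr_root vO (n := 6)) => //; rewrite expr_div_n expr1n u6s mul1r.
  by rewrite -[X in O X]addr0 -(mul0r 576%:R) -z3 -natrM.
suff O4 : O (r / u ^+ 2) by split=> //; [exact: (vr0 vO)|vr vO].
set x := r / u ^+ 2; have [//|OV] := vrV vO x.
have [->|x0] := eqVneq x 0; first exact: (vr0 vO).
have -> : x = x^-1 ^+ 2 - (1 / u) ^+ 2; last by vr vO.
apply: (mulIf (expf_neq0 2 x0)); rewrite mulrBl -exprMn mulVf // expr1n.
apply/eqP; rewrite -subr_eq0; apply/eqP.
transitivity ((r ^+ 3 + r ^+ 2 - u ^+ 6) / u ^+ 6); first by rewrite /x; field.
by rewrite u6s re mul0r.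
Qed.

(** With 12 invertible, [r = - 1 / 12] makes [b2] vanish; up to powers of 24 and 216, [b4^3] is then
    [- j] and [b6^2] is [j - 1728]. *)
Lemma good_coef5 u : 2%:R != 0 :> L -> 3%:R != 0 :> L -> u != 0 ->
  u ^+ 6 = s * (1 + 1728%:R * s) ^+ 2 ->
  exists r b2 b4 b6 b8, good_coef u r b2 b4 b6 b8 /\ [/\ O b2, O b4, O b6 & O b8].
Proof.
move=> n2 n3 u0 u6.
have nV k : O (k%:R^-1) := vr_natV vO k pL.
have n12 : 12%:R != 0 :> L by rewrite (natrM _ 3 4) (natrM _ 2 2) !mulf_neq0.
have n24 : 24%:R != 0 :> L by rewrite (natrM _ 2 12) !mulf_neq0.
have n216 : 216%:R != 0 :> L by rewrite (natrM _ 9 24) mulf_neq0 // (natrM _ 3 3) mulf_neq0.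
have n4 : 4%:R != 0 :> L by rewrite (natrM _ 2 2) mulf_neq0.
pose b4 := - (1728%:R * s + 1) / 24%:R / u ^+ 2.
pose b6 := (1728%:R * s + 1) / 216%:R / u ^+ 3.
have O4 : O b4.
  apply: (vr_root vO (n := 3)) => //.
  have -> : b4 ^+ 3 = - (s^-1 + 1728%:R) * (24%:R^-1) ^+ 3.
    rewrite /b4; move: (24%:R : L) n24 => d n24.
    transitivity (- (1 + 1728%:R * s) ^+ 3 / d ^+ 3 / u ^+ 6).
      by field; rewrite ?u0 ?n24 ?n216.
    by rewrite u6; field; rewrite s0 n24 t0.
  by vr vO.
have O6 : O b6.
  apply: (vr_root vO (n := 2)) => //.
  have -> : b6 ^+ 2 = (s^-1 + 1728%:R - 1728%:R) * (216%:R^-1) ^+ 2.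
    rewrite /b6; move: (216%:R : L) n216 => d n216.
    transitivity ((1 + 1728%:R * s) ^+ 2 / d ^+ 2 / u ^+ 6).
      by field; rewrite ?u0 ?n24 ?n216.
    by rewrite u6; field; rewrite s0 n216 t0.
  by vr vO.
exists (- 12%:R^-1), 0, b4, b6, (- (b4 ^+ 2) / 4%:R); split.
  have n12E : 12%:R = 3%:R * 2%:R * 2%:R :> L by rewrite -!natrM.
  have n24E : 24%:R = 3%:R * 2%:R * 2%:R * 2%:R :> L by rewrite -!natrM.
  have n216E : 216%:R = 3%:R * 3%:R * 3%:R * 2%:R * 2%:R * 2%:R :> L by rewrite -!natrM.
  have n4E : 4%:R = 2%:R * 2%:R :> L by rewrite -!natrM.
  split.
  - by rewrite mulrN mulfV // subrr mul0r.
  - by rewrite /b4; field; rewrite ?n12 ?n24 ?u0.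
  - by rewrite /b6; field; rewrite ?n12 ?n216 ?u0.
  - by rewrite /b4; field; rewrite ?n12 ?n24 ?u0 ?n4.
split=> //; first exact: (vr0 vO).
by vr vO.
Qed.

(** Taking [u^6] equal to the discriminant of the normal form makes the new discriminant 1; only the
    translation [r] depends on the characteristic. This is the origin of the exponent 6 and of the
    mean 1/6. *)
Lemma good_model : exists u r b2 b4 b6 b8,
  [/\ u != 0, u ^+ 6 = s * (1 + 1728%:R * s) ^+ 2, good_coef u r b2 b4 b6 b8 &
    [/\ O b2, O b4, O b6 & O b8]].
Proof.
have [u u6] := @closed_field_root L (s * (1 + 1728%:R * s) ^+ 2) 6 isT.
have u0 : u != 0.
  apply/eqP => u0; move/eqP: u6; rewrite u0 expr0n /= eq_sym mulf_eq0 expf_eq0.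
  by rewrite (negPf s0) (negPf t0).
have [r [b2 [b4 [b6 [b8 [h1 h2]]]]]] :
    exists r b2 b4 b6 b8, good_coef u r b2 b4 b6 b8 /\ [/\ O b2, O b4, O b6 & O b8].
  have [z2|n2] := eqVneq (2%:R : L) 0; first exact: good_coef2.
  have [z3|n3] := eqVneq (3%:R : L) 0; first exact: good_coef3.
  exact: good_coef5.
by exists u, r, b2, b4, b6, b8; split.
Qed.

Variables (M : zmodType) (X : M -> L) (n : nat).
Hypotheses (kX : normal_kummer s X) (n_unit : n%:R != 0 :> L).

Lemma vr_natU k : k%:R != 0 :> L -> ~ vmax O k%:R.
Proof. by move=> k0 [/eqP|]; [rewrite (negPf k0)|apply; apply: vr_natV pL]. Qed.

Lemma unit_intro x : O x -> ~ vmax O x -> [/\ x != 0, O x & O x^-1].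
Proof. by move=> h /vr_unit[]. Qed.

Lemma good_units P Q : P != 0 -> Q != 0 -> P *+ n = 0 -> Q *+ n = 0 -> X P != X Q ->
  let e := (X P - X Q) ^+ 6 / (s * (1 + 1728%:R * s) ^+ 2) in O e /\ O e^-1.
Proof.
have [u [r [b2 [b4 [b6 [b8 [u0 u6 [e2 e4 e6 e8] [O2 O4 O6 O8]]]]]]]] := good_model.
move=> P0 Q0 nP nQ ne /=; have := kummer_affine r u0 kX; rewrite -e2 -e4 -e6 -e8 => kX'.
have dU : ~ vmax O (km_disc b2 b4 b6 b8).
  rewrite e2 e4 e6 e8 km_disc_affine //; last by case: kX.
  rewrite normal_disc -u6 mulfV ?expf_neq0 //; exact: vmax1.
have ne' : (X P - r) / u != (X Q - r) / u.
  by apply: contraNneq ne => /(mulIf (invr_neq0 u0))/addIr ->.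
have [h1 h2] := torsion_sep kX' vO O2 O4 O6 O8 (vr_natU n_unit) dU P0 Q0 nP nQ ne'.
have [d0 d1 d2] := unit_intro h1 h2.
have -> : (X P - X Q) ^+ 6 / (s * (1 + 1728%:R * s) ^+ 2) =
    ((X P - r) / u - (X Q - r) / u) ^+ 6 by rewrite -u6; field.
by rewrite -exprVn; split; apply: (vrX vO).
Qed.

Lemma good_psi_units P : P != 0 -> P + P != 0 -> P *+ n = 0 ->
  let e := km_psi 1 (- 72%:R * s) (- 4%:R * s) (X P) ^+ 2 / (s * (1 + 1728%:R * s) ^+ 2) in
  O e /\ O e^-1.
Proof.
have [u [r [b2 [b4 [b6 [b8 [u0 u6 [e2 e4 e6 e8] [O2 O4 O6 O8]]]]]]]] := good_model.
move=> P0 P2 nP /=; have := kummer_affine r u0 kX; rewrite -e2 -e4 -e6 -e8 => kX'.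
have dU : ~ vmax O (km_disc b2 b4 b6 b8).
  rewrite e2 e4 e6 e8 km_disc_affine //; last by case: kX.
  rewrite normal_disc -u6 mulfV ?expf_neq0 //; exact: vmax1.
have [h1 h2] := torsion_psi kX' vO O2 O4 O6 O8 (vr_natU n_unit) dU P0 P2 nP.
have [d0 d1 d2] := unit_intro h1 h2.
have -> : km_psi 1 (- 72%:R * s) (- 4%:R * s) (X P) ^+ 2 / (s * (1 + 1728%:R * s) ^+ 2) =
    km_psi b2 b4 b6 ((X P - r) / u) ^+ 2.
  by rewrite e2 e4 e6 km_psi_affine // -u6; field.
by rewrite -exprVn; split; apply: (vrX vO).
Qed.

End GoodModel.

(** * Local heights at infinity *)

(** The value at 0 is arbitrary, hence the nonvanishing conditions; [vge] and [vgt] treat it as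
    infinite. *)
Definition is_val (L : fieldType) (w : L -> rat) :=
  (forall x y, x != 0 -> y != 0 -> w (x * y) = w x + w y) /\
  (forall x y, x != 0 -> y != 0 -> x + y != 0 -> Num.min (w x) (w y) <= w (x + y)).

Section Val.
Variables (L : fieldType) (w : L -> rat).
Hypothesis hw : is_val w.

Definition vge x r := x = 0 \/ r <= w x.
Definition vgt x r := x = 0 \/ r < w x.

Lemma valM x y : x != 0 -> y != 0 -> w (x * y) = w x + w y.
Proof. by case: hw => h _; apply: h. Qed.

Lemma val1 : w 1 = 0.
Proof.
have := valM (oner_neq0 L) (oner_neq0 L); rewrite mulr1 => /eqP.
by rewrite -subr_eq subrr eq_sym => /eqP.
Qed.

Lemma valX x k : x != 0 -> w (x ^+ k) = w x *+ k.
Proof.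
move=> x0; elim: k => [|k IH]; first by rewrite expr0 val1.
by rewrite exprS valM ?expf_neq0 // IH mulrS.
Qed.

Lemma val_root1 x k : (0 < k)%N -> x ^+ k = 1 -> w x = 0.
Proof.
move=> k0 e; have x0 : x != 0.
  by apply: contra_eq_neq e => ->; rewrite expr0n eqn0Ngt k0 eq_sym oner_neq0.
by have /eqP := valX k x0; rewrite e val1 eq_sym mulrn_eq0 eqn0Ngt k0 => /eqP.
Qed.

Lemma valV x : x != 0 -> w x^-1 = - w x.
Proof.
move=> x0; apply/eqP; rewrite -addr_eq0 addrC -valM ?invr_eq0 // mulfV //.
by rewrite val1.
Qed.

Lemma valN x : w (- x) = w x.
Proof.
have [->|x0] := eqVneq x 0; first by rewrite oppr0.
rewrite -mulN1r valM ?oppr_eq0 ?oner_eq0 // (@val_root1 (-1) 2) ?add0r //.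
by rewrite sqrrN expr1n.
Qed.

Lemma vge_vgt x r r' : vge x r -> r' < r -> vgt x r'.
Proof. by case=> [->|h] h'; [left|right; apply: lt_le_trans h]. Qed.

Lemma vgt_vge x r : vgt x r -> vge x r.
Proof. by case=> [->|h]; [left|right; apply: ltW]. Qed.

Lemma vgeW x r r' : vge x r -> r' <= r -> vge x r'.
Proof. by case=> [->|h] h'; [left|right; apply: le_trans h]. Qed.

Lemma vgeD x y r : vge x r -> vge y r -> vge (x + y) r.
Proof.
have [->|x0] := eqVneq x 0; first by rewrite add0r.
have [->|y0] := eqVneq y 0; first by rewrite addr0.
have [->|xy0] := eqVneq (x + y) 0; first by left.
case=> [/eqP|hx]; first by rewrite (negPf x0).
case=> [/eqP|hy]; first by rewrite (negPf y0).
by right; apply: le_trans (hw.2 _ _ x0 y0 xy0); rewrite le_min hx hy.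
Qed.

Lemma vgtD x y r : vgt x r -> vgt y r -> vgt (x + y) r.
Proof.
have [->|x0] := eqVneq x 0; first by rewrite add0r.
have [->|y0] := eqVneq y 0; first by rewrite addr0.
have [->|xy0] := eqVneq (x + y) 0; first by left.
case=> [/eqP|hx]; first by rewrite (negPf x0).
case=> [/eqP|hy]; first by rewrite (negPf y0).
by right; apply: lt_le_trans (hw.2 _ _ x0 y0 xy0); rewrite lt_min hx hy.
Qed.

Lemma vgeN x r : vge x r -> vge (- x) r.
Proof. by case=> [->|h]; [left; rewrite oppr0|right; rewrite valN]. Qed.

Lemma vgtN x r : vgt x r -> vgt (- x) r.
Proof. by case=> [->|h]; [left; rewrite oppr0|right; rewrite valN]. Qed.

Lemma vgeM x y r t : vge x r -> vge y t -> vge (x * y) (r + t).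
Proof.
case=> [->|hx]; first by left; rewrite mul0r.
case=> [->|hy]; first by left; rewrite mulr0.
have [->|x0] := eqVneq x 0; first by left; rewrite mul0r.
have [->|y0] := eqVneq y 0; first by left; rewrite mulr0.
by right; rewrite valM // lerD.
Qed.

Lemma vgeX x r k : vge x r -> vge (x ^+ k) (k%:R * r).
Proof.
move=> h; elim: k => [|k IH]; first by right; rewrite expr0 val1 mul0r.
by rewrite exprS -natr1 mulrDl mul1r addrC; apply: vgeM.
Qed.

Lemma vge_nat k : vge k%:R 0.
Proof.
elim: k => [|k IH]; first by left.
by rewrite mulrS; apply: vgeD => //; right; rewrite val1.
Qed.

Lemma vge_self x : vge x (w x). Proof. by right. Qed.

Lemma val_dom x y : x != 0 -> vgt y (w x) -> x + y != 0 /\ w (x + y) = w x.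
Proof.
move=> x0 hy; have xy0 : x + y != 0.
  apply/eqP => xy; have yE : y = - x by apply/eqP; rewrite -addr_eq0 addrC xy.
  by case: hy => [y0|]; [move: x0; rewrite -oppr_eq0 -yE y0 eqxx|rewrite yE valN ltxx].
split=> //; apply/eqP; rewrite eq_le; apply/andP; split; last first.
  by case: (vgeD (vge_self x) (vgt_vge hy)) => // /eqP; rewrite (negPf xy0).
rewrite leNgt; apply/negP => lt.
have : vgt (x + y - y) (w x) by apply: vgtD; [right|apply: vgtN].
by rewrite addrK => -[/eqP|]; [rewrite (negPf x0)|rewrite ltxx].
Qed.

Lemma valring_val : valring (fun x => vge x 0).
Proof.
split.
- by right; rewrite val1.
- by move=> x y hx hy; apply: vgeD => //; apply: vgeN.
- by move=> x y hx hy; have := vgeM hx hy; rewrite addr0.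
- move=> x; have [->|x0] := eqVneq x 0; first by left; left.
  by have [h|h] := leP 0 (w x); [left; right|right; right; rewrite valV // oppr_ge0 ltW].
Qed.

Lemma vmax_val x : vmax (fun x => vge x 0) x <-> vgt x 0.
Proof.
split; last first.
  case=> [->|h]; first by left.
  have [->|x0] := eqVneq x 0; first by left.
  right => -[/eqP|]; first by rewrite invr_eq0 (negPf x0).
  by rewrite valV // oppr_ge0 leNgt h.
case=> [->|h]; first by left.
have [->|x0] := eqVneq x 0; first by left.
by right; rewrite ltNge; apply/negP => h'; apply: h; right; rewrite valV // oppr_ge0.
Qed.

End Val.

Ltac vget hw := first [eassumption | lazymatch goal with
  | |- vge _ (- _) _ => eapply (vgeN hw); vget hw
  | |- vge _ (_ * _) _ => eapply (vgeM hw); [vget hw|vget hw]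
  | |- vge _ (_ ^+ _) _ => eapply (vgeX hw); vget hw
  | |- vge _ (_ *+ _) _ => apply (vge_nat hw)
  end].
Ltac vgts hw := lazymatch goal with
  | |- vgt _ (_ + _) _ => eapply (vgtD hw); vgts hw
  | |- vgt _ (- _) _ => eapply (vgtN hw); vgts hw
  | |- _ => eapply vge_vgt; [vget hw|try lra]
  end.

(* For a point of a Tate curve [L^* / q^Z] with [w q = 1] that is represented by [u],
   [0 <= w u < 1], this is [min (w u) (1 - w u)] at [X P]. *)
Definition cap (L : fieldType) (w : L -> rat) (x : L) : rat :=
  if x == 0 then 2%:R^-1 else Num.min (w x) 2%:R^-1.

Section Local.
Variables (L : fieldType) (w : L -> rat) (s : L) (M : zmodType) (X : M -> L).
Variable n : nat.
Hypotheses (hw : is_val w) (s0 : s != 0) (ws : w s = 1) (kX : normal_kummer s X).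
Hypothesis n_unit : ~ vmax (fun x => vge w x 0) n%:R.

Local Notation f := (cap w).

Let sV : vge w s 1. Proof. by right; rewrite ws. Qed.

Lemma normal_vge : [/\ vge w 1 0, vge w (- 72%:R * s) 0, vge w (- 4%:R * s) 0 &
  vge w (- s - 1296%:R * s ^+ 2) 0].
Proof.
split; first by right; rewrite val1.
- by apply: vgt_vge; vgts hw.
- by apply: vgt_vge; vgts hw.
- by apply: vgt_vge; vgts hw.
Qed.

Lemma torsion_vge P : P != 0 -> P *+ n = 0 -> vge w (X P) 0.
Proof.
move=> P0 nP; have [h1 h2 h3 h4] := normal_vge.
exact: (torsion_integral kX (valring_val hw) h1 h2 h3 h4 n_unit).
Qed.

Lemma cap_le x : f x <= 2%:R^-1.
Proof. by rewrite /cap; case: ifP => // _; rewrite ge_min lexx orbT. Qed.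

Lemma cap_vge x : vge w x (f x).
Proof. by rewrite /cap; case: eqP => [->|_]; [left|right; rewrite ge_min lexx]. Qed.

Lemma cap_ge0 x : vge w x 0 -> 0 <= f x.
Proof. by rewrite /cap; case: eqP => // /eqP x0 [/eqP|h]; [rewrite (negPf x0)|rewrite le_min h]. Qed.

Lemma cap_lt x : f x < 2%:R^-1 -> x != 0 /\ w x = f x.
Proof.
rewrite /cap; case: eqP => [_|_]; first by rewrite ltxx.
case: (leP (w x) 2%:R^-1) => /= _; first by []. by rewrite ltxx.
Qed.

Lemma km_P_large x y : vge w x 2%:R^-1 -> vge w y 2%:R^-1 ->
  let c := km_P (- 72%:R * s) (- 4%:R * s) (- s - 1296%:R * s ^+ 2) x y in c != 0 /\ w c = 1.
Proof.
move=> hx hy /=.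
have -> : km_P (- 72%:R * s) (- 4%:R * s) (- s - 1296%:R * s ^+ 2) x y =
  s + (1296%:R * s ^+ 2 + x ^+ 2 * y ^+ 2 + 72%:R * s * x * y + (4%:R * s * x + 4%:R * s * y)).
  by rewrite /km_P; ring.
by rewrite -ws; apply: val_dom => //; rewrite ws; vgts hw.
Qed.

Lemma val_sqr_eq u d c : u * d ^+ 2 = c -> c != 0 -> d != 0 -> vge w u 0 ->
  w d *+ 2 <= w c.
Proof.
move=> <- c0 d0 hu; have u0 : u != 0 by apply: contraNneq c0 => ->; rewrite mul0r.
rewrite (valM hw) ?expf_neq0 // (valX hw) // lerDr.
by case: hu => // /eqP; rewrite (negPf u0).
Qed.

(** Different caps are settled by the ultrametric inequality. If both equal [a], one of [km_S] and
    [km_P] has a dominant term of valuation [2 a]; as [X (P + Q)] and [X (P - Q)] are integral, the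
    difference cannot have valuation above [a]. *)
Lemma local_min P Q : P != 0 -> Q != 0 -> P *+ n = 0 -> Q *+ n = 0 -> X P != X Q ->
  w (X P - X Q) = Num.min (f (X P)) (f (X Q)).
Proof.
wlog le : P Q / f (X P) <= f (X Q).
  move=> wl P0 Q0 nP nQ ne; have [le|/ltW le] := leP (f (X P)) (f (X Q)).
    by have := wl P Q le P0 Q0 nP nQ ne; rewrite min_l.
  by have := wl Q P le Q0 P0 nQ nP; rewrite eq_sym => /(_ ne); rewrite min_l // -(valN hw) opprB.
move=> P0 Q0 nP nQ ne; rewrite min_l //.
have [_ hN _ hS _] := kX; have [eS eP] := hS _ _ P0 Q0 ne.
have s3 : P + Q != 0 by rewrite addr_eq0; apply: contraNneq ne => ->; rewrite hN.
have s4 : P - Q != 0 by rewrite subr_eq0; apply: contraNneq ne => ->.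
have O3 : vge w (X (P + Q)) 0 by apply: torsion_vge; rewrite // mulrnDl nP nQ addr0.
have O4 : vge w (X (P - Q)) 0 by apply: torsion_vge; rewrite // mulrnBl nP nQ subr0.
have OP := torsion_vge P0 nP; have OQ := torsion_vge Q0 nQ.
have O34 : vge w (X (P + Q) + X (P - Q)) 0 by apply: (vgeD hw).
have O34' : vge w (X (P + Q) * X (P - Q)) 0 by have := vgeM hw O3 O4; rewrite addr0.
have d0 : X P - X Q != 0 by rewrite subr_eq0.
move: (cap_ge0 OP) (cap_vge (X P)) (cap_vge (X Q)) (cap_le (X Q)) le (@cap_lt (X P)) (@cap_lt (X Q)) eS eP ne d0.
set x := X P; set y := X Q; set a := f x; set b := f y.
move=> a0 xa yb b2 le xl yl eS eP ne d0.
have [lt|/eqP ab] : a < b \/ a == b by apply/orP; rewrite orbC -le_eqVlt.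
  have [x0 wx] := xl (lt_le_trans lt b2).
  by have [] := @val_dom _ _ hw x (- y) x0; rewrite ?wx //; apply: (vgtN hw); apply: vge_vgt yb lt.
have da : a <= w (x - y).
  have : vge w (x - y) a by apply: (vgeD hw) => //; apply: (vgeN hw); rewrite ab.
  by case=> // /eqP; rewrite (negPf d0).
apply/eqP; rewrite eq_le da andbT leNgt; apply/negP => gt.
have [lt|ge] := ltP a 2%:R^-1; last first.
  have a2 : a = 2%:R^-1 by apply/eqP; rewrite eq_le ge ab b2.
  have [c0 wc] := km_P_large (vgeW xa ge) (vgeW yb (le_trans ge le)).
  have := val_sqr_eq eP c0 d0 O34'; rewrite wc mulr2n => h.
  by move: h gt; rewrite a2; move: (w (x - y)) => t; lra.
have [x0 wx] := xl lt; have [y0 wy] : y != 0 /\ w y = b by apply: yl; rewrite -ab.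
rewrite -ab in wy; have [a00|a00] := eqVneq a 0.
  have [c0 wc] : km_P (- 72%:R * s) (- 4%:R * s) (- s - 1296%:R * s ^+ 2) x y != 0 /\
      w (km_P (- 72%:R * s) (- 4%:R * s) (- s - 1296%:R * s ^+ 2) x y) = 0.
    have -> : km_P (- 72%:R * s) (- 4%:R * s) (- s - 1296%:R * s ^+ 2) x y =
      x ^+ 2 * y ^+ 2 + (s + 1296%:R * s ^+ 2 + 72%:R * s * x * y + (4%:R * s * x + 4%:R * s * y)).
      by rewrite /km_P; ring.
    have wxy : w (x ^+ 2 * y ^+ 2) = 0.
      by rewrite (valM hw) ?expf_neq0 // !(valX hw) // wx wy a00 !mul0rn.
    rewrite -[X in _ /\ _ = X]wxy; apply: (val_dom hw); first by rewrite mulf_neq0 ?expf_neq0.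
    by rewrite wxy; vgts hw.
  have := val_sqr_eq eP c0 d0 O34'; rewrite wc mulr2n => h.
  by move: h gt; rewrite a00; move: (w (x - y)) => t; lra.
have {a00}a0 : 0 < a by rewrite lt0r a00.
rewrite -ab in yb.
have wxy : w (x * y) = a + a by rewrite (valM hw) // wx wy.
have [c0 wc] : km_S 1 (- 72%:R * s) (- 4%:R * s) x y != 0 /\
    w (km_S 1 (- 72%:R * s) (- 4%:R * s) x y) = a + a.
  have -> : km_S 1 (- 72%:R * s) (- 4%:R * s) x y =
    x * y + (2%:R * x * y * x + 2%:R * x * y * y - (72%:R * s * x + 72%:R * s * y) - 4%:R * s).
    by rewrite /km_S; ring.
  rewrite -wxy; apply: (val_dom hw); first by rewrite mulf_neq0.
  by rewrite wxy; vgts hw.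
have := val_sqr_eq eS c0 d0 O34; rewrite wc mulr2n => h.
by move: h gt; move: (w (x - y)) => t; lra.
Qed.

Lemma val_eq0_of_mul u v : u != 0 -> v != 0 -> vge w u 0 -> vge w v 0 -> w u + w v = 0 ->
  w u = 0 /\ w v = 0.
Proof.
move=> u0 v0 [/eqP|hu]; first by rewrite (negPf u0).
move=> [/eqP|hv]; first by rewrite (negPf v0).
by move: hu hv; move: (w u) (w v) => a b; lra.
Qed.

Lemma cap_small x a : x != 0 -> w x = a -> a <= 2%:R^-1 -> f x = a.
Proof. by move=> x0 wx a2; rewrite /cap (negPf x0) wx min_l. Qed.

(** As on a Tate curve, doubling sends [c] to [2 c] or [1 - 2 c], whichever is at most 1/2, and
    [x - x^2] takes the same value at both. *)
Lemma local_dbl P : P != 0 -> P + P != 0 -> P *+ n = 0 ->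
  let c := f (X P) in let c' := f (X (P + P)) in
  w (km_psi 1 (- 72%:R * s) (- 4%:R * s) (X P)) = 2%:R * c /\
  c' - c' ^+ 2 = 2%:R * c - 4%:R * c ^+ 2.
Proof.
move=> P0 P2 nP /=; have [_ _ _ _ hD] := kX.
have := hD _ P0; rewrite (negPf P2) => -[p0 e].
have OP := torsion_vge P0 nP.
have O2 : vge w (X (P + P)) 0 by apply: torsion_vge; rewrite // mulrnDl nP addr0.
move: (cap_ge0 OP) (cap_vge (X P)) (cap_le (X P)) (@cap_lt (X P)) e p0 (OP) (O2).
set x := X P; set x2 := X (P + P); set a := f x.
have psiE : km_psi 1 (- 72%:R * s) (- 4%:R * s) x =
  x ^+ 2 + (4%:R * x ^+ 3 - 144%:R * s * x - 4%:R * s) by rewrite /km_psi; ring.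
have phiE : km_phi (- 72%:R * s) (- 4%:R * s) (- s - 1296%:R * s ^+ 2) x =
  x ^+ 4 + (72%:R * s * x ^+ 2 + 8%:R * s * x + s + 1296%:R * s ^+ 2) by rewrite /km_phi; ring.
move: psiE phiE; set psi := km_psi _ _ _ _; set phi := km_phi _ _ _ _.
move=> psiE phiE a0 xa a2 xl e p0 Ox Ox2.
have [lt|ge] := ltP a 2%:R^-1; last first.
  have {ge}ax : a = 2%:R^-1 by apply/eqP; rewrite eq_le ge a2.
  rewrite ax in xa.
  have [ph0 wph] : phi != 0 /\ w phi = 1.
    have -> : phi = s + (x ^+ 4 + 72%:R * s * x ^+ 2 + 8%:R * s * x + 1296%:R * s ^+ 2).
      by rewrite phiE; ring.
    by rewrite -ws; apply: (val_dom hw) => //; rewrite ws; vgts hw.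
  have x20 : x2 != 0 by apply: contraNneq ph0 => z; rewrite -e z mul0r.
  have psi1 : vge w psi 1.
    have x21 := vgeX hw 2 xa; have x31 := vgeX hw 3 xa.
    rewrite psiE; apply: (vgeD hw); first by apply: vgeW x21 _; lra.
    apply: (vgeD hw); last by apply: (vgeN hw); have := vgeM hw (vge_nat hw 4) sV; rewrite add0r.
    apply: vgt_vge; vgts hw.
  have w1 : 1 <= w psi by case: psi1 => // /eqP; rewrite (negPf p0).
  have w2 : 0 <= w x2 by case: Ox2 => // /eqP; rewrite (negPf x20).
  have ww : w x2 + w psi = 1 by rewrite -(valM hw) // e.
  have fx2 : f x2 = 0 by apply: cap_small => //; move: w1 w2 ww; move: (w x2) (w psi) => u v; lra.
  by rewrite fx2 ax; split; [move: w1 w2 ww; move: (w x2) (w psi) => u v; lra|lra].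
have [x0 wx] := xl lt; rewrite -/a in wx.
have [a00|a00] := eqVneq a 0.
  have [ph0 wph] : phi != 0 /\ w phi = 0.
    have wx4 : w (x ^+ 4) = 0 by rewrite (valX hw) // wx a00 mul0rn.
    rewrite phiE -[X in _ /\ _ = X]wx4; apply: (val_dom hw); first by rewrite expf_neq0.
    by rewrite wx4; vgts hw.
  have x20 : x2 != 0 by apply: contraNneq ph0 => z; rewrite -e z mul0r.
  have Opsi : vge w psi 0.
    have [h1 h2 h3 _] := normal_vge.
    exact: (O_psi (valring_val hw) h1 h2 h3).
  have [w1 w2] := val_eq0_of_mul x20 p0 Ox2 Opsi (etrans (esym (valM hw x20 p0)) (etrans (congr1 w e) wph)).
  have fx2 : f x2 = 0 by apply: cap_small.
  by rewrite fx2 w2 a00; split; lra.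
have {a00}a0 : 0 < a by rewrite lt0r a00.
have wx2 : w (x ^+ 2) = a + a by rewrite (valX hw) // wx mulr2n.
clear Ox OP.
have [_ wpsi] : psi != 0 /\ w psi = a + a.
  by rewrite psiE -wx2; apply: (val_dom hw); rewrite ?expf_neq0 // wx2; vgts hw.
split; first by rewrite wpsi; lra.
have phi_dom : vgt w (72%:R * s * x ^+ 2 + 8%:R * s * x + 1296%:R * s ^+ 2) 1 by vgts hw.
have wx4 : w (x ^+ 4) = 4%:R * a by rewrite (valX hw) // wx mulr_natl.
have x40 : x ^+ 4 != 0 by rewrite expf_neq0.
have wmul : x2 != 0 -> w x2 = w phi - (a + a).
  by move=> x20; rewrite -e (valM hw) // wpsi addrK.
have x2n0 : phi != 0 -> x2 != 0 by apply: contraNneq => z; rewrite -e z mul0r.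
have [lt4|gt4|eq4] := ltgtP (4%:R * a) 1.
- have [ph0 wph] : phi != 0 /\ w phi = 4%:R * a.
    rewrite phiE -wx4; apply: (val_dom hw) => //; rewrite wx4.
    have -> : 72%:R * s * x ^+ 2 + 8%:R * s * x + s + 1296%:R * s ^+ 2 =
      72%:R * s * x ^+ 2 + 8%:R * s * x + 1296%:R * s ^+ 2 + s by ring.
    by apply: (vgtD hw); [apply: vge_vgt (vgt_vge phi_dom) lt4|right; rewrite ws].
  have x20 := x2n0 ph0; have wx2' := wmul x20; rewrite wph in wx2'.
  have -> : f x2 = a + a by apply: cap_small => //; [rewrite wx2'; ring|lra].
  by rewrite expr2; ring.
- have [ph0 wph] : phi != 0 /\ w phi = 1.
    have -> : phi = s + (72%:R * s * x ^+ 2 + 8%:R * s * x + 1296%:R * s ^+ 2 + x ^+ 4).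
      by rewrite phiE; ring.
    rewrite -ws; apply: (val_dom hw) => //; rewrite ws.
    by apply: (vgtD hw) => //; right; rewrite wx4.
  have x20 := x2n0 ph0; have wx2' := wmul x20; rewrite wph in wx2'.
  have -> : f x2 = 1 - (a + a) by apply: cap_small => //; lra.
  ring.
(* At [c = 1/4] the terms [x^4] and [s] may cancel, so the valuation of [km_phi] is only bounded
   below; the truncation at 1/2 absorbs this. *)
- have -> : f x2 = 2%:R^-1.
    rewrite /cap; case: eqP => // /eqP x20; rewrite min_r //.
    have hph : vge w phi 1.
      rewrite phiE; apply: (vgeD hw); first by right; rewrite wx4 eq4.
      have -> : 72%:R * s * x ^+ 2 + 8%:R * s * x + s + 1296%:R * s ^+ 2 =
        72%:R * s * x ^+ 2 + 8%:R * s * x + 1296%:R * s ^+ 2 + s by ring.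
      by apply: (vgeD hw) => //; apply: vgt_vge.
    have ph0 : phi != 0 by rewrite -e mulf_neq0.
    rewrite wmul //; case: hph => [/eqP|hph]; first by rewrite (negPf ph0).
    by move: hph; move: (w phi) => u; lra.
  have -> : a = 4%:R^-1 by lra.
  lra.
Qed.

End Local.

(** * The place at infinity *)

Lemma prime_morphism (L : fieldType) p : p \in [pchar L] -> exists f : {rmorphism 'F_p -> L}, True.
Proof.
move=> pL; pose f (a : 'F_p) : L := (a%:A : pPrimeCharType pL).
have f1 : f 1 = 1 by exact: (rmorph1 (in_alg (pPrimeCharType pL))).
have fB : {morph f : x y / x - y} by exact: (rmorphB (in_alg (pPrimeCharType pL))).
have fM : {morph f : x y / x * y} by exact: (rmorphM (in_alg (pPrimeCharType pL))).
pose mA := GRing.isZmodMorphism.Build 'F_p L f fB.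
pose mM := GRing.isMonoidMorphism.Build 'F_p L f (f1, fM).
pose g : {rmorphism 'F_p -> L} := HB.pack f mA mM.
by exists g.
Qed.

Section PlaceAt.
Variables (L : closedFieldType) (k : fieldType) (f : {rmorphism k -> L}) (j : L).
Hypothesis trj : forall P : {poly k}, (map_poly f P).[j] = 0 -> P = 0.

Lemma place_at (a : L) : exists O : L -> Prop, [/\ valring O,
  forall P : {poly k}, O (map_poly f P).[j],
  forall P : {poly k}, (map_poly f P).[a] = 0 -> vmax O (map_poly f P).[j] &
  forall P : {poly k}, (map_poly f P).[a] != 0 -> O ((map_poly f P).[j])^-1].
Proof.
have [|G [plG G0 vG GV]] := @place_extend L (fun x y =>
    exists P : {poly k}, x = (map_poly f P).[j] /\ y = (map_poly f P).[a]).
  split.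
  - by exists 1; rewrite rmorph1 !hornerC.
  - by move=> _ _ _ _ [P [-> ->]] [Q [-> ->]]; exists (P - Q); rewrite rmorphB !hornerE.
  - by move=> _ _ _ _ [P [-> ->]] [Q [-> ->]]; exists (P * Q); rewrite rmorphM !hornerE.
  - by move=> _ [P [/esym/trj -> ->]]; rewrite rmorph0 horner0.
have GP P : G (map_poly f P).[j] (map_poly f P).[a] by apply: G0; exists P.
exists (fun x => exists y, G x y); split=> //.
- by move=> P; exists (map_poly f P).[a].
- move=> P Pa; have [->|Pj] := eqVneq (map_poly f P).[j] 0; first by left.
  right=> -[c xc]; have [G1 _ GM _] := plG.
  have := GM _ _ _ _ (GP P) xc; rewrite Pa mul0r mulfV // => h.
  by have /eqP := place_graph_fun plG G1 h; rewrite oner_eq0.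
- by move=> P Pa; exists ((map_poly f P).[a])^-1; apply: GV.
Qed.

End PlaceAt.

(** * From a place to a rational-valued valuation *)

Section ValOfPlace.
Variables (L : fieldType) (O : L -> Prop) (s : L).
Hypotheses (vO : valring O) (ms : vmax O s) (s0 : s != 0).

Definition vunit x := [/\ x != 0, O x & O x^-1].

Lemma vunitM x y : vunit x -> vunit y -> vunit (x * y).
Proof.
move=> [x0 h1 h2] [y0 h3 h4]; split; first exact: mulf_neq0.
  exact: (vrM vO).
by rewrite invfM; apply: (vrM vO).
Qed.

Lemma vunitV x : vunit x -> vunit x^-1.
Proof. by move=> [x0 h1 h2]; split; rewrite ?invr_eq0 ?invrK. Qed.

Lemma vunit1 : vunit 1.
Proof. by split; rewrite ?oner_neq0 ?invr1 //; apply: (vrn vO 1). Qed.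

Lemma vunitX x n : vunit x -> vunit (x ^+ n).
Proof. by move=> h; elim: n => [|n IH]; [exact: vunit1|rewrite exprS; apply: vunitM]. Qed.

Lemma vunit_1D x : vmax O x -> vunit (1 + x).
Proof.
move=> mx; have [h1 h2] := vr_unit (vmax1D vO mx).
by split=> //; apply: (vrD vO); [apply: (vrn vO 1)|apply: (vmaxW vO)].
Qed.

Definition veq x y := vunit (x / y).

Lemma veq_trans x y z : y != 0 -> veq x y -> veq y z -> veq x z.
Proof. by move=> y0 h1 h2; have := vunitM h1 h2; rewrite /veq mulrA mulfVK. Qed.

Lemma veq_sym x y : veq x y -> veq y x.
Proof. by move=> /vunitV; rewrite invf_div. Qed.

(** A sum of terms of pairwise distinct values has the value of its dominant term. Values are
    compared through units, as no valuation has been built yet. *)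
Lemma vr_sum_neq0 (I : eqType) (r : seq I) (g : I -> L) : uniq r -> r != [::] ->
  (forall i, i \in r -> g i != 0) ->
  (forall i i', i \in r -> i' \in r -> veq (g i) (g i') -> i = i') ->
  \sum_(i <- r) g i != 0 /\ exists2 i, i \in r & veq (\sum_(i <- r) g i) (g i).
Proof.
elim: r => // x [_ _ _ g0 _|y r IH /andP[xr ur] _ g0 gI].
  have gx : g x != 0 by apply: g0; rewrite mem_seq1.
  rewrite big_seq1; split=> //; exists x; rewrite ?mem_seq1 //.
  by rewrite /veq divff //; apply: vunit1.
have [||S0 [e er Se]] := IH ur isT.
- by move=> i ir; apply: g0; rewrite in_cons ir orbT.
- by move=> i i' ir ir'; apply: gI; rewrite in_cons ?ir ?ir' orbT.
rewrite big_cons; set S := \sum_(i <- _ :: _) g i in S0 Se *.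
have gx : g x != 0 by apply: g0; rewrite mem_head.
have nxS : ~ vunit (g x / S).
  move=> h; have : x = e; last by move=> xe; move: xr; rewrite xe er.
  apply: gI; [exact: mem_head|by rewrite in_cons er orbT|exact: (veq_trans S0 h Se)].
have [h|h] := vrV vO (g x / S).
  have m : vmax O (g x / S).
    apply: contrapT => /vr_unit[h1 h2]; apply: nxS; split=> //.
  have -> : g x + S = S * (1 + g x / S) by field.
  have u := vunit_1D m; split; first by rewrite mulf_neq0 //; case: u.
  exists e; first by rewrite in_cons er orbT.
  by rewrite /veq mulrAC; apply: vunitM.
have m : vmax O (S / g x).
  rewrite invf_div in h; apply: contrapT => /vr_unit[h1 h2]; apply: nxS; split=> //.
  - by rewrite mulf_neq0 ?invr_eq0.
  - by rewrite -invf_div.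
  - by rewrite invf_div.
have -> : g x + S = g x * (1 + S / g x) by field.
have u := vunit_1D m; split; first by rewrite mulf_neq0 //; case: u.
exists x; first by rewrite mem_head.
by rewrite /veq mulrAC divff // mul1r.
Qed.

Lemma vunit_sz (c : int) : vunit (s ^ c) -> c = 0.
Proof.
have half (n : nat) : vunit (s ^+ n) -> n = 0%N.
  case: n => // n [_ _ h]; case: (vmax1 vO).
  rewrite -(mulfV (expf_neq0 n.+1 s0)); apply: (vmaxM vO) => //.
  by rewrite exprS; apply: (vmaxM vO) => //; apply: (vrX vO); apply: (vmaxW vO).
case: c => n; first by rewrite -exprnP => /half ->.
by rewrite NegzE -exprnN => /vunitV; rewrite invrK => /half.
Qed.

Hypothesis relz : forall z, z != 0 -> exists (b : nat) (a : int), (0 < b)%N /\ vunit (z ^+ b / s ^ a).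

Lemma rel_uniq z b a b' a' : z != 0 -> vunit (z ^+ b / s ^ a) -> vunit (z ^+ b' / s ^ a') ->
  a * b'%:Z = a' * b%:Z.
Proof.
move=> z0 /(vunitX b') h /(vunitX b) h'.
have e1 : (z ^+ b / s ^ a) ^+ b' = z ^+ (b * b') / s ^ (a * b'%:Z).
  by rewrite expr_div_n -exprM [(s ^ a) ^+ b']exprnP exprz_exp.
have e2 : (z ^+ b' / s ^ a') ^+ b = z ^+ (b * b') / s ^ (a' * b%:Z).
  by rewrite expr_div_n -exprM [(s ^ a') ^+ b]exprnP exprz_exp mulnC.
rewrite e1 in h; rewrite e2 in h'.
have zn0 : z ^+ (b * b') != 0 by rewrite expf_neq0.
have [c0 c'0] : s ^ (a * b'%:Z) != 0 /\ s ^ (a' * b%:Z) != 0 by rewrite !expfz_neq0.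
have := vunitM h' (vunitV h).
have G (u v t : L) : u != 0 -> v != 0 -> t != 0 -> u / t * (u / v)^-1 = v / t.
  by move=> *; field; apply/and3P.
rewrite G //.
rewrite invr_expz -expfzDr // => h2.
by apply/eqP; rewrite -subr_eq0; apply/eqP/vunit_sz.
Qed.

(** By [relz] every value is a rational multiple of that of [s]: if [z^b] and [s^a] differ by a
    unit, the value of [z] must be [a / b]. *)
Lemma val_of_place : exists w, is_val w /\ w s = 1.
Proof.
pose P z (c : nat * int) := (0 < c.1)%N /\ vunit (z ^+ c.1 / s ^ c.2).
have ex z : z != 0 -> exists c, P z c.
  by move=> /relz[b [a h]]; exists (b, a).
pose w z : rat := if pselect (exists c, P z c) is left h then
  (sval (cid h)).2%:~R / (sval (cid h)).1%:R else 0.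
have wE z b a : z != 0 -> (0 < b)%N -> vunit (z ^+ b / s ^ a) -> w z = a%:~R / b%:R.
  move=> z0 b0 h; rewrite /w; case: pselect => [hc|[]]; last exact: ex.
  case: (cid hc) => -[b' a'] /= [b'0 h']; have := rel_uniq z0 h h'.
  move/(congr1 (fun x : int => x%:~R : rat)); rewrite !rmorphM /= => e.
  have b0r : (b%:R : rat) != 0 by rewrite pnatr_eq0 -lt0n.
  have b'0r : (b'%:R : rat) != 0 by rewrite pnatr_eq0 -lt0n.
  apply: (mulIf b0r); apply: (mulIf b'0r); rewrite mulfVK //.
  by rewrite -[LHS]mulrA [b%:R * _]mulrC mulrA mulfVK // -e.
have wM x y : x != 0 -> y != 0 -> w (x * y) = w x + w y.
  move=> x0 y0; have [b [a [b0 h]]] := relz x0; have [b' [a' [b'0 h']]] := relz y0.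
  rewrite (wE x b a) // (wE y b' a') // (wE _ (b * b')%N (a * b'%:Z + a' * b%:Z)).
  - have b0r : (b%:R : rat) != 0 by rewrite pnatr_eq0 -lt0n.
    have b'0r : (b'%:R : rat) != 0 by rewrite pnatr_eq0 -lt0n.
    rewrite intrD !intrM natrM; field; exact/andP.
  - exact: mulf_neq0.
  - by rewrite muln_gt0 b0.
  - have := vunitM (vunitX b' h) (vunitX b h').
    rewrite !expr_div_n -!exprM [(s ^ a) ^+ b']exprnP [(s ^ a') ^+ b]exprnP !exprz_exp.
    by rewrite mulf_div -expfzDr // (mulnC b' b) -exprMn.
have wO x : x != 0 -> (O x <-> 0 <= w x).
  move=> x0; have [b [a [b0 h]]] := relz x0; rewrite (wE _ _ _ x0 b0 h).
  have b0r : 0 < (b%:R : rat) by rewrite ltr0n.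
  rewrite pmulr_lge0 ?invr_gt0 // ler0z; have [_ h1 h2] := h.
  have sa0 : s ^ a != 0 by rewrite expfz_neq0.
  split.
    move=> Ox; case: a => [//|n] in h h1 h2 sa0 *; rewrite NegzE -exprnN in h h1 h2 sa0.
    case: (vmax1 vO); have -> : 1 = (s ^+ n.+1 * x ^+ b) * ((x ^+ b) / (s ^+ n.+1)^-1)^-1.
      by rewrite invrK; field; rewrite expf_neq0 // expf_neq0.
    apply: (vmaxM vO) => //; apply: (vmaxM vO); last exact: (vrX vO).
    by rewrite exprS; apply: (vmaxM vO) => //; apply: (vrX vO); apply: (vmaxW vO).
  case: a => [n|//] in h h1 h2 sa0 * => _.
  apply: (vr_root vO b0); rewrite -(mulfVK sa0 (x ^+ b)); apply: (vrM vO) => //.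
  by apply: (vrX vO); apply: (vmaxW vO).
have w1 : w 1 = 0.
  have := wM 1 1 (oner_neq0 L) (oner_neq0 L); rewrite mulr1 => /eqP.
  by rewrite -subr_eq subrr eq_sym => /eqP.
have wV x : x != 0 -> w x^-1 = - w x.
  by move=> x0; apply/eqP; rewrite -addr_eq0 addrC -wM ?invr_eq0 // mulfV // w1.
exists w; split; last first.
  by rewrite (wE s 1%N 1) // expr1z expr1 divff //; apply: vunit1.
split=> // x y; wlog le : x y / w x <= w y.
  move=> wl x0 y0 xy0; have [le|/ltW le] := leP (w x) (w y).
    by have := wl x y le x0 y0 xy0; rewrite min_l.
  by have := wl y x le y0 x0; rewrite addrC => /(_ xy0); rewrite min_l.
move=> x0 y0 xy0; rewrite min_l //.
have Oyx : O (y / x) by apply/wO; rewrite ?mulf_neq0 ?invr_eq0 // wM ?invr_eq0 // wV // subr_ge0.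
have e : x + y = x * (1 + y / x) by field.
have t0 : 1 + y / x != 0 by apply: contraNneq xy0 => z; rewrite e z mulr0.
rewrite e wM // lerDl; apply/wO => //.
by apply: (vrD vO) => //; apply: (vrn vO 1).
Qed.

End ValOfPlace.

(** * Rational function subfields and the product formula *)

Section RatSub.
Variables (k L : fieldType) (f : {rmorphism k -> L}) (z : L).

Definition ratsub : {pred L} := [pred x | `[< exists P Q : {poly k},
  (map_poly f Q).[z] != 0 /\ x = (map_poly f P).[z] / (map_poly f Q).[z] >]].

Lemma ratsubP x : reflect (exists P Q : {poly k},
  (map_poly f Q).[z] != 0 /\ x = (map_poly f P).[z] / (map_poly f Q).[z]) (x \in ratsub).
Proof. exact: asboolP. Qed.

Lemma ratsub_poly P : (map_poly f P).[z] \in ratsub.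
Proof.
by apply/ratsubP; exists P, 1; rewrite rmorph1 !hornerC oner_neq0 divr1.
Qed.

Fact ratsub_closed : divring_closed ratsub.
Proof.
split.
- by have := ratsub_poly 1; rewrite rmorph1 hornerC.
- move=> x y /ratsubP[P [Q [Q0 ->]]] /ratsubP[P' [Q' [Q'0 ->]]]; apply/ratsubP.
  exists (P * Q' - P' * Q), (Q * Q'); rewrite rmorphB !rmorphM !hornerE mulf_neq0 //=.
  by split=> //; field; apply/andP.
- move=> x y /ratsubP[P [Q [Q0 ->]]] /ratsubP[P' [Q' [Q'0 ->]]]; apply/ratsubP.
  have [P'0|P'0] := eqVneq (map_poly f P').[z] 0.
    by exists 0, 1; rewrite rmorph0 rmorph1 !hornerC oner_neq0 P'0 !(mul0r, invr0, mulr0).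
  exists (P * Q'), (Q * P'); rewrite !rmorphM !hornerE mulf_neq0 //=.
  by split=> //; field; rewrite Q0 P'0 Q'0.
Qed.

HB.instance Definition _ := GRing.isDivringClosed.Build L ratsub ratsub_closed.

Record ratfield := RatField { ratval : L; _ : ratval \in ratsub }.
HB.instance Definition _ := [isSub for ratval].
HB.instance Definition _ := [Choice of ratfield by <:].
HB.instance Definition _ := [SubChoice_isSubIntegralDomain of ratfield by <:].
HB.instance Definition _ := [SubIntegralDomain_isSubField of ratfield by <:].

Definition ratinj : {rmorphism ratfield -> L} := val.

Lemma ratinj_in x : x \in ratsub -> exists b, x = ratinj b.
Proof. by move=> h; exists (RatField h). Qed.

Lemma ratsub_ratinj b : ratinj b \in ratsub. Proof. exact: (valP b). Qed.

End RatSub.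

Lemma ratsub_gen (k L : fieldType) (f : {rmorphism k -> L}) (z : L) (A : L -> Prop) :
  (forall a, A (f a)) -> A z -> (forall x y, A x -> A y -> A (x - y)) ->
  (forall x y, A x -> A y -> A (x * y)) -> (forall x, A x -> A x^-1) ->
  forall x, x \in ratsub f z -> A x.
Proof.
move=> Af Az AB AM AV x /ratsubP[P [Q [_ ->]]].
have A0 : A 0 by rewrite -(subrr z); apply: AB.
have AD u v : A u -> A v -> A (u + v).
  by move=> hu hv; rewrite -(opprK v); apply: (AB) => //; rewrite -sub0r; apply: AB.
have Ap R : A (map_poly f R).[z].
  elim/poly_ind: R => [|R c IH]; first by rewrite rmorph0 horner0.
  by rewrite rmorphD rmorphM /= map_polyX map_polyC !hornerE; apply: AD; [apply: AM|apply: Af].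
by apply: AM => //; apply: AV.
Qed.

Section ValEv.
Variables (k : finFieldType) (L : fieldType) (f : {rmorphism k -> L}) (s : L).
Hypothesis trs : forall P : {poly k}, (map_poly f P).[s] = 0 -> P = 0.
Local Notation ev P := ((map_poly f P).[s]).

Lemma transcendental_neq0 : s != 0.
Proof.
apply/eqP => s0; have : 'X = 0 :> {poly k} by apply: trs; rewrite map_polyX hornerX.
by move/eqP; rewrite polyX_eq0.
Qed.

Lemma poly_at0 (P : {poly k}) : P != 0 -> exists m (q : {poly k}), q.[0] != 0 /\ P = q * 'X^m.
Proof.
move=> P0; have [m [q qr pE]] := multiplicity_XsubC P 0.
by exists m, q; rewrite -rootE; rewrite P0 in qr; split=> //; rewrite pE subr0.
Qed.

Lemma val_const w (a : k) : is_val w -> a != 0 -> w (f a) = 0.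
Proof.
move=> hw a0; apply: (@val_root1 _ _ hw _ #|k|.-1); first by rewrite -ltnS prednK ?finNzRing_gt1 // (ltnW (finNzRing_gt1 _)).
have fa0 : f a != 0 by rewrite fmorph_eq0.
apply: (mulfI fa0); rewrite -exprS prednK ?mulr1; last exact: (ltnW (finNzRing_gt1 _)).
by rewrite -rmorphXn expf_card.
Qed.

Lemma val_ev w (P : {poly k}) : is_val w -> w s = 1 -> P != 0 -> exists m : nat, w (ev P) = m%:R.
Proof.
move=> hw ws P0; have s0 := transcendental_neq0.
have [m [q [q0 ->]]] := poly_at0 P0; exists m.
have ev0 R : vge w (ev R) 0.
  elim/poly_ind: R => [|R c IH]; first by rewrite rmorph0 horner0; left.
  rewrite rmorphD rmorphM /= map_polyX map_polyC !hornerE; apply: (vgeD hw).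
    by apply: (vgeW (vgeM hw IH (vge_self w s))); rewrite ws.
  have [c0|c0] := eqVneq c 0; first by left; rewrite c0; exact: rmorph0.
  by right; rewrite val_const.
have [q1 wq] : ev q != 0 /\ w (ev q) = 0.
  have : root (q - q.[0]%:P) 0 by rewrite rootE !hornerE subrr.
  case/factor_theorem => r; rewrite subr0 => e.
  have -> : q = q.[0]%:P + r * 'X by rewrite -e addrC subrK.
  rewrite rmorphD rmorphM /= map_polyX map_polyC !hornerE -[X in _ /\ _ = X](val_const hw q0).
  apply: (val_dom hw); first by rewrite fmorph_eq0.
  rewrite val_const //; apply: vge_vgt (vgeM hw (ev0 r) (vge_self w s)) _.
  by rewrite ws.
rewrite rmorphM /= map_polyXn hornerM hornerXn (valM hw) ?expf_neq0 // wq add0r.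
by rewrite (valX hw) // ws.
Qed.

Lemma val_ratsub w x : is_val w -> w s = 1 -> x \in ratsub f s -> x != 0 ->
  exists m : int, w x = m%:~R.
Proof.
move=> hw ws /ratsubP[P [Q [Q0 ->]]] x0.
have nz R : ev R != 0 -> R != 0 by apply: contraNneq => ->; rewrite rmorph0 horner0.
have P0 : ev P != 0 by apply: contraNneq x0 => ->; rewrite mul0r.
have [m mE] := val_ev hw ws (nz _ P0); have [m' mE'] := val_ev hw ws (nz _ Q0).
exists (m%:Z - m'%:Z); rewrite (valM hw) ?invr_eq0 // (valV hw) // mE mE'.
by rewrite intrD mulrNz.
Qed.

End ValEv.

Section ValInfty.
Variables (k : finFieldType) (L : closedFieldType) (f : {rmorphism k -> L}) (s : L).
Hypothesis trs : forall P : {poly k}, (map_poly f P).[s] = 0 -> P = 0.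
Local Notation ev P := ((map_poly f P).[s]).
Hypothesis algs : is_algebraic_closure (ratinj f s).
Let s0 := transcendental_neq0 trs.

(** The place lies above [s = 0]. In an algebraic equation of [z] over [k(s)] two terms must have
    the same value, so a power of [z] has the value of an element of [k(s)], which is that of a
    power of [s]. *)
Lemma exists_val : exists w, is_val w /\ w s = 1.
Proof.
have [O [vO OP mP uP]] := place_at trs 0.
have ms : vmax O s by have := mP 'X; rewrite map_polyX !hornerX; apply.
apply: (val_of_place vO ms s0) => z z0.
have uev P : P != 0 -> exists m : nat, vunit O (ev P / s ^ m).
  move=> P0; have [m [q [q0 ->]]] := poly_at0 P0; exists m.
  have q0' : (map_poly f q).[0] != 0 by have := q0; rewrite -(fmorph_eq0 f) -horner_map /= (_ : f 0 = 0) //; exact: rmorph0.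
  rewrite rmorphM /= map_polyXn hornerM hornerXn -exprnP mulfK ?expf_neq0 //.
  split; [|exact: OP|exact: uP].
  apply: contraNneq q0' => /trs ->; by rewrite rmorph0 horner0.
have urat c : c \in ratsub f s -> c != 0 -> exists a : int, vunit O (c / s ^ a).
  move=> /ratsubP[P [Q [Q0 ->]]] c0.
  have nz R : ev R != 0 -> R != 0 by apply: contraNneq => ->; rewrite rmorph0 horner0.
  have P0 : ev P != 0 by apply: contraNneq c0 => ->; rewrite mul0r.
  have [m mE] := uev _ (nz _ P0); have [m' mE'] := uev _ (nz _ Q0).
  exists (m%:Z - m'%:Z); have := vunitM vO mE (vunitV mE').
  rewrite expfzDr // -invr_expz.
  have [h1 h2] : s ^ m != 0 /\ s ^ m' != 0 by rewrite !expfz_neq0.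
  move: (ev P) (ev Q) (s ^ m) (s ^ m') P0 Q0 h1 h2 => u v x y u0 v0 x0 y0.
  by rewrite (_ : u / x * (v / y)^-1 = u / v / (x / y)) //; field; rewrite x0 y0 v0.
have [P [P0 /rootP Pz]] := algs z.
pose c i := ratinj f s P`_i.
pose r := [seq i <- iota 0 (size P) | P`_i != 0].
pose g i := c i * z ^+ i.
have cn0 i : i \in r -> c i != 0 by rewrite mem_filter => /andP[h _]; rewrite fmorph_eq0.
have gn0 i : i \in r -> g i != 0 by move=> /cn0 h; rewrite mulf_neq0 ?expf_neq0.
have rn0 : r != [::].
  apply/eqP => r0; have : (size P).-1 \in r; last by rewrite r0.
  by rewrite mem_filter -lead_coefE lead_coef_eq0 P0 mem_iota add0n prednK ?size_poly_gt0 //=.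
have sum0 : \sum_(i <- r) g i = 0.
  rewrite big_filter -[RHS]Pz horner_coef size_map_poly -(big_mkord xpredT (fun i => (map_poly (ratinj f s) P)`_i * z ^+ i)).
  rewrite /index_iota subn0 [RHS](bigID (fun i => P`_i != 0)) /= [X in _ = _ + X]big1 ?addr0.
    by apply: eq_bigr => i _; rewrite (coef_map (ratinj f s)).
  by move=> i /negPn/eqP h; rewrite (coef_map (ratinj f s)) h [X in X * _](rmorph0 (ratinj f s)) mul0r.
have [i [i' [ir ir' ne gg]]] : exists i i', [/\ i \in r, i' \in r, i <> i' & veq O (g i) (g i')].
  apply: contrapT => no; have [|+ _] := vr_sum_neq0 vO (filter_uniq _ (iota_uniq 0 (size P))) rn0 gn0.
    move=> i i' ir ir' h; apply: contrapT => ne; apply: no; exists i, i'; split=> //.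
  by rewrite -/r sum0 eqxx.
wlog lt : i i' ir ir' ne gg / (i' < i)%N.
  move=> wl; have [lt|lt|//] := ltngtP i i'; last exact: wl gg lt.
  by apply: wl (veq_sym gg) lt => //; apply/nesym.
have [a aE] := urat _ (ratsub_ratinj P`_i) (cn0 _ ir).
have [a' aE'] := urat _ (ratsub_ratinj P`_i') (cn0 _ ir').
exists (i - i')%N, (a' - a); rewrite subn_gt0 lt; split=> //.
have := vunitM vO gg (vunitM vO aE' (vunitV aE)).
rewrite /g -/(c i) -/(c i') expfzDr // -invr_expz.
have [h1 h2] : s ^ a != 0 /\ s ^ a' != 0 by rewrite !expfz_neq0.
have [c1 c2] := (cn0 _ ir, cn0 _ ir').
have -> : z ^+ i = z ^+ (i - i') * z ^+ i' by rewrite -exprD subnK // ltnW.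
have z1 : z ^+ (i - i') != 0 by rewrite expf_neq0.
have z2 : z ^+ i' != 0 by rewrite expf_neq0.
move: (c i) (c i') (s ^ a) (s ^ a') (z ^+ (i - i')) (z ^+ i') h1 h2 c1 c2 z1 z2.
move=> u v x y t q x0 y0 u0 v0 t0 q0.
have -> // : u * (t * q) / (v * q) * (v / y * (u / x)^-1) = t / (y / x).
by field; rewrite x0 y0 u0 v0 q0.
Qed.

End ValInfty.

(** * The product formula over [k(j)] *)

Section ProductFormula.
Variables (k : finFieldType) (L : closedFieldType) (f : {rmorphism k -> L}) (j : L).
Hypothesis trj : forall P : {poly k}, (map_poly f P).[j] = 0 -> P = 0.
Hypothesis algj : is_algebraic_closure (ratinj f j).
Variable w : L -> rat.
Hypothesis hw : is_val w.

(** Valuation rings containing [j] are the places where [j] is finite, so these are the elements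
    with neither zero nor pole away from infinity. *)
Definition unit_above (x : L) := forall O, valring O -> O j -> O x /\ O x^-1.

(** In lowest terms, a root [a] of the numerator or denominator gives a place above [j = a] where
    [c] is not a unit. So [c] is a constant of the finite field, hence a root of unity. *)
Lemma unit_above_ratsub c : c \in ratsub f j -> c != 0 -> unit_above c -> w c = 0.
Proof.
move=> /ratsubP[P [Q [Q0 cE]]] c0 uc.
have nz R : (map_poly f R).[j] != 0 -> R != 0.
  by apply: contraNneq => ->; rewrite rmorph0 horner0.
have nz' R : R != 0 -> (map_poly f R).[j] != 0.
  by apply: contra_neq => /trj.
have P0 : (map_poly f P).[j] != 0 by apply: contraNneq c0 => z; rewrite cE z mul0r.
pose D := gcdp P Q; have D0 : D != 0 by rewrite gcdp_eq0 negb_and (nz P).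
pose P' := P %/ D; pose Q' := Q %/ D.
have PE : P = P' * D by rewrite divpK // dvdp_gcdl.
have QE : Q = Q' * D by rewrite divpK // dvdp_gcdr.
have cop : coprimep P' Q' by apply: coprimep_div_gcd; rewrite (nz P).
have P'0 : P' != 0 by apply: contraNneq (nz _ P0) => z; rewrite PE z mul0r.
have Q'0 : Q' != 0 by apply: contraNneq (nz _ Q0) => z; rewrite QE z mul0r.
have {cE}cE : c = (map_poly f P').[j] / (map_poly f Q').[j].
  rewrite cE PE QE !rmorphM !hornerM -mulf_div divff ?mulr1 //; exact: nz'.
have key R T : R != 0 -> T != 0 -> coprimep R T ->
    (forall O, valring O -> O j -> O ((map_poly f T).[j] / (map_poly f R).[j])) -> size R = 1%N.
  move=> R0 T0 cRT uRT; apply/eqP; rewrite -(size_map_poly f) -[_ == _]negbK; apply/negP.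
  case/closed_rootP => a /rootP Ra; have [O [vO OP mP uP]] := place_at trj a.
  have Oj : O j by have := OP 'X; rewrite map_polyX hornerX.
  have Ta : (map_poly f T).[a] != 0.
    have /Bezout_coprimepP[[u v] /= /eqpP[[x y] /= /andP[x0 y0] e]] := cRT.
    apply/eqP => Ta; have := congr1 (fun r => (map_poly f r).[a]) e.
    rewrite /= !map_polyZ rmorphD !rmorphM rmorph1 !hornerE Ra Ta !mulr0 addr0 mulr0 => /esym/eqP.
    by rewrite fmorph_eq0 (negPf y0).
  have [h1 h2] := (mP _ Ra, uP _ Ta).
  apply: (vmax1 vO); have -> : 1 = (map_poly f R).[j] *
     (((map_poly f T).[j])^-1 * ((map_poly f T).[j] / (map_poly f R).[j])).
    by field; rewrite !nz'.
  by apply: (vmaxM vO) => //; apply: (vrM vO) => //; apply: uRT.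
have sQ : size Q' = 1%N.
  by apply: (key _ _ Q'0 P'0); rewrite 1?coprimep_sym // => O vO Oj; rewrite -cE; case: (uc _ vO Oj).
have sP : size P' = 1%N.
  by apply: (key _ _ P'0 Q'0) => // O vO Oj; rewrite -invf_div -cE; case: (uc _ vO Oj).
have /size_poly1P[a a0 Pa] : size P' == 1%N by rewrite sP.
have /size_poly1P[b b0 Qb] : size Q' == 1%N by rewrite sQ.
rewrite cE Pa Qb !map_polyC !hornerC (valM hw) ?invr_eq0 ?fmorph_eq0 // (valV hw) ?fmorph_eq0 //.
by rewrite (val_const f hw a0) (val_const f hw b0) subr0.
Qed.

Variables (S : seq L) (n : nat) (sg : 'I_n -> {rmorphism L -> L}).
Hypothesis sgF : forall i, fixes (ratinj f j) (sg i).
Hypothesis sgT : forall t, fixes (ratinj f j) t -> exists i, {in S, sg i =1 t}.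
Hypothesis sgI : forall i i', {in S, sg i =1 sg i'} -> i = i'.

(** The Galois-theoretic form of membership in the field generated by [S] over [k(j)], up to purely
    inseparable extensions. *)
Definition determined (x : L) := forall t t' : {rmorphism L -> L},
  fixes (ratinj f j) t -> fixes (ratinj f j) t' -> {in S, t =1 t'} -> t x = t' x.

(** The product of the conjugates is fixed by all automorphisms, so a power of it lies in [k(j)],
    where units away from infinity have valuation 0. *)
Lemma product_formula eta : eta != 0 -> determined eta -> unit_above eta ->
  \sum_i w (sg i eta) = 0.
Proof.
move=> e0 de ue; pose N := \prod_i sg i eta.
have N0 : N != 0 by apply/prodf_neq0 => i _; rewrite fmorph_eq0.
have wN : w N = \sum_i w (sg i eta).
  rewrite /N; apply: (@proj2 (\prod_i sg i eta != 0)).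
  apply: (big_ind2 (fun x y => x != 0 /\ w x = y)).
  - by rewrite oner_neq0 (val1 hw).
  - by move=> x1 y1 x2 y2 [h1 <-] [h2 <-]; rewrite mulf_neq0 // (valM hw).
  - by move=> i _; rewrite fmorph_eq0.
have Nfix t : fixes (ratinj f j) t -> t N = N.
  move=> tF; rewrite /N rmorph_prod.
  have h i : exists i', {in S, sg i' =1 t \o sg i}.
    have [i' h] := sgT (t := (t \o sg i : {rmorphism L -> L})) (fixes_comp tF (sgF i)).
    by exists i' => x /h.
  pose u i := sval (cid (h i)); have uP i : {in S, sg (u i) =1 t \o sg i} := svalP (cid (h i)).
  have uI : injective u.
    move=> i i' e; apply: sgI => x xS; apply: (fmorph_inj t).
    by have := uP i x xS; have := uP i' x xS; rewrite /= e => -> ->.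
  rewrite [RHS](reindex_inj uI) /=; apply: eq_bigr => i _.
  apply/esym; apply: (de _ (t \o sg i : {rmorphism L -> L})) => //.
  exact: fixes_comp.
have [m [b Nb]] := fixed_pow algj Nfix.
have jE : exists b, j = ratinj f j b.
  by apply: ratinj_in; have := ratsub_poly f j 'X; rewrite map_polyX hornerX.
have uN : unit_above N.
  have prod (g : 'I_n -> L) O : valring O -> (forall i, O (g i)) -> O (\prod_i g i).
    by move=> vO h; apply: (big_ind O) => //; [exact: (vrn vO 1)|exact: (vrM vO)].
  (* [sg i] fixes [j], so the preimage of [O] under it is again a valuation ring containing [j]. *)
  move=> O vO Oj; have each i : O (sg i eta) /\ O (sg i eta)^-1.
    have := ue (fun x => O (sg i x)); rewrite fmorphV; apply.
      case: vO => h1 h2 h3 h4; split; rewrite ?rmorph1 //.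
      - by move=> x y; rewrite rmorphB; apply: h2.
      - by move=> x y; rewrite rmorphM; apply: h3.
      - by move=> x; rewrite fmorphV.
    by case: jE => b0 jb; rewrite [X in sg i X]jb sgF -jb.
  split; first by apply: prod => // i; case: (each i).
  by rewrite -prodfV; apply: prod => // i; case: (each i).
have : w (N ^+ m.+1) = 0.
  apply: unit_above_ratsub; rewrite ?expf_neq0 //.
    by rewrite Nb; apply: ratsub_ratinj.
  by move=> O vO Oj; have [h1 h2] := uN O vO Oj; rewrite -exprVn; split; apply: (vrX vO).
rewrite (valX hw) // -wN => /eqP; by rewrite mulrn_eq0 /= => /eqP.
Qed.

End ProductFormula.

(** * An energy inequality *)

Definition qf (x : rat) : rat := x - x ^+ 2.
(** For [y <= x] this is the mean of [B (x - y)] and [B (x + y)], with [B z = z^2 - z + 1/6] the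
    second Bernoulli polynomial, which gives local heights on Tate curves. *)
Definition energy (x y : rat) : rat := Num.min x y - qf x - qf y + 6%:R^-1.

Lemma sum_below (u : nat -> rat) a M : (a <= M)%N ->
  \sum_(r < M) (r < a)%N%:R * u r = \sum_(r < a) u r.
Proof.
move=> aM; rewrite (big_ord_widen M u aM) [RHS]big_mkcond /=.
by apply: eq_bigr => i _; case: ifP => _; rewrite ?mul1r ?mul0r.
Qed.

Lemma sum_lin (h : rat) a :
  \sum_(r < a) (1 - (2 * r + 1)%N%:R * h) = a%:R - a%:R ^+ 2 * h.
Proof.
elim: a => [|a IH]; first by rewrite big_ord0 expr0n mul0r subr0.
by rewrite big_ord_recr /= IH natrD natrM -natr1; ring.
Qed.

Lemma sum_lin_sqr (h : rat) a :
  \sum_(r < a) (1 - (2 * r + 1)%N%:R * h) ^+ 2 =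
  a%:R - 2%:R * h * a%:R ^+ 2 + h ^+ 2 * (4%:R * a%:R ^+ 3 - a%:R) / 3%:R.
Proof.
elim: a => [|a IH]; first by rewrite big_ord0; field.
by rewrite big_ord_recr /= IH natrD natrM -natr1; field.
Qed.

(* [energy] is the Gram kernel of the functions [1_[0,x) - (1 - 2 t)] on
   [0, 1/2]; midpoint sampling on a grid of step [1 / (2 M)] is exact except for
   the constant term, which leaves a gain of [1 / (24 M^2)]. *)
Lemma energy_lower n M (f : 'I_n -> rat) : (0 < M)%N ->
  (forall k, exists2 F : nat, (F <= M)%N & f k = F%:R / (2 * M)%N%:R) ->
  n%:R ^+ 2 / (24%:R * M%:R ^+ 2) <= \sum_k \sum_l energy (f k) (f l).
Proof.
move=> M0 fF; pose F k := sval (cid2 (fF k)).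
have FM k : (F k <= M)%N by rewrite /F; case: cid2.
have fE k : f k = (F k)%:R / (2 * M)%N%:R by rewrite /F; case: cid2.
have Mr : (M%:R : rat) != 0 by rewrite pnatr_eq0 -lt0n.
pose h : rat := ((2 * M)%N%:R)^-1.
have hE : h = (2%:R * M%:R)^-1 by rewrite /h natrM.
have h0 : 0 <= h by rewrite invr_ge0 ler0n.
(* The function [1 - 2 t] at the midpoint [(2 r + 1) / (4 M)] of the [r]-th cell. *)
pose c (r : nat) : rat := 1 - (2 * r + 1)%N%:R * h.
pose v k (r : nat) : rat := (r < F k)%N%:R - c r.
have key k l : energy (f k) (f l) = \sum_(r < M) h * (v k r * v l r) + (24%:R * M%:R ^+ 2)^-1.
  have -> : \sum_(r < M) h * (v k r * v l r) = h * (
     \sum_(r < M) (r < minn (F k) (F l))%N%:R * 1 - \sum_(r < M) (r < F k)%N%:R * c r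
     - \sum_(r < M) (r < F l)%N%:R * c r + \sum_(r < M) c r ^+ 2).
    rewrite -!sumrB -big_split /= -mulr_sumr; congr (_ * _); apply: eq_bigr => r _.
    by rewrite /v leq_min -mulnb natrM; ring.
  rewrite (sum_below (fun=> 1)) ?geq_min ?FM // !sum_below ?FM // sumr_const card_ord.
  rewrite !sum_lin sum_lin_sqr /energy /qf.
  have -> : Num.min (f k) (f l) = (minn (F k) (F l))%:R * h.
    rewrite !fE -/h; case: (leqP (F k) (F l)) => [le|/ltnW le].
      by rewrite min_l // ler_wpM2r // ler_nat.
    by rewrite min_r // ler_wpM2r // ler_nat.
  rewrite !fE -/h hE; move: (M%:R : rat) Mr (F k)%:R (F l)%:R (minn _ _) => m m0 x y t.
  field; exact: m0.
have -> : \sum_k \sum_l energy (f k) (f l) =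
    \sum_(r < M) h * (\sum_k v k r) ^+ 2 + n%:R ^+ 2 / (24%:R * M%:R ^+ 2).
  under eq_bigr do (under eq_bigr do rewrite key).
  under eq_bigr do rewrite big_split /= sumr_const card_ord.
  rewrite big_split /= sumr_const card_ord; congr (_ + _).
    under eq_bigr do rewrite exchange_big /=.
    rewrite exchange_big /=; apply: eq_bigr => r _.
    under eq_bigr do rewrite -mulr_sumr -mulr_sumr.
    by rewrite -mulr_sumr -mulr_suml expr2.
  by rewrite -[LHS]mulr_natl -[X in _ * X]mulr_natl mulrA expr2.
rewrite lerDr; apply: sumr_ge0 => r _; apply: mulr_ge0 => //; exact: sqr_ge0.
Qed.

Lemma common_denom n (f : 'I_n -> rat) : (forall k, 0 <= f k <= 2%:R^-1) ->
  exists2 M : nat, (0 < M)%N &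
    forall k, exists2 F : nat, (F <= M)%N & f k = F%:R / (2 * M)%N%:R.
Proof.
move=> hf; pose M := (\prod_k `|denq (f k)|)%N.
have M0 : (0 < M)%N by rewrite prodn_gt0 // => k; rewrite absz_gt0 denq_eq0.
exists M => // k; have /andP[f0 f2] := hf k.
have d0 : (0 < `|denq (f k)|)%N by rewrite absz_gt0 denq_eq0.
have ME : M = (`|denq (f k)| * (M %/ `|denq (f k)|))%N.
  by rewrite mulnC divnK // /M (bigD1 k) //= dvdn_mulr.
pose q := (M %/ `|denq (f k)|)%N.
exists (`|numq (f k)| * (2 * q))%N; last first.
  rewrite -{1}(divq_num_den (f k)) {1}ME -/q.
  have -> : (numq (f k))%:~R = (`|numq (f k)|%N)%:R :> rat.
    by rewrite -[in LHS](gez0_abs (_ : 0 <= numq (f k))) // numq_ge0.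
  have -> : (denq (f k))%:~R = (`|denq (f k)|%N)%:R :> rat.
    by rewrite -[in LHS](gez0_abs (_ : 0 <= denq (f k))) // ltW.
  have q0 : (q%:R : rat) != 0.
    by rewrite pnatr_eq0; apply: contraTneq M0 => z; rewrite ME -/q z muln0.
  rewrite !natrM; field; rewrite q0 pnatr_eq0 -lt0n //.
have : f k * (2 * M)%N%:R <= M%:R.
  by rewrite natrM mulrA -[leRHS]mul1r ler_wpM2r ?ler0n // -ler_pdivlMr ?mul1r.
rewrite -{1}(divq_num_den (f k)) {1}ME -/q.
have -> : (numq (f k))%:~R = (`|numq (f k)|%N)%:R :> rat.
  by rewrite -[in LHS](gez0_abs (_ : 0 <= numq (f k))) // numq_ge0.
have -> : (denq (f k))%:~R = (`|denq (f k)|%N)%:R :> rat.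
  by rewrite -[in LHS](gez0_abs (_ : 0 <= denq (f k))) // ltW.
rewrite (_ : _ * _ = (`|numq (f k)| * (2 * q))%N%:R) ?ler_nat //.
by rewrite !natrM; field; rewrite pnatr_eq0 -lt0n.
Qed.

Section Energy.
Variables (N n : nat) (f : 'I_n -> 'I_N -> rat) (eps : rat).
Hypothesis f01 : forall k i, 0 <= f k i <= 2%:R^-1.
Hypothesis fmin : forall k l, k != l -> \sum_i Num.min (f k i) (f l i) = N%:R / 6%:R.
Hypothesis fq : forall k, N%:R * (6%:R^-1 - eps) <= \sum_i qf (f k i).

Lemma energy_upper :
  \sum_i \sum_k \sum_l energy (f k i) (f l i) <= N%:R * (n%:R / 3%:R + 2%:R * n%:R ^+ 2 * eps).
Proof.
rewrite exchange_big /=; under eq_bigr do rewrite exchange_big /=.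
pose Q k := \sum_i qf (f k i).
have e k l : \sum_i energy (f k i) (f l i) =
    \sum_i Num.min (f k i) (f l i) - Q k - Q l + N%:R / 6%:R.
  rewrite /energy big_split /= sumr_const card_ord -[X in _ + X]mulr_natl.
  by rewrite sumrB sumrB.
pose B := N%:R * (6%:R^-1 - eps).
(* Off the diagonal the mean of the minimum is 1/6; on it only the bound 1/2 is available, which
   costs another 1/3. *)
have le k l : \sum_i energy (f k i) (f l i) <= N%:R / 3%:R - 2%:R * B + (k == l)%:R * (N%:R / 3%:R).
  rewrite e; have := fq k; have := fq l; rewrite -/B -/(Q k) -/(Q l).
  have [<-|ne] := eqVneq k l.
    have : \sum_i Num.min (f k i) (f k i) <= N%:R / 2%:R.
      rewrite -[N in leRHS]card_ord -sum1_card natr_sum mulr_suml; apply: ler_sum => i _.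
      by rewrite minxx mul1r; case/andP: (f01 k i).
    by rewrite mul1r; move: (\sum_i Num.min _ _) (Q k) B (N%:R : rat) => x y z t; lra.
  rewrite fmin // mul0r addr0; move: (Q k) (Q l) B (N%:R : rat) => x y z t; lra.
apply: le_trans (_ : \sum_k \sum_l (N%:R / 3%:R - 2%:R * B + (k == l)%:R * (N%:R / 3%:R)) <= _).
  by apply: ler_sum => k _; apply: ler_sum => l _.
have sub (k : 'I_n) : \sum_l (N%:R / 3%:R - 2%:R * B + (k == l)%:R * (N%:R / 3%:R)) =
    n%:R * (N%:R / 3%:R - 2%:R * B) + N%:R / 3%:R.
  rewrite big_split /= sumr_const card_ord -[X in X + _ = _]mulr_natl; congr (_ + _).
  rewrite (bigD1 k) //= eqxx mul1r big1 ?addr0 // => l /negPf ne.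
  by rewrite eq_sym ne mul0r.
under eq_bigr do rewrite sub.
rewrite sumr_const card_ord -[leLHS]mulr_natl /B.
by rewrite le_eqVlt; apply/orP; left; apply/eqP; field.
Qed.

(** The grid gives [n^2 / (24 M^2)] as a lower bound. The condition on [eps] lets half of it absorb
    the error term, leaving [n^2 / (48 M^2) <= n / 3]. *)
Lemma energy_grid_bound M : (0 < N)%N -> (0 < M)%N -> eps <= (96%:R * M%:R ^+ 2)^-1 ->
  (forall k i, exists2 F : nat, (F <= M)%N & f k i = F%:R / (2 * M)%N%:R) ->
  (n <= 16 * M ^ 2)%N.
Proof.
move=> N0 M0 he fF; have := energy_upper.
have Nr : 0 < (N%:R : rat) by rewrite ltr0n.
have Mr : 0 < (M%:R : rat) by rewrite ltr0n.
have : \sum_(i < N) n%:R ^+ 2 / (24%:R * M%:R ^+ 2) <= \sum_i \sum_k \sum_l energy (f k i) (f l i).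
  by apply: ler_sum => i _; apply: energy_lower.
rewrite sumr_const card_ord -[leLHS]mulr_natl => h1 h2.
have {h1 h2} := le_trans h1 h2; rewrite ler_pM2l // => h.
have M2 : 0 < (M%:R : rat) ^+ 2 by rewrite exprn_gt0.
have [->|n0] := posnP n; first by [].
have nr : 0 < (n%:R : rat) by rewrite ltr0n.
have h3 : 2%:R * n%:R ^+ 2 * eps <= n%:R ^+ 2 / (48%:R * M%:R ^+ 2).
  have -> : n%:R ^+ 2 / (48%:R * M%:R ^+ 2) = 2%:R * n%:R ^+ 2 * (96%:R * M%:R ^+ 2)^-1 :> rat.
    by field; rewrite gt_eqF.
  by rewrite ler_wpM2l // mulr_ge0 ?ler0n // exprn_ge0 // ler0n.
have h4 : n%:R ^+ 2 / (24%:R * M%:R ^+ 2) = 2%:R * (n%:R ^+ 2 / (48%:R * M%:R ^+ 2)) :> rat.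
  by field; rewrite gt_eqF.
rewrite h4 in h; have h5 : n%:R ^+ 2 / (48%:R * M%:R ^+ 2) <= n%:R / 3%:R :> rat.
  by move: h h3; move: (n%:R ^+ 2 / _) (2%:R * _ * eps) (n%:R / _) => x y z; lra.
rewrite -(ler_nat rat) natrM natrX.
move: h5; rewrite ler_pdivrMr ?mulr_gt0 ?ltr0n // expr2.
have -> : n%:R / 3%:R * (48%:R * M%:R ^+ 2) = n%:R * (16%:R * M%:R ^+ 2) :> rat by field.
by rewrite ler_pM2l.
Qed.

(** Each index in [C] contributes at least [n^2 / 24] and the others are nonnegative, so the mean is
    at least [n^2 / (24 d)]; half of this absorbs the error term. *)
Lemma energy_const_bound d (C : {set 'I_N}) (phi : 'I_N -> rat) : (0 < N)%N ->
  (N <= d * #|C|)%N -> eps <= (96%:R * d%:R)^-1 ->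
  (forall k i, i \in C -> f k i = phi i) -> (n <= 16 * d)%N.
Proof.
move=> N0 Nd he fC; have := energy_upper.
have Nr : 0 < (N%:R : rat) by rewrite ltr0n.
have d0 : (0 < d)%N by case: d Nd {he} => //; rewrite mul0n leqNgt N0.
have dr : 0 < (d%:R : rat) by rewrite ltr0n.
have ge0 i : 0 <= \sum_k \sum_l energy (f k i) (f l i).
  have [M M0 MF] := common_denom (fun k => f01 k i).
  apply: le_trans (energy_lower M0 MF); apply: divr_ge0; first exact: sqr_ge0.
  by rewrite mulr_ge0 ?ler0n // exprn_ge0 // ler0n.
have : \sum_(i in C) n%:R ^+ 2 / 24%:R <= \sum_i \sum_k \sum_l energy (f k i) (f l i).
  rewrite [leRHS](bigID (mem C)) /= -[leLHS]addr0 lerD //; last by apply: sumr_ge0.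
  apply: ler_sum => i iC.
  have -> : \sum_k \sum_l energy (f k i) (f l i) = \sum_(k < n) \sum_(l < n) energy (phi i) (phi i).
    by apply: eq_bigr => k _; apply: eq_bigr => l _; rewrite !fC.
  rewrite sumr_const [X in _ <= X *+ _]sumr_const card_ord -[leRHS]mulr_natl -[X in _ <= _ * X]mulr_natl mulrA -expr2.
  rewrite ler_wpM2l ?sqr_ge0 // /energy /qf minxx.
  (* [energy x x = 2 (x - 1/4)^2 + 1/24]. *)
  have : 0 <= (phi i - 4%:R^-1) ^+ 2 by exact: sqr_ge0.
  by rewrite sqrrB -mulr_natl; move: (phi i) (phi i ^+ 2) => x y; lra.
rewrite sumr_const -[leLHS]mulr_natl => h1 h2; have {h1 h2} h := le_trans h1 h2.
have [->|n0] := posnP n; first by [].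
have nr : 0 < (n%:R : rat) by rewrite ltr0n.
pose z := n%:R / 3%:R + 2%:R * n%:R ^+ 2 * eps.
have z0 : 0 <= z.
  have : 0 <= N%:R * z by apply: le_trans h; rewrite mulr_ge0 ?ler0n // divr_ge0 ?sqr_ge0 ?ler0n.
  by rewrite pmulr_rge0.
have C0 : 0 < (#|C|%:R : rat).
  by rewrite ltr0n lt0n; apply: contraTneq Nd => ->; rewrite muln0 -ltnNge.
have {}h : n%:R ^+ 2 / 24%:R <= d%:R * z.
  rewrite -(ler_pM2l C0); apply: le_trans h _.
  rewrite [leRHS](mulrA _ _ z); apply: ler_wpM2r => //.
  by rewrite -natrM ler_nat mulnC.
have h3 : d%:R * (2%:R * n%:R ^+ 2 * eps) <= n%:R ^+ 2 / 48%:R.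
  have -> : n%:R ^+ 2 / 48%:R = d%:R * (2%:R * n%:R ^+ 2 * (96%:R * d%:R)^-1) :> rat.
    by field; rewrite gt_eqF.
  apply: ler_wpM2l; first exact: ltW.
  by apply: ler_wpM2l => //; rewrite mulr_ge0 ?ler0n // sqr_ge0.
rewrite /z mulrDr in h.
have h5 : n%:R ^+ 2 / 48%:R <= d%:R * (n%:R / 3%:R) :> rat.
  by move: h h3; move: (n%:R ^+ 2) (d%:R * (_ * eps)) (d%:R * _) => x y t; lra.
rewrite -(ler_nat rat) natrM -(ler_pM2l nr).
move: h5; rewrite expr2; move: (n%:R * n%:R) => x.
by have -> : n%:R * (16%:R * d%:R) = 48%:R * (d%:R * (n%:R / 3%:R)) :> rat; [field|lra].
Qed.

End Energy.

(** * Decomposition groups *)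

Lemma perm_map_stable (T : eqType) (g : T -> T) (s : seq T) : injective g -> uniq s ->
  {subset map g s <= s} -> perm_eq (map g s) s.
Proof.
move=> gI us sub; have um : uniq (map g s) by rewrite map_inj_uniq.
have [_ e] := uniq_min_size um sub (eq_leq (esym (size_map g s))).
exact: uniq_perm.
Qed.

Lemma large_mult (A B : rat) : 0 < A -> exists M0, forall M, (M0 <= M)%N -> 0 < M%:R * A + B.
Proof.
move=> A0; exists (Num.bound (`|B / A|)).+1 => M hM.
have h : `|B / A| < M%:R.
  by apply: lt_trans (archi_boundP (normr_ge0 _)) _; rewrite ltr_nat.
have : - (B / A) < M%:R by apply: le_lt_trans h; rewrite -normrN ler_norm.
by rewrite -(ltr_pM2r A0) mulNr divfK ?gt_eqF // -subr_gt0 opprK.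
Qed.

Section Dec.
Variables (F : fieldType) (L : closedFieldType) (iota : {rmorphism F -> L}).
Hypothesis algL : is_algebraic_closure iota.
Variables (K : L -> Prop).
Hypothesis hK : finite_abelian_galois iota K.
Variable w : L -> rat.
Hypothesis hw : is_val w.

Local Notation Faut := (fixes iota).

Lemma K_sub : is_subfield K. Proof. by case: hK. Qed.

Lemma K_stable (s : {rmorphism L -> L}) x : Faut s -> K x -> K (s x).
Proof.
case: hK => _ _ _ [_ nK] _ sF /nK[P [rs [P0 Px rK PE]]]; apply: rK.
have := fixes_root sF Px; rewrite PE rootZ ?root_prod_XsubC //.
by rewrite lead_coef_eq0 map_poly_eq0.
Qed.

Lemma K_Faut (s : {rmorphism L -> L}) : Faut s -> is_Faut iota K s.
Proof.
move=> sF; split=> //.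
- by move=> x; apply: K_stable.
- move=> z Kz; have [t [tF st ts]] := fixes_inv algL sF.
  by exists (t z); split; [apply: K_stable|rewrite ts].
- by move=> x y _ _; rewrite rmorphD.
- by move=> x y _ _; rewrite rmorphM.
Qed.

Lemma K_comm (s t : {rmorphism L -> L}) x : Faut s -> Faut t -> K x -> s (t x) = t (s x).
Proof. by move=> sF tF; case: hK => _ _ _ _; apply; apply: K_Faut. Qed.

Lemma K_fixed z : K z -> (forall s : {rmorphism L -> L}, Faut s -> s z = z) ->
  exists a, z = iota a.
Proof.
move=> Kz zf; case: hK => _ _ _ [sK _] _; have [P [sP Pz]] := sK _ Kz.
exact: (fixed_separable algL zf sP Pz).
Qed.

Lemma K_restr : exists n (h : 'I_n -> {rmorphism L -> L}), (forall i, Faut (h i)) /\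
  forall s : {rmorphism L -> L}, Faut s -> exists i, forall x, K x -> h i x = s x.
Proof.
case: hK => _ _ [bs [bK bspan]] _ _.
have [n [h [hF hT _]]] := finite_restrictions algL bs.
exists n, h; split=> // s sF; have [i hi] := hT _ sF; exists i => x /bspan[cs [sz ->]].
rewrite !rmorph_sum; apply: eq_bigr => l _; rewrite !rmorphM sF hF; congr (_ * _).
by apply: hi; apply: mem_nth.
Qed.

Lemma K_big_prod (r : seq L) : (forall x, x \in r -> K x) -> K (\prod_(x <- r) x).
Proof.
case: K_sub => K1 _ KM _; elim: r => [|x r IH] h; first by rewrite big_nil.
by rewrite big_cons; apply: KM; [apply: h; rewrite mem_head|apply: IH => y yr; apply: h; rewrite in_cons yr orbT].
Qed.

Lemma K_big_sum (r : seq L) : (forall x, x \in r -> K x) -> K (\sum_(x <- r) x).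
Proof.
case: K_sub => K1 KB _ _; have K0 : K 0 by rewrite -(subrr 1); apply: KB.
elim: r => [|x r IH] h; first by rewrite big_nil.
rewrite big_cons -(opprK (\sum_(x <- r) x)); apply: (KB); first by apply: h; rewrite mem_head.
by rewrite -sub0r; apply: (KB) => //; apply: IH => y yr; apply: h; rewrite in_cons yr orbT.
Qed.

Lemma K_X x n : K x -> K (x ^+ n).
Proof. by case: K_sub => K1 _ KM _ Kx; elim: n => [|n IH]; rewrite ?expr0 // exprS; apply: KM. Qed.

(* The decomposition group of [w] in [Gal(K / F)]. *)
Definition dec (s : {rmorphism L -> L}) := forall x, K x -> w (s x) = w x.

Lemma finite_orbit (Q : {rmorphism L -> L} -> Prop) x : K x ->
  (forall s t, Faut s -> Faut t -> (forall x, K x -> s x = t x) -> Q s -> Q t) ->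
  exists r : seq L, uniq r /\ forall y, y \in r <-> exists s, [/\ Faut s, Q s & y = s x].
Proof.
move=> Kx QE; have [n [h [hF hT]]] := K_restr.
exists (undup [seq h i x | i <- enum 'I_n & `[< Q (h i) >]]); split; first exact: undup_uniq.
move=> y; rewrite mem_undup; split.
  by move=> /mapP[i]; rewrite mem_filter => /andP[/asboolP Qi _] ->; exists (h i).
move=> [s [sF Qs ->]]; have [i hi] := hT _ sF.
apply/mapP; exists i; last by rewrite hi.
rewrite mem_filter mem_enum andbT; apply/asboolP.
by apply: QE Qs => // z Kz; rewrite hi.
Qed.

Lemma dec_ext s t : Faut s -> Faut t -> (forall x, K x -> s x = t x) -> dec s -> dec t.
Proof. by move=> _ _ e h x Kx; rewrite -e // h. Qed.

Lemma dec_orbit x : K x -> exists r : seq L, uniq r /\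
  forall y, y \in r <-> exists s, [/\ Faut s, dec s & y = s x].
Proof. by move=> Kx; apply: (finite_orbit Kx); exact: dec_ext. Qed.

Lemma decM s t : Faut s -> Faut t -> dec s -> dec t -> dec (s \o t).
Proof. by move=> sF tF ds dt x Kx /=; rewrite ds ?dt //; apply: K_stable. Qed.

Lemma val_prod (r : seq L) : (forall x, x \in r -> x != 0) ->
  w (\prod_(x <- r) x) = \sum_(x <- r) w x.
Proof.
elim: r => [|x r IH] h; first by rewrite !big_nil (val1 hw).
have hr y : y \in r -> y != 0 by move=> yr; apply: h; rewrite in_cons yr orbT.
rewrite !big_cons (valM hw) ?IH //; first by apply: h; rewrite mem_head.
by rewrite prodf_seq_neq0; apply/allP => y /hr ->.
Qed.

(** Commutativity gives [w (s (t x)) = w (t (s x)) = w (s x)] for [t] in the decomposition group, so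
    all factors of [s N] have the same value, even when [s] lies outside that group. *)
Lemma dec_orbit_prod x r : K x -> x != 0 -> uniq r ->
  (forall y, y \in r <-> exists s, [/\ Faut s, dec s & y = s x]) ->
  let N := \prod_(y <- r) y in
  [/\ K N, N != 0, forall s, Faut s -> dec s -> s N = N &
    forall s, Faut s -> w (s N) = (size r)%:R * w (s x)].
Proof.
move=> Kx x0 ur hr N.
have rn y : y \in r -> y != 0 by case/hr => s [_ _ ->]; rewrite fmorph_eq0.
have rK y : y \in r -> K y by case/hr => s [sF _ ->]; apply: K_stable.
split.
- exact: K_big_prod.
- by rewrite prodf_seq_neq0; apply/allP => y /rn ->.
- move=> s sF ds; rewrite /N rmorph_prod -(big_map s xpredT id).
  apply: perm_big; apply: perm_map_stable => //; first exact: fmorph_inj.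
  move=> _ /mapP[y /hr[t [tF dt ->]] ->]; apply/hr.
  by exists (s \o t); split=> //; [apply: fixes_comp|apply: decM].
- move=> s sF; rewrite /N rmorph_prod -(big_map s xpredT id) val_prod; last first.
    by move=> _ /mapP[y /rn y0 ->]; rewrite fmorph_eq0.
  rewrite big_map (eq_big_seq (fun=> w (s x))).
    by rewrite big_const_seq count_predT iter_addr_0 mulr_natl.
  by move=> _ /hr[t [tF dt ->]]; rewrite K_comm // dt //; apply: K_stable.
Qed.

(** The sum of the distinct conjugates of [y] lies in [F], and [y] is its dominant term. *)
Lemma min_orbit_val y : K y -> y != 0 ->
  (forall s : {rmorphism L -> L}, Faut s -> s y != y -> w y < w (s y)) ->
  exists2 a, a != 0 & w y = w (iota a).
Proof.
move=> Ky y0 ymin; have [//|r [ur hr]] := @finite_orbit (fun=> True) y Ky.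
have yr : y \in r by apply/hr; exists idfun.
have [a aE] : exists a, \sum_(x <- r) x = iota a.
  apply: K_fixed; first by apply: K_big_sum => x /hr[s [sF _ ->]]; apply: K_stable.
  move=> s sF; rewrite rmorph_sum -(big_map s xpredT id).
  apply: perm_big; apply: perm_map_stable => //; first exact: fmorph_inj.
  move=> _ /mapP[x /hr[t [tF _ ->]] ->]; apply/hr.
  by exists (s \o t); split=> //; apply: fixes_comp.
have [s0 ws] : y + \sum_(x <- rem y r) x != 0 /\ w (y + \sum_(x <- rem y r) x) = w y.
  apply: (val_dom hw) => //; rewrite big_seq.
  apply: (big_ind (fun x => vgt w x (w y))); [by left|by move=> *; apply: (vgtD hw)|].
  move=> x; rewrite (mem_rem_uniq y ur) inE => /andP[xy /hr[s [sF _ xE]]].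
  by right; rewrite xE; apply: ymin => //; rewrite -xE.
exists a.
  by rewrite -(fmorph_eq0 iota) -aE (big_rem y).
by rewrite -aE (big_rem y).
Qed.

(** A pair not separated by [b] is separated by some [x]; in [b^M x] with [M] large the pairs
    already separated remain so. *)
Lemma generic_elt n (h : 'I_n -> {rmorphism L -> L}) (r : seq ('I_n * 'I_n)) :
  (forall c, c \in r -> ~ (forall x, K x -> w (h c.1 x) = w (h c.2 x))) ->
  exists b, [/\ K b, b != 0 & forall c, c \in r -> w (h c.1 b) != w (h c.2 b)].
Proof.
have [K1 _ KM _] := K_sub; elim: r => [|c r IH] hr.
  by exists 1; split=> //; exact: oner_neq0.
have [|b [Kb b0 hb]] := IH; first by move=> e er; apply: hr; rewrite in_cons er orbT.
have [eb|nb] := eqVneq (w (h c.1 b)) (w (h c.2 b)); last first.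
  by exists b; split=> // e; rewrite in_cons => /orP[/eqP ->|/hb].
have [x [Kx ne]] : exists x, K x /\ w (h c.1 x) != w (h c.2 x).
  apply: contrapT => no; apply: (hr c); first exact: mem_head.
  by move=> x Kx; apply: contrapT => /eqP ne; apply: no; exists x.
have x0 : x != 0 by apply: contraNneq ne => ->; rewrite !rmorph0.
have wbx M (s : {rmorphism L -> L}) : w (s (b ^+ M * x)) = M%:R * w (s b) + w (s x).
  rewrite rmorphM rmorphXn (valM hw) ?expf_neq0 ?fmorph_eq0 // (valX hw) ?fmorph_eq0 //.
  by rewrite mulr_natl.
have [M0 M0P] : exists M0, forall M, (M0 <= M)%N ->
    forall e, e \in r -> w (h e.1 (b ^+ M * x)) != w (h e.2 (b ^+ M * x)).
  elim: r {IH hr} hb => [|e r IH] hb; first by exists 0%N.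
  have [|M1 M1P] := IH; first by move=> e' e'r; apply: hb; rewrite in_cons e'r orbT.
  have := hb e (mem_head _ _); rewrite neq_lt => /orP lt.
  have [M2 M2P] : exists M2, forall M, (M2 <= M)%N -> w (h e.1 (b ^+ M * x)) != w (h e.2 (b ^+ M * x)).
    case: lt => lt; rewrite -subr_gt0 in lt.
      have [M2 M2P] := large_mult (w (h e.2 x) - w (h e.1 x)) lt.
      by exists M2 => M /M2P h2; rewrite !wbx lt_eqF // -subr_gt0; move: h2;
         congr (0 < _); ring.
    have [M2 M2P] := large_mult (w (h e.1 x) - w (h e.2 x)) lt.
    by exists M2 => M /M2P h2; rewrite !wbx gt_eqF // -subr_gt0; move: h2;
       congr (0 < _); ring.
  exists (maxn M1 M2) => M; rewrite geq_max => /andP[h1 h2] e'.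
  by rewrite in_cons => /orP[/eqP ->|e'r]; [apply: M2P|apply: M1P].
exists (b ^+ M0 * x); split.
- by apply: (KM) => //; apply: K_X.
- by rewrite mulf_neq0 // expf_neq0.
- move=> e; rewrite in_cons => /orP[/eqP ->|]; last exact: M0P.
  by rewrite !wbx eb (inj_eq (addrI _)).
Qed.

(** A conjugate of minimal value of a generic element keeps that value only under the decomposition
    group; the product over its orbit under that group is moreover fixed. *)
Lemma dec_elt : exists b, [/\ K b, b != 0, forall s, Faut s -> dec s -> s b = b &
  forall s, Faut s -> ~ dec s -> w b < w (s b)].
Proof.
have [n [h [hF hT]]] := K_restr.
pose r := [seq c <- enum (('I_n * 'I_n)%type : finType) |
   ~~ `[< forall x, K x -> w (h c.1 x) = w (h c.2 x) >]].
have [|b [Kb b0 hb]] := @generic_elt n h r.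
  by move=> c; rewrite mem_filter => /andP[/asboolP].
have [i1 _] := hT idfun (fun=> erefl).
have [i0 hmin] : exists i0, forall i, w (h i0 b) <= w (h i b).
  case: (Order.TotalTheory.arg_minP (fun i => w (h i b)) (erefl : predT i1)) => i0 _ hi.
  by exists i0 => i; apply: hi.
pose b1 := h i0 b; have Kb1 : K b1 by apply: K_stable.
have b10 : b1 != 0 by rewrite fmorph_eq0.
have b1min (s : {rmorphism L -> L}) : Faut s -> w b1 <= w (s b1) /\ (w (s b1) = w b1 -> dec s).
  move=> sF; have [i hi] := hT (s \o h i0) (fixes_comp sF (hF i0)).
  have e : s b1 = h i b by rewrite hi.
  rewrite e; split; first exact: hmin.
  move=> eq x Kx; have [t [tF ht th]] := fixes_inv algL (hF i0).
  have Kt : K (t x) by apply: K_stable.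
  have -> : x = h i0 (t x) by rewrite th.
  have := hi (t x) Kt => /= <-.
  apply: contrapT => ne; have /hb : (i, i0) \in r.
    by rewrite mem_filter mem_enum andbT; apply/asboolP => /(_ (t x) Kt).
  by rewrite /= eq eqxx.
have [O [uO hO]] := dec_orbit Kb1.
have [KN N0 Nfix wN] := dec_orbit_prod Kb1 b10 uO hO.
exists (\prod_(y <- O) y); split=> // s sF nd.
have [le ne] := b1min _ sF.
have O0 : (0 < size O)%N.
  have : b1 \in O by apply/hO; exists idfun.
  by case: (O).
have := wN idfun (fun=> erefl); rewrite /= => ->; rewrite wN //.
rewrite ltr_pM2l ?ltr0n // lt_neqAle le andbT.
by apply/eqP => /esym/ne.
Qed.

(** A large power of the element [b] of [dec_elt] makes both [b^M z] and [b^M] strictly minimal in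
    their orbits. So both have values of [F], and hence so does [z]. *)
Lemma dec_value z : K z -> z != 0 -> (forall s, Faut s -> dec s -> s z = z) ->
  exists2 a, a != 0 & w z = w (iota a).
Proof.
move=> Kz z0 zfix; have [b [Kb b0 bfix bmin]] := dec_elt; have [K1 _ KM _] := K_sub.
have wbx M (s : {rmorphism L -> L}) x : x != 0 -> w (s (b ^+ M * x)) = M%:R * w (s b) + w (s x).
  move=> x0; rewrite rmorphM rmorphXn (valM hw) ?expf_neq0 ?fmorph_eq0 // (valX hw) ?fmorph_eq0 //.
  by rewrite mulr_natl.
have key x : K x -> x != 0 -> (forall s, Faut s -> dec s -> s x = x) ->
    exists M0, forall M, (M0 <= M)%N -> exists2 a, a != 0 & w (b ^+ M * x) = w (iota a).
  move=> Kx x0 xfix; have [n [h [hF hT]]] := K_restr.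
  have [M0 M0P] : exists M0, forall M, (M0 <= M)%N -> forall i, ~ dec (h i) ->
      w (b ^+ M * x) < w (h i (b ^+ M * x)).
    suff [M0 M0P] : exists M0, forall M, (M0 <= M)%N -> forall i, i \in enum 'I_n -> ~ dec (h i) ->
      w (b ^+ M * x) < w (h i (b ^+ M * x)).
      by exists M0 => M hM i; apply: M0P => //; rewrite mem_enum.
    elim: (enum 'I_n) => [|i r [M1 M1P]]; first by exists 0%N.
    have [M2 M2P] : exists M2, forall M, (M2 <= M)%N -> ~ dec (h i) ->
        w (b ^+ M * x) < w (h i (b ^+ M * x)).
      have [d|nd] := pselect (dec (h i)); first by exists 0%N => M _ /(_ d).
      have lt := bmin _ (hF i) nd; rewrite -subr_gt0 in lt.
      have [M2 M2P] := large_mult (w (h i x) - w x) lt.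
      exists M2 => M /M2P h2 _; have := wbx M idfun x x0 => /= ->.
      by rewrite wbx // -subr_gt0; move: h2; congr (0 < _); ring.
    exists (maxn M1 M2) => M; rewrite geq_max => /andP[h1 h2] e'.
    by rewrite in_cons => /orP[/eqP ->|e'r]; [apply: M2P|apply: M1P].
  exists M0 => M hM; apply: min_orbit_val.
  - by apply: (KM) => //; apply: K_X.
  - by rewrite mulf_neq0 // expf_neq0.
  - move=> s sF ne; have [i hi] := hT s sF.
    rewrite -hi; last by apply: (KM) => //; apply: K_X.
    apply: M0P => // d; move/eqP: ne; apply.
    have ds : dec s by apply: dec_ext d.
    by rewrite rmorphM rmorphXn bfix // xfix.
have [M1 h1] := key z Kz z0 zfix.
have [|M2 h2] := key 1 K1 (oner_neq0 L); first by move=> s _ _; rewrite rmorph1.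
have [a a0 wa] := h1 (maxn M1 M2) (leq_maxl _ _).
have [a' a'0 wa'] := h2 (maxn M1 M2) (leq_maxr _ _).
exists (a / a'); first by rewrite mulf_neq0 ?invr_eq0.
have b0' : b ^+ maxn M1 M2 != 0 by rewrite expf_neq0.
rewrite fmorph_div (valM hw) ?invr_eq0 ?fmorph_eq0 // (valV hw) ?fmorph_eq0 // -wa -wa'.
by rewrite mulr1 (valM hw) // addrC addKr.
Qed.

End Dec.

(** * Finite extensions of rational function fields *)

Lemma linear_dep (B F : fieldType) (i : {rmorphism B -> F}) (bs : seq F) m (x : 'I_m -> F) :
  (size bs < m)%N ->
  (forall k, exists c : nat -> B, x k = \sum_(l < size bs) i (c l) * bs`_l) ->
  exists c : 'I_m -> B, (exists k, c k != 0) /\ \sum_k i (c k) * x k = 0.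
Proof.
move=> ltn hx; pose A := \matrix_(k < m, l < size bs) (sval (cid (hx k)) l).
have xE k : x k = \sum_(l < size bs) i (A k l) * bs`_l.
  by rewrite [LHS](svalP (cid (hx k))); apply: eq_bigr => l _; rewrite mxE.
have : kermx A != 0.
  by rewrite kermx_eq0 /row_free neq_ltn (leq_ltn_trans (rank_leq_col A)).
case/rowV0Pn => v /sub_kermxP vA v0.
exists (fun k => v 0 k); split.
  apply: contrapT => no; move/eqP: v0; apply; apply/rowP => k; rewrite mxE.
  by apply: contrapT => /eqP h; apply: no; exists k.
under eq_bigr do rewrite xE mulr_sumr.
rewrite exchange_big big1 // => l _.
under eq_bigr do rewrite mulrA -rmorphM.
rewrite -mulr_suml -rmorph_sum; move/matrixP: vA => /(_ 0 l); rewrite !mxE => ->.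
by rewrite rmorph0 mul0r.
Qed.

Lemma val_dep (L : fieldType) (v : L -> rat) (a : L) m (c : 'I_m -> L) :
  is_val v -> a != 0 -> (exists k, c k != 0) -> \sum_k c k * a ^+ k = 0 ->
  exists k k' : 'I_m, [/\ (k' < k)%N, c k != 0, c k' != 0 &
    (k - k')%:R * v a = v (c k' / c k)].
Proof.
move=> hv a0 [k0 ck0] s0.
pose r := [seq k <- enum 'I_m | c k != 0]; pose g k := c k * a ^+ (k : 'I_m).
have rn0 : r != [::].
  by apply/eqP => r0; have : k0 \in r; [rewrite mem_filter ck0 mem_enum|rewrite r0].
have cr k : k \in r -> c k != 0 by rewrite mem_filter => /andP[].
have gr k : k \in r -> g k != 0 by move=> /cr h; rewrite mulf_neq0 ?expf_neq0.
have sr : \sum_(k <- r) g k = 0.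
  rewrite big_filter big_enum_cond /= -[RHS]s0 [RHS](bigID (fun k => c k != 0)) /=.
  rewrite [X in _ = _ + X]big1 ?addr0; first by [].
  by move=> k /negPn/eqP ->; rewrite mul0r.
have [k [k' [kr k'r ne e]]] : exists k k', [/\ k \in r, k' \in r, k <> k' & v (g k) = v (g k')].
  apply: contrapT => no.
  have [|+ _] := vr_sum_neq0 (valring_val hv) (filter_uniq _ (enum_uniq 'I_m)) rn0 gr.
    move=> k k' kr k'r [h1 h2 h3]; apply: contrapT => ne; apply: no; exists k, k'; split=> //.
    have [g1 g2] := (gr _ kr, gr _ k'r).
    have d : v (g k / g k') = v (g k) - v (g k').
      by rewrite (valM hv) ?invr_eq0 // (valV hv).
    have {h2}le1 : 0 <= v (g k) - v (g k').
      by case: h2 => [/eqP|]; rewrite ?(negPf h1) // d.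
    have {h3}le2 : 0 <= v (g k') - v (g k).
      by case: h3 => [/eqP|]; rewrite ?invr_eq0 ?(negPf h1) // (valV hv) // d opprB.
    by apply/eqP; rewrite eq_le -subr_ge0 le2 -subr_ge0 le1.
  by rewrite -/r sr eqxx.
have gE q : q \in r -> v (g q) = v (c q) + q%:R * v a.
  by move=> /cr h; rewrite (valM hv) ?expf_neq0 // (valX hv) // mulr_natl.
wlog lt : k k' kr k'r ne e / (k' < k)%N.
  move=> wl; have [lt|lt|eq] := ltngtP k k'; last by case: ne; apply/val_inj.
    by apply: wl (esym e) lt => //; apply/nesym.
  exact: wl e lt.
exists k, k'; have [c1 c2] := (cr _ kr, cr _ k'r); split=> //.
rewrite (valM hv) ?invr_eq0 // (valV hv) // natrB ?(ltnW lt) // mulrBl.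
by rewrite !gE // in e; move: e; move: (v (c k)) (v (c k')) (_ * v a) (_ * v a) => x y z t; lra.
Qed.

Section FunctionField.
Variables (k : finFieldType) (F : fieldType) (f : {rmorphism k -> F}) (t j : F).
Hypothesis trj : forall P : {poly k}, (map_poly f P).[j] = 0 -> P = 0.
Variable bs : seq F.
Hypothesis spanF : forall y : F, exists c : nat -> ratfield f t,
  y = \sum_(l < size bs) ratinj f t (c l) * bs`_l.

Lemma pow_dep (a : F) : exists c : 'I_(size bs).+1 -> ratfield f t,
  (exists i, c i != 0) /\ \sum_i ratinj f t (c i) * a ^+ i = 0.
Proof. by apply: (@linear_dep _ _ (ratinj f t) bs) => // i; apply: spanF. Qed.

Lemma common_denom_ratsub n (c : 'I_n -> ratfield f t) : exists (Q : {poly k}) (P : 'I_n -> {poly k}),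
  (map_poly f Q).[t] != 0 /\ forall i, ratinj f t (c i) = (map_poly f (P i)).[t] / (map_poly f Q).[t].
Proof.
have h i : exists PQ : {poly k} * {poly k}, (map_poly f PQ.2).[t] != 0 /\
    ratinj f t (c i) = (map_poly f PQ.1).[t] / (map_poly f PQ.2).[t].
  by have /ratsubP[P [Q [h1 h2]]] := ratsub_ratinj (c i); exists (P, Q).
pose PQ i := sval (cid (h i)); have PQP i := svalP (cid (h i)); rewrite -/(PQ _) in PQP.
exists (\prod_i (PQ i).2), (fun i => (PQ i).1 * \prod_(l | l != i) (PQ l).2); split.
  by rewrite rmorph_prod horner_prod; apply/prodf_neq0 => i _; case: (PQP i).
move=> i; have [h1 ->] := PQP i.
rewrite [X in _ = _ / (map_poly f X).[_]](bigD1 i) //; set R := \prod_(l | _) _.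
have R0 : (map_poly f R).[t] != 0.
  by rewrite rmorph_prod horner_prod; apply/prodf_neq0 => l _; case: (PQP l).
by rewrite !rmorphM !hornerM -mulf_div divff // mulr1.
Qed.

(** A relation of [j] over [k(t)], cleared of denominators, is reordered by powers of [t]. It stays
    nontrivial because [j] is transcendental. *)
Lemma t_algebraic : exists P : {poly ratfield f j}, P != 0 /\ root (map_poly (ratinj f j) P) t.
Proof.
have [c [[i0 ci0] s0]] := pow_dep j.
have [Q [P [Q0 PE]]] := common_denom_ratsub c.
have {s0}s0 : \sum_i (map_poly f (P i)).[t] * j ^+ i = 0.
  apply: (mulIf (invr_neq0 Q0)); rewrite mul0r -[RHS]s0 mulr_suml; apply: eq_bigr => i _.
  by rewrite PE mulrAC.
have P0 : P i0 != 0.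
  apply: contra_neq ci0 => z; apply: (fmorph_inj (ratinj f t)).
  by rewrite PE z rmorph0 horner0 mul0r; apply/esym; exact: rmorph0.
pose N := \max_i size (P i).
pose S l : {poly k} := \sum_(i < (size bs).+1) (P i)`_l *: 'X^i.
have SE l : (map_poly f (S l)).[j] = \sum_i f (P i)`_l * j ^+ i.
  rewrite /S rmorph_sum horner_sum; apply: eq_bigr => i _.
  by rewrite /= map_polyZ map_polyXn hornerZ hornerXn.
have Sin l : exists b : ratfield f j, (map_poly f (S l)).[j] = ratinj f j b.
  exact/ratinj_in/ratsub_poly.
pose T l := sval (cid (Sin l)); have TE l : (map_poly f (S l)).[j] = ratinj f j (T l) := svalP (cid (Sin l)).
exists (\poly_(l < N) T l); split.
  apply/eqP => /polyP/(_ (size (P i0)).-1); rewrite coef_poly coef0.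
  have sP0 : (0 < size (P i0))%N by rewrite size_poly_gt0.
  have -> : ((size (P i0)).-1 < N)%N.
    by rewrite prednK // (leq_bigmax i0).
  move=> T0; have := TE (size (P i0)).-1; rewrite T0 => e.
  have /trj/polyP/(_ i0) : (map_poly f (S (size (P i0)).-1)).[j] = 0.
    by rewrite e; exact: rmorph0.
  rewrite /S coef_sum coef0 (bigD1 i0) //= coefZ coefXn eqxx mulr1 big1 ?addr0.
    by move/eqP; rewrite -lead_coefE lead_coef_eq0 (negPf P0).
  by move=> i /negPf ne; rewrite coefZ coefXn (inj_eq val_inj) eq_sym ne mulr0.
apply/rootP; rewrite (@horner_coef_wide _ N); last first.
  by rewrite size_map_poly size_poly.
transitivity (\sum_(l < N) \sum_i f (P i)`_l * j ^+ i * t ^+ l).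
  apply: eq_bigr => l _; rewrite (coef_map (ratinj f j)) coef_poly ltn_ord -mulr_suml.
  by congr (_ * _); rewrite -SE; exact: esym (TE l).
rewrite exchange_big /= -[RHS]s0; apply: eq_bigr => i _.
rewrite (@horner_coef_wide _ N); last by rewrite size_map_poly (leq_bigmax i).
by rewrite mulr_suml; apply: eq_bigr => l _; rewrite coef_map mulrAC.
Qed.

Lemma F_algebraic (a : F) : exists P : {poly ratfield f j}, P != 0 /\ root (map_poly (ratinj f j) P) a.
Proof.
suff /integral_algebraic[P P0 Pa] : integralOver (ratinj f j) a by exists P.
have tI : integralOver (ratinj f j) t.
  by apply/integral_algebraic; have [P [P0 Pt]] := t_algebraic; exists P.
have rI x : x \in ratsub f t -> integralOver (ratinj f j) x.
  apply: ratsub_gen => //.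
  - move=> c; have [b ->] : exists b, f c = ratinj f j b.
      by apply: ratinj_in; have := ratsub_poly f j c%:P; rewrite map_polyC hornerC.
    exact: integral_id.
  - by move=> x1 y1 h1 h2; apply: integral_sub.
  - by move=> x1 y1 h1 h2; apply: integral_mul.
  - by move=> x1 h1; apply: integral_inv.
have [c [[i0 ci0] s0]] := pow_dep a.
pose P := \poly_(i < (size bs).+1) (ratinj f t (c (inord i))).
apply: (@integral_root _ _ _ P).
- apply/eqP => /polyP/(_ i0); rewrite coef_poly ltn_ord coef0 inord_val => /eqP.
  by rewrite fmorph_eq0 (negPf ci0).
- apply/rootP; rewrite horner_poly -[RHS]s0; apply: eq_bigr => i _; by rewrite inord_val.
- by apply/integral_poly => i; rewrite coef_poly; case: ifP => _; [apply/rI/ratsub_ratinj|exact: integral0].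
Qed.

(** One [m] must serve all conjugate valuations, so it depends on degrees only: elements of [F] have
    relations of degree at most [size bs] over [k(t)], polynomials in [t] of degree at most [D] over
    [k(j)]. Two terms of equal value bound the denominators, hence the factorials. *)
Lemma discrete_values : exists2 m : nat, (0 < m)%N & forall v : F -> rat, is_val v ->
  (forall x, x \in ratsub f j -> x != 0 -> exists z : int, v x = z%:~R) ->
  forall a, a != 0 -> exists z : int, m%:R * v a = z%:~R.
Proof.
have [P [P0 /rootP Pt]] := t_algebraic.
pose Pm := (lead_coef P)^-1 *: P.
have Pmon : Pm \is monic by rewrite monicE lead_coefZ mulVf // lead_coef_eq0.
have Pmt : (map_poly (ratinj f j) Pm).[t] = 0 by rewrite map_polyZ hornerZ Pt mulr0.
pose D := size Pm.
have dvd_int (n q : nat) (v : rat) (z : int) : (0 < q <= n)%N -> q%:R * v = z%:~R ->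
    exists z' : int, (n`!)%:R * v = z'%:~R.
  move=> qn e; have /dvdnP[u ->] : (q %| n`!)%N by apply: dvdn_fact.
  by exists (u%:Z * z); rewrite natrM -mulrA e intrM.
exists (((size bs).+1)`! * (D.+1)`!)%N; first by rewrite muln_gt0 !fact_gt0.
move=> v hv vj a a0.
have vpoly R : (map_poly f R).[t] != 0 -> exists z : int, ((D.+1)`!)%:R * v (map_poly f R).[t] = z%:~R.
  move=> R0; set y := (map_poly f R).[t] in R0 *.
  have [||c [cn0 s0]] := @linear_dep _ _ (ratinj f j) (mkseq (fun l => t ^+ l) D) D.+1 (fun e => y ^+ e).
  - by rewrite size_mkseq.
  - move=> e; have [T TE] : exists T : {poly ratfield f j}, y ^+ e = (map_poly (ratinj f j) T).[t].
      have h c : exists b, f c = ratinj f j b.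
        by apply: ratinj_in; have := ratsub_poly f j c%:P; rewrite map_polyC hornerC.
      exists ((\poly_(i < size R) sval (cid (h R`_i))) ^+ e).
      rewrite rmorphXn horner_exp; congr (_ ^+ _); rewrite (@horner_coef_wide _ (size R)); last first.
        by rewrite size_map_poly size_poly.
      rewrite /y horner_coef size_map_poly; apply: eq_bigr => i _; congr (_ * _).
      by rewrite coef_map (coef_map (ratinj f j)) coef_poly ltn_ord; apply: svalP (cid (h R`_i)).
    exists (fun l => (Pdiv.Ring.rmodp T Pm)`_l); rewrite TE {1}(Pdiv.RingMonic.rdivp_eq Pmon T).
    rewrite rmorphD rmorphM hornerD hornerM /= Pmt mulr0 add0r size_mkseq.
    rewrite (@horner_coef_wide _ D (map_poly (ratinj f j) _)); last first.

      by rewrite size_map_poly ltnW // /D Pdiv.Ring.ltn_rmodpN0 // monic_neq0.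
    by apply: eq_bigr => l _; rewrite coef_map nth_mkseq.
  - have [|e [e' [lt ce ce' E]]] := val_dep hv R0 _ s0.
      by case: cn0 => i ci; exists i; rewrite fmorph_eq0.
    have [z zE] := vj (ratinj f j (c e') / ratinj f j (c e))
      (rpred_div (ratsub_ratinj _) (ratsub_ratinj _)) (mulf_neq0 ce' (invr_neq0 ce)).
    apply: (@dvd_int D.+1 (e - e')%N _ z); last by rewrite E zE.
    by rewrite subn_gt0 lt (leq_trans (leq_subr _ _)) // ltnW.
have [c [[i ci] s0]] := pow_dep a.
have [|e [e' [lt ce ce' E]]] := val_dep hv a0 _ s0.
  by exists i; rewrite fmorph_eq0.
have /ratsubP[A [B [B0 eAB]]] := rpred_div (ratsub_ratinj (c e')) (ratsub_ratinj (c e)).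
have A0 : (map_poly f A).[t] != 0.
  by apply: contraTneq (mulf_neq0 ce' (invr_neq0 ce)) => A0; rewrite eAB A0 mul0r eqxx.
have [z1 z1E] := vpoly _ A0; have [z2 z2E] := vpoly _ B0.
have [||z3 z3E] := @dvd_int (size bs).+1 (e - e')%N (((D.+1)`!)%:R * v a) (z1 - z2).
- by rewrite subn_gt0 lt (leq_trans (leq_subr _ _)) // ltnW.
- rewrite mulrCA E eAB (valM hv) ?invr_eq0 // (valV hv) // mulrBr z1E z2E.
  by rewrite -intrB.
by exists z3; rewrite natrM -mulrA.
Qed.
End FunctionField.

(** * Torsion of order p *)

Section Differences.
Variable L : fieldType.
Implicit Types (h : nat -> L) (P : {poly L}).

Definition diff h k := h k.+1 - h k.

Lemma iter_diffZ c g h j k : (forall i, g i = c * h i) ->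
  iter j diff g k = c * iter j diff h k.
Proof. by move=> e; elim: j k => [|j IH] k //=; rewrite /diff !IH mulrBr. Qed.

Lemma iter_diffD f g h j k : (forall i, f i = g i + h i) ->
  iter j diff f k = iter j diff g k + iter j diff h k.
Proof. by move=> e; elim: j k => [|j IH] k //=; rewrite /diff !IH opprD addrACA. Qed.

Lemma iter_diff_shift h j k : iter j diff (fun i => h i.+1) k = iter j diff h k.+1.
Proof. by elim: j k => [|j IH] k //=; rewrite /diff !IH. Qed.

Lemma iter_diff_const c j k : iter j.+1 diff (fun=> c) k = 0.
Proof. by rewrite iterSr (@iter_diffZ 0 _ (fun=> 0)) ?mul0r // => i; rewrite /diff subrr. Qed.

(* ['X] acts on sequences by the shift, hence ['X - 1] by [diff]. *)
Definition shift_act h P k := \sum_(i < size P) P`_i * h (k + i)%N.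

Lemma shift_act_wide h P k n : (size P <= n)%N -> shift_act h P k = \sum_(i < n) P`_i * h (k + i)%N.
Proof.
move=> le; rewrite /shift_act (big_ord_widen n (fun i => P`_i * h (k + i)%N) le) big_mkcond /=.
by apply: eq_bigr => i _; case: ltnP => // /(nth_default _) ->; rewrite mul0r.
Qed.

Lemma shift_actX1 h P k : shift_act h (('X - 1) * P) k = shift_act h P k.+1 - shift_act h P k.
Proof.
have le : (size (('X - 1) * P)%R <= (size P).+1)%N.
  by apply: leq_trans (size_polyMleq _ _) _; rewrite -polyC1 size_XsubC.
rewrite (shift_act_wide _ _ le) (shift_act_wide _ k (leqnSn _)) /shift_act.
under eq_bigr do rewrite mulrBl mul1r coefB mulrBl.
rewrite sumrB; congr (_ - _); rewrite big_ord_recl coefXM mul0r add0r.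
by apply: eq_bigr => i _; rewrite coefXM /= addnS addSn.
Qed.

Lemma iter_diffE h j k : iter j diff h k = shift_act h (('X - 1) ^+ j) k.
Proof.
elim: j k => [|j IH] k; first by rewrite expr0 /shift_act size_poly1 big_ord1 coef1 mul1r addn0.
by rewrite exprS shift_actX1 /= /diff !IH.
Qed.

Lemma iter_diff_pchar p h k : p \in [pchar L] -> iter p diff h k = h (k + p)%N - h k.
Proof.
move=> pL; rewrite iter_diffE.
have pP : p \in [pchar {poly L}] by rewrite (rmorph_pchar polyC).
have -> : ('X - 1 : {poly L}) ^+ p = 'X^p - 1.
  by rewrite -!(pFrobenius_autE pP) rmorphB rmorph1.
have p0 := prime_gt0 (pcharf_prime pL).
rewrite (@shift_act_wide _ _ _ p.+1); last by rewrite size_XnsubC.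
under eq_bigr do rewrite coefB coefXn coef1 mulrBl.
rewrite sumrB big_ord_recr big_ord_recl /= eqxx mul1r addn0 mul1r.
rewrite big1 ?add0r => [|i _]; last by rewrite ltn_eqF ?mul0r.
by rewrite big1 ?addr0 // => i _; rewrite mul0r.
Qed.
End Differences.

Arguments diff {L} h k.

Section Smooth.
Variables (L : fieldType) (O : L -> Prop) (vO : valring O) (z : L).
Hypothesis Oz : O z.

(* Integrality of the divided differences of step [z] up to order [j]. *)
Fixpoint smooth j (h : nat -> L) : Prop :=
  if j is j'.+1 then (forall k, O (h k)) /\
    exists2 h', smooth j' h' & forall k, diff h k = z * h' k
  else forall k, O (h k).

Lemma smoothO j h k : smooth j h -> O (h k).
Proof. by case: j => [|j] //= []. Qed.

Lemma smoothW j h : smooth j.+1 h -> smooth j h.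
Proof.
elim: j h => [|j IH] h [Oh [h' sh' e]] //; split=> //.
by exists h' => //; apply: IH.
Qed.

Lemma smooth_const j c : O c -> smooth j (fun=> c).
Proof.
move=> Oc; have h0 i : smooth i (fun=> 0).
  elim: i => [|i IH] /=; first by move=> _; apply: (vr0 vO).
  split=> [_|]; first exact: (vr0 vO).
  by exists (fun=> 0) => // k; rewrite /diff subrr mulr0.
case: j => [|j] //=; split=> //; exists (fun=> 0) => // k.
by rewrite /diff subrr mulr0.
Qed.

Lemma smooth_shift j h : smooth j h -> smooth j (fun k => h k.+1).
Proof.
elim: j h => [|j IH] h /=; first by move=> H k; apply: H.
move=> [Oh [h' sh' e]]; split=> [k|]; first exact: Oh.
by exists (fun k => h' k.+1); [apply: IH|move=> k; rewrite /diff; apply: e].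
Qed.

Lemma smoothD j g h : smooth j g -> smooth j h -> smooth j (fun k => g k + h k).
Proof.
elim: j g h => [|j IH] g h /=; first by move=> Hg Hh k; apply: (vrD vO).
move=> [Og [g' sg' eg]] [Oh [h' sh' eh]]; split=> [k|]; first exact: (vrD vO).
exists (fun k => g' k + h' k); first exact: IH.
by move=> k; rewrite mulrDr -eg -eh /diff; ring.
Qed.

Lemma smoothM j g h : smooth j g -> smooth j h -> smooth j (fun k => g k * h k).
Proof.
elim: j g h => [|j IH] g h; first by move=> Hg Hh k; apply: (vrM vO).
move=> sg sh; have [g1 h1] := (smoothW sg, smoothW sh).
case: sg sh => [Og [g' sg' eg]] [Oh [h' sh' eh]]; split=> [k|]; first exact: (vrM vO).
exists (fun k => g k.+1 * h' k + g' k * h k).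
  by apply: smoothD; apply: IH => //; apply: smooth_shift.
move=> k; transitivity (g k.+1 * (z * h' k) + z * g' k * h k); last by ring.
by rewrite -eg -eh /diff; ring.
Qed.

Lemma smoothN j h : smooth j h -> smooth j (fun k => - h k).
Proof.
move=> sh; rewrite (_ : (fun k => _) = fun k => -1 * h k); last first.
  by apply/funext => k; rewrite mulN1r.
by apply: smoothM => //; apply: smooth_const; apply: (vrN vO); apply: (vrn vO 1).
Qed.

Lemma smoothX j h n : smooth j h -> smooth j (fun k => h k ^+ n).
Proof.
move=> sh; elim: n => [|n IH].
  by rewrite (_ : (fun k => _) = fun=> 1); [apply/smooth_const/(vrn vO 1)|apply/funext => k; rewrite expr0].
rewrite (_ : (fun k => _) = fun k => h k * h k ^+ n); first exact: smoothM.
by apply/funext => k; rewrite exprS.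
Qed.

Lemma smoothV j h : (forall k, h k != 0 /\ O (h k)^-1) -> smooth j h -> smooth j (fun k => (h k)^-1).
Proof.
move=> hu; elim: j => [|j IH] sh; first by move=> k; case: (hu k).
have sV := IH (smoothW sh); case: sh => [Oh [h' sh' eh]]; split=> [k|]; first by case: (hu k).
exists (fun k => - h' k * (h k)^-1 * (h k.+1)^-1).
  apply: smoothM; first by apply: smoothM => //; apply: smoothN.
  exact: (@smooth_shift _ (fun k => (h k)^-1)).
move=> k; have [[h0 _] [h1 _]] := (hu k, hu k.+1).
transitivity (- (z * h' k) * (h k)^-1 * (h k.+1)^-1); last by ring.
by rewrite -eh /diff; field; apply/andP.
Qed.

Lemma smooth_diff j h k : smooth j h -> exists2 o, O o & iter j diff h k = z ^+ j * o.
Proof.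
elim: j h k => [|j IH] h k sh; first by exists (h k); [apply: sh|rewrite expr0 mul1r].
case: sh => [_ [h' sh' e]]; have [o Oo oE] := IH h' k sh'; exists o => //.
by rewrite iterSr (iter_diffZ _ _ e) oE exprS mulrA.
Qed.

End Smooth.

Ltac smooth vO := first [eassumption
  | apply: (smooth_const vO); vr vO
  | lazymatch goal with
  | |- smooth _ _ _ (fun k => _ + _) => eapply (smoothD vO); smooth vO
  | |- smooth _ _ _ (fun k => - _) => eapply (smoothN vO); smooth vO
  | |- smooth _ _ _ (fun k => _ * _) => eapply (smoothM vO); smooth vO
  | |- smooth _ _ _ (fun k => _ ^+ _) => eapply (smoothX vO); smooth vO
  | _ => idtac
  end].

Section Nonsingular.
Variables (L : closedFieldType) (s : L) (M : zmodType) (X : M -> L) (O : L -> Prop).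
Hypotheses (kX : normal_kummer s X) (vO : valring O) (ms : vmax O s).
Local Notation tau := (tau X).
Local Notation U := (km_U (- 72%:R * s) (- 4%:R * s) (- s - 1296%:R * s ^+ 2)).

Let Os : O s := vmaxW vO ms.

(** The reduced curve has its node at [X = 0]; the condition says that [P] does not reduce to it. *)
Definition nonsingular P := tau_dom X P /\ O (tau P).

Lemma nonsingular_U t u : O t -> O u -> O (U t u) /\ U t u != 0 /\ O (U t u)^-1.
Proof.
move=> Ot Ou; have Osr : O s := Os; split; first by rewrite /km_U; vr vO.
apply: vr_unit.
rewrite (_ : U t u = 1 + s * (72%:R * t * u + 4%:R * t * u * (t + u) + (1 + 1296%:R * s) * t ^+ 2 * u ^+ 2)).
  by apply: (vmax1D vO); apply: (vmaxM vO) => //; vr vO.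
by rewrite /km_U; ring.
Qed.

Lemma nonsingular_addsub P Q : nonsingular P -> nonsingular Q ->
  nonsingular (P + Q) /\ nonsingular (P - Q).
Proof.
move=> [dP OP] [dQ OQ]; have [OU [U0 UV]] := nonsingular_U OP OQ; have Osr : O s := Os.
have [dS dD eS eP] := tau_addsub kX dP dQ U0.
have O1 : O (tau (P + Q) + tau (P - Q)).
  rewrite -[X in O X](mulfK U0) eS; apply: (vrM vO) => //; rewrite /km_V; vr vO.
have O2 : O (tau (P + Q) * tau (P - Q)).
  rewrite -[X in O X](mulfK U0) eP; apply: (vrM vO) => //; vr vO.
by split; split=> //; apply: (vr_quad vO O1 O2); ring.
Qed.

Lemma nonsingular0 : nonsingular 0.
Proof. by split; [exact: tau_dom0|rewrite tau0; apply: (vr0 vO)]. Qed.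

Lemma nonsingular_mulrn P n : nonsingular P -> nonsingular (P *+ n).
Proof.
move=> hP; elim: n => [|n IH]; first by rewrite mulr0n; apply: nonsingular0.
by rewrite mulrS; case: (nonsingular_addsub hP IH).
Qed.

Lemma not_nonsingular P : P != 0 -> ~ nonsingular P -> vmax O (X P).
Proof.
move=> P0 nP; have [->|X0] := eqVneq (X P) 0; first exact: vmax0.
right => h; apply: nP; split; first by rewrite /tau_dom X0 orbT.
by rewrite (tauE _ P0).
Qed.

Variable p : nat.
Hypothesis pL : p \in [pchar L].

(** In characteristic 2, [km_psi] is the square of [X]. *)
Lemma nonsingular_order2 P : p = 2%N -> P != 0 -> P *+ p = 0 -> X P = 0.
Proof.
move=> p2 P0; rewrite p2 mulr2n => P2; case: kX => _ _ _ _ /(_ _ P0).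
rewrite P2 eqxx /km_psi.
have z2 : 2%:R = 0 :> L by apply: (pcharf0 (_ : 2%N \in _)); rewrite -p2.
have -> : 4%:R = 0 :> L by rewrite (natrM _ 2 2) z2 mul0r.
by rewrite z2 !(mulNr, oppr0, mul0r, addr0, add0r) mul1r => /eqP; rewrite expf_eq0 => /eqP.
Qed.

(* Modulo [s] the curve is nodal and [tau (k P) = u ^ k + u ^ - k - 2] =: x k has second
   difference [t (x k + 2)], [t = tau P]. So the [2 p]-th difference is [t ^ p] times a unit;
   but in characteristic [p] it is [x (2 p) - 2 x p + x 0 = 0]. *)
Lemma nonsingular_order_p P : 2%:R != 0 :> L -> nonsingular P -> P *+ p = 0 -> P = 0.
Proof.
move=> n2 hP pP; apply: contrapT => /eqP P0; have hk k := nonsingular_mulrn k hP.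
pose x k := tau (P *+ k); pose t := tau P; have [dP Ot] := hP; rewrite -/t in Ot.
have Ox k : O (x k) by case: (hk k).
have dx k : tau_dom X (P *+ k) by case: (hk k).
have x0 : x 0%N = 0 by rewrite /x mulr0n tau0.
(* First differences are divisible only by a square root of [t]: the square of [diff x k] is [t]
   times [tau] of the multiple [2 k + 1], up to a unit. *)
have [z zt] := closed_field_root t (isT : (0 < 2)%N).
have t0 : t != 0 by apply: contra_neq P0; apply: tau_eq0.
have z0 : z != 0 by apply: contraNneq t0 => z0; rewrite -zt z0 expr0n.
have Oz : O z by apply: (@vr_root _ _ vO 2) => //; rewrite zt.
have Osr : O s := Os.
pose u k := U (x k) t.
(* [t * s * n k] is the deviation of the second difference, multiplied by [u k], from its form on
   the nodal curve. *)
pose n k := - 72%:R * x k * (x k + t) - 4%:R * x k ^+ 2 * t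
  - 144%:R * x k ^+ 2 - 8%:R * x k ^+ 2 * (t + x k) - 2%:R * (1 + 1296%:R * s) * t * x k ^+ 3
  - (72%:R * t * x k + 4%:R * t * x k * (t + x k) + (1 + 1296%:R * s) * t ^+ 2 * x k ^+ 2) * (2%:R + x k).
pose r k := n k * (u k)^-1.
have u1 k : u k != 0 /\ O (u k)^-1 by case: (nonsingular_U (Ox k) Ot).
have d2 k : diff (diff x) k = t * (x k.+1 + 2%:R + s * r k.+1).
  have [u0 _] := u1 k.+1; have [_ _ eS _] := tau_addsub kX (dx k.+1) dP u0.
  rewrite -mulrSr [P *+ k.+1 - P](_ : _ = P *+ k) in eS; last by rewrite mulrSr addrK.
  rewrite -/(x _) -/(x _) -/(x _) -/t -/(u _) in eS.
  apply: (mulIf u0); transitivity ((x k.+2 + x k) * u k.+1 - 2%:R * x k.+1 * u k.+1).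
    by rewrite /diff; ring.
  transitivity (t * (x k.+1 + 2%:R) * u k.+1 + t * s * n k.+1); last by rewrite /r; field.
  by rewrite eS /n /u /km_U /km_V; ring.
have rx j : smooth O z j x -> smooth O z j r.
  move=> sx; have su : smooth O z j u by rewrite /u /km_U; smooth vO.
  have suV : smooth O z j (fun k => (u k)^-1) by apply: smoothV.
  by rewrite /r /n; smooth vO.
(* Bootstrapping: smoothness of order [j] passes from [x] to [r], and the second difference formula
   then raises the order of [x] to [j + 2]. *)
have sx j : smooth O z j x.
  suff [] : smooth O z j x /\ smooth O z j.+1 x by [].
  elim: j => [|j [IH0 IH1]].
    split=> //; split=> //.
    have h k : exists2 o, O o & diff x k = z * o.
      have [OU [U0 _]] := nonsingular_U (Ox k.+1) (Ox k).
      have [_ _ _ eP] := tau_addsub kX (dx k.+1) (dx k) U0.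
      rewrite -mulrnBr // subSnn mulr1n -mulrnDr -/(x _) -/(x _) -/(x _) -/t in eP.
      exists (diff x k / z); last by rewrite mulrC divfK.
      apply: (@vr_root _ _ vO 2) => //; rewrite expr_div_n /diff -eP zt.
      rewrite mulrAC mulfK; last by rewrite -zt expf_neq0.
      by apply: (vrM vO) => //; apply: Ox.
    by exists (fun k => sval (cid2 (h k))) => [k|k]; case: cid2.
  split=> //; case: IH1 => _ [h' sh' eh]; split=> //; exists h' => //; split.
    by move=> k; apply: smoothO sh'.
  have sr := rx _ IH0.
  exists (fun k => x k.+1 + 2%:R + s * r k.+1).
    have sx1 := smooth_shift IH0; have sr1 := smooth_shift sr; smooth vO.
  move=> k; apply: (mulfI z0); have := d2 k; rewrite /diff -/(diff x _) -/(diff x _) !eh -zt => e.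
  by rewrite /diff mulrBr e; ring.
(* Two more differences extract one more factor [t]. The error term keeps pace, since differences of
   [r] of order [2 i] are divisible by [z ^+ (2 i)], that is by [t ^+ i]. *)
have d2j j k : exists2 o, O o & iter j.+1.*2 diff x k = t ^+ j.+1 * (x (k + j.+1)%N + 2%:R + s * o).
  have sr i : smooth O z i r by apply: rx.
  elim: j k => [|j IH] k.
    exists (r k.+1); last by rewrite expr1 addn1 -d2.
    exact: (smoothO _ (sr 0%N)).
  have [o Oo oE] := IH k.+1; have [o' Oo' oE'] := smooth_diff k.+1 (sr j.+1.*2).
  exists (o + o'); first exact: (vrD vO).
  rewrite doubleS iterSr iterSr (iter_diffZ _ _ d2).
  rewrite (@iter_diffD _ _ (fun i => x i.+1 + 2%:R) (fun i => s * r i.+1)) //.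
  rewrite (@iter_diffD _ _ (fun i => x i.+1) (fun=> 2%:R)) // (iter_diff_shift x) iter_diff_const.
  rewrite (@iter_diffZ _ s (fun i => s * r i.+1) (fun i => r i.+1)) // (iter_diff_shift r) oE oE' addr0.
  rewrite -mul2n exprM zt addSn -addnS.
  by rewrite [t ^+ j.+2]exprS; ring.
have p1 : (0 < p)%N := prime_gt0 (pcharf_prime pL).
have [o Oo] := d2j p.-1 0%N; have mso : vmax O (s * o) by apply: (vmaxM vO).
rewrite prednK // add0n.
rewrite -addnn iterD iter_diff_pchar // add0n !iter_diff_pchar //.
have -> : x p = 0 by rewrite /x pP tau0.
have -> : x (p + p)%N = 0 by rewrite /x mulrnDr pP addr0 tau0.
rewrite x0 !subrr add0r => /esym/eqP; rewrite mulf_eq0 expf_eq0 (negPf t0) andbF /=.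
rewrite addr_eq0 => /eqP e; have : vmax O 2%:R by rewrite e; apply: (vmaxN vO).
exact: (vr_natU pL vO).

Qed.
End Nonsingular.

Section PTorsion.
Variables (L : closedFieldType) (s : L) (M : zmodType) (X : M -> L) (p : nat).
Hypotheses (kX : normal_kummer s X) (pL : p \in [pchar L]).

(** Multiples of a nonsingular point are nonsingular, so some multiple would be a nonsingular point
    of exact order [p]. *)
Lemma ptorsion_vmax O P a : valring O -> vmax O s -> P != 0 -> P *+ p ^ a = 0 -> vmax O (X P).
Proof.
move=> vO ms P0 aP; apply: (not_nonsingular P0) => nsP.
have [b [bP bP1]] : exists b, P *+ p ^ b != 0 /\ P *+ p ^ b.+1 = 0.
  elim: a aP => [|a IH] aP; first by move: P0; rewrite -[P]mulr1n aP eqxx.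
  have [/IH //|ne] := eqVneq (P *+ p ^ a) 0; by exists a.
have nsR := nonsingular_mulrn kX vO ms (p ^ b) nsP.
have pR : P *+ p ^ b *+ p = 0 by rewrite -mulrnA -expnSr.
have [p2|p2] := eqVneq p 2%N; last first.
  apply/negP: bP; rewrite negbK; apply/eqP; apply: (nonsingular_order_p kX vO ms pL) pR => //.
  by rewrite -(dvdn_pcharf pL) dvdn_prime2 // (pcharf_prime pL).
have := nonsingular_order2 kX pL p2 bP pR; case: nsR; rewrite /tau_dom (negPf bP) /=.
by move=> X0 _ /eqP; rewrite (negPf X0).
Qed.

Variable w : L -> rat.
Hypotheses (hw : is_val w) (s0 : s != 0) (ws : w s = 1).

Lemma val_sqr_lt u d c : u * d ^+ 2 = c -> c != 0 -> d != 0 -> vgt w u 0 -> w d *+ 2 < w c.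
Proof.
move=> <- c0 d0 hu; have u0 : u != 0 by apply: contraNneq c0 => ->; rewrite mul0r.
rewrite (valM hw) ?expf_neq0 // (valX hw) // ltrDr.
by case: hu => // /eqP; rewrite (negPf u0).
Qed.

Lemma ptorsion_vgt P a : P != 0 -> P *+ p ^ a = 0 -> vgt w (X P) 0.
Proof.
move=> P0 aP; apply/(vmax_val hw); apply: ptorsion_vmax P0 aP; first exact: valring_val.
by apply/(vmax_val hw); right; rewrite ws.
Qed.

(** The argument of [local_min] becomes strict: [X (P + Q)] and [X (P - Q)] now lie in the maximal
    ideal, so the difference would have valuation below the common cap. *)
Lemma ptorsion_cap_inj P Q a : P != 0 -> Q != 0 -> P *+ p ^ a = 0 -> Q *+ p ^ a = 0 ->
  cap w (X P) = cap w (X Q) -> X P = X Q.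
Proof.
move=> P0 Q0 nP nQ ee; apply/eqP; apply: contraT => ne; exfalso.
have sV : vge w s 1 by right; rewrite ws.
have [_ hN _ hS _] := kX; have [eS eP] := hS _ _ P0 Q0 ne.
have s3 : P + Q != 0 by rewrite addr_eq0; apply: contraNneq ne => ->; rewrite hN.
have s4 : P - Q != 0 by rewrite subr_eq0; apply: contraNneq ne => ->.
have O3 : vgt w (X (P + Q)) 0 by apply: (@ptorsion_vgt _ a); rewrite // mulrnDl nP nQ addr0.
have O4 : vgt w (X (P - Q)) 0 by apply: (@ptorsion_vgt _ a); rewrite // mulrnBl nP nQ subr0.
have OP := ptorsion_vgt P0 nP; have OQ := ptorsion_vgt Q0 nQ.
have O34 : vgt w (X (P + Q) + X (P - Q)) 0 by apply: (vgtD hw).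
have O34' : vgt w (X (P + Q) * X (P - Q)) 0.
  case: O3 => [->|O3]; first by left; rewrite mul0r.
  by have := vgeM hw (vge_self w (X (P + Q))) (vgt_vge O4); rewrite addr0 => h; apply: vge_vgt h O3.
have d0 : X P - X Q != 0 by rewrite subr_eq0.
have cpos x : vgt w x 0 -> 0 < cap w x.
  by rewrite /cap; case: eqP => // /eqP x0 [/eqP|h]; [rewrite (negPf x0)|rewrite lt_min h].
move: (cpos _ OP) (cap_vge w (X P)) (cap_vge w (X Q)) (cap_le w (X P))
  (@cap_lt _ w (X P)) (@cap_lt _ w (X Q)) eS eP ne d0.
rewrite -ee; clear cpos ee OP OQ; set x := X P; set y := X Q; set c := cap w x.
move=> c0 xc yc c2 xl yl eS eP ne d0.
have dc : c <= w (x - y).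
  have : vge w (x - y) c by apply: (vgeD hw) => //; apply: (vgeN hw).
  by case=> // /eqP; rewrite (negPf d0).
have [lt|ge] := ltP c 2%:R^-1; last first.
  have [k0 wk] := km_P_large hw s0 ws (vgeW xc ge) (vgeW yc ge).
  have := val_sqr_lt eP k0 d0 O34'; rewrite wk mulr2n => h.
  by move: h dc ge; move: (w (x - y)) => t; lra.
have [x0 wx] := xl lt; have [y0 wy] := yl lt.
have wxy : w (x * y) = c + c by rewrite (valM hw) // wx wy.
have [k0 wk] : km_S 1 (- 72%:R * s) (- 4%:R * s) x y != 0 /\
    w (km_S 1 (- 72%:R * s) (- 4%:R * s) x y) = c + c.
  have -> : km_S 1 (- 72%:R * s) (- 4%:R * s) x y =
    x * y + (2%:R * x * y * x + 2%:R * x * y * y - (72%:R * s * x + 72%:R * s * y) - 4%:R * s).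
    by rewrite /km_S; ring.
  rewrite -wxy; apply: (val_dom hw); first by rewrite mulf_neq0.
  by rewrite wxy; clear O3 O4 O34 O34'; vgts hw.
have := val_sqr_lt eS k0 d0 O34; rewrite wk mulr2n => h.
by move: h dc; move: (w (x - y)) => t; lra.
Qed.

End PTorsion.

(** * Averages over conjugate places *)

Lemma closure_trans (B1 B2 L : fieldType) (C : closedFieldType)
  (i1 : {rmorphism B1 -> L}) (i : {rmorphism L -> C}) (i2 : {rmorphism B2 -> C}) :
  (forall a, integralOver i1 a) -> (forall b, integralOver i2 (i (i1 b))) ->
  is_algebraic_closure i -> is_algebraic_closure i2.
Proof.
move=> h1 h2 h x; have [P [P0 Px]] := h x.
have iI a : integralOver i2 (i a).
  have [Q Qm Qa] := h1 a.
  apply: (@integral_root _ _ i2 (map_poly i (map_poly i1 Q))).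
  - by rewrite !map_poly_eq0 monic_neq0.
  - by rewrite fmorph_root.
  - by apply/integral_poly => l; rewrite coef_map (coef_map i1); apply: h2.
have : integralOver i2 x.
  apply: (@integral_root _ _ i2 (map_poly i P)) => //.
  - by rewrite map_poly_eq0.
  - by apply/integral_poly => l; rewrite coef_map; apply: iI.
by move=> [Q Qm Qx]; exists Q; rewrite monic_neq0.
Qed.

Lemma ratsub_integral (k F C : fieldType) (f : {rmorphism k -> F}) (z : F)
   (B : fieldType) (i : {rmorphism F -> C}) (i2 : {rmorphism B -> C}) :
  (forall c, integralOver i2 (i (f c))) -> integralOver i2 (i z) ->
  forall b, integralOver i2 (i (ratinj f z b)).
Proof.
move=> hc hz b; have : ratinj f z b \in ratsub f z := ratsub_ratinj b.
move: (ratinj f z b); apply: (@ratsub_gen _ _ f z (fun x => integralOver i2 (i x))) => //.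
- by move=> x y; rewrite rmorphB; apply: integral_sub.
- by move=> x y; rewrite rmorphM; apply: integral_mul.
- by move=> x; rewrite fmorphV; apply: integral_inv.
Qed.

Lemma rmorph_km_psi (K L : fieldType) (e : {rmorphism K -> L}) b2 b4 b6 x :
  e (km_psi b2 b4 b6 x) = km_psi (e b2) (e b4) (e b6) (e x).
Proof. by rewrite /km_psi !rmorphD !rmorphM ?rmorphXn !rmorph_nat. Qed.

(** Composition with an automorphism injects the class of any other restriction to [S0] into that of
    [e], and there are at most [d] classes. *)
Lemma restriction_class (B : fieldType) (L : closedFieldType) (i : {rmorphism B -> L})
    (S0 S : seq L) d N (sg0 : 'I_d -> {rmorphism L -> L}) (sg : 'I_N -> {rmorphism L -> L}) e :
  is_algebraic_closure i -> {subset S0 <= S} -> (forall a, fixes i (sg0 a)) ->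
  (forall e, fixes i e -> exists a, {in S0, sg0 a =1 e}) ->
  (forall l, fixes i (sg l)) -> (forall e, fixes i e -> exists l, {in S, sg l =1 e}) ->
  (forall l l', {in S, sg l =1 sg l'} -> l = l') -> fixes i e ->
  (N <= d * #|[set l | `[< {in S0, sg l =1 e} >]]|)%N.
Proof.
move=> alg sub sg0F sg0T sgF sgT sgI eF; set C := [set l | _].
pose a l := sval (cid (sg0T _ (sgF l))).
have aP l : {in S0, sg0 (a l) =1 sg l} := svalP (cid (sg0T _ (sgF l))).
have cl b : (\sum_(l | a l == b) 1 <= #|C|)%N.
  have [r [rF r0 _]] := fixes_inv alg (sg0F b).
  pose g l : {rmorphism L -> L} := e \o (r \o sg l).
  have gF l : fixes i (g l) by apply: fixes_comp => //; apply: fixes_comp.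
  pose u l := sval (cid (sgT _ (gF l))).
  have uP l : {in S, sg (u l) =1 g l} := svalP (cid (sgT _ (gF l))).
  have uI : injective u.
    move=> l l' ll; apply: sgI => x xS; apply: (fmorph_inj (e \o r)) => /=.
    by rewrite -[LHS](uP l x xS) -[RHS](uP l' x xS) ll.
  rewrite sum1dep_card -(card_imset _ uI); apply: subset_leq_card.
  apply/fintype.subsetP => y /imsetP[l]; rewrite inE => /eqP lb ->; rewrite inE; apply/asboolP => x xS.
  by rewrite uP ?sub //= -(aP l x xS) lb r0.
have e1 : N = (\sum_(b < d) \sum_(l | a l == b) 1)%N.
  by rewrite -{1}(card_ord N) -sum1_card (partition_big a xpredT).
rewrite {1}e1 -[X in (_ <= X * _)%N]card_ord -sum_nat_const.
by apply: leq_sum => b _; exact: cl.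
Qed.

Lemma is_val_comp (K L : fieldType) (w : L -> rat) (e : {rmorphism K -> L}) :
  is_val w -> is_val (w \o e).
Proof.
case=> h1 h2; split=> x y x0 y0 /=; first by rewrite rmorphM h1 ?fmorph_eq0.
by move=> xy; rewrite rmorphD h2 -?rmorphD ?fmorph_eq0.
Qed.

Lemma bounded_finite (T : eqType) (A : T -> Prop) n :
  (forall r, uniq r -> (forall x, x \in r -> A x) -> (size r <= n)%N) ->
  exists r : seq T, forall x, A x -> x \in r.
Proof.
move=> hA; suff h m r : uniq r -> (forall x, x \in r -> A x) -> (n <= size r + m)%N ->
    exists r : seq T, forall x, A x -> x \in r by apply: (h n [::]).
elim: m r => [|m IH] r ur rA nr.
  exists r => x Ax; apply: contraT => xr.
  have := hA (x :: r); rewrite /= xr ur ltnNge -(addn0 (size r)) nr => /(_ isT).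
  by apply => y; rewrite in_cons => /orP[/eqP ->|/rA].
have [h|/existsNP[x /not_implyP[Ax /negP xr]]] := pselect (forall x, A x -> x \in r).
  by exists r.
apply: (IH (x :: r)); rewrite /= ?xr ?ur ?addSn -?addnS //.
by move=> y; rewrite in_cons => /orP[/eqP ->|/rA].
Qed.

Section Core.
Variables (k : finFieldType) (F : fieldType) (L : closedFieldType).
Variables (iota : {rmorphism F -> L}) (f0 : {rmorphism k -> F}) (t j s : F) (bs : seq F).
Hypothesis algL : is_algebraic_closure iota.
Hypothesis trj : forall P : {poly k}, (map_poly f0 P).[j] = 0 -> P = 0.
Hypothesis spanF : forall y : F, exists c : nat -> ratfield f0 t,
  y = \sum_(l < size bs) ratinj f0 t (c l) * bs`_l.
Hypotheses (s0 : s != 0) (s1728 : 1 + 1728%:R * s != 0) (sj : s^-1 + 1728%:R = j).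
Variables (p : nat) (pL : p \in [pchar L]).
Variables (M : zmodType) (X : M -> L).

Definition const : {rmorphism k -> L} := iota \o f0.
Local Notation f := const.
Local Notation jL := (iota j).
Local Notation sL := (iota s).
Hypothesis kX : normal_kummer sL X.

Lemma map_const P x : (map_poly f P).[iota x] = iota (map_poly f0 P).[x].
Proof. by rewrite /const map_poly_comp horner_map. Qed.

Lemma iota_ratsub x z : x \in ratsub f0 z -> iota x \in ratsub f (iota z).
Proof.
move=> /ratsubP[P [Q [Q0 ->]]]; apply/ratsubP; exists P, Q.
by rewrite !map_const fmorph_eq0 fmorph_div.
Qed.

Lemma trjL P : (map_poly f P).[jL] = 0 -> P = 0.
Proof. by rewrite map_const => /eqP; rewrite fmorph_eq0 => /eqP/trj. Qed.

Lemma j_in_s : j \in ratsub f0 s.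
Proof.
rewrite -sj rpredD ?rpredV ?rpred_nat //.
by have := ratsub_poly f0 s 'X; rewrite map_polyX hornerX.
Qed.

Lemma s_in_j : s \in ratsub f0 j.
Proof.
rewrite (_ : s = (j - 1728%:R)^-1); last by rewrite -sj addrK invrK.
rewrite rpredV rpredB ?rpred_nat //.
by have := ratsub_poly f0 j 'X; rewrite map_polyX hornerX.
Qed.

Lemma ratsub_const z c : f c \in ratsub f z.
Proof. by have := ratsub_poly f z c%:P; rewrite map_polyC hornerC. Qed.

Lemma ratsub_integralOver z x : x \in ratsub f z -> integralOver (ratinj f z) x.
Proof. by move=> /ratinj_in[b ->]; apply: integral_id. Qed.

Lemma algj : is_algebraic_closure (ratinj f jL).
Proof.
apply: (@closure_trans _ _ _ _ (ratinj f0 j) iota (ratinj f jL)) => //.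
  move=> a; have [P [P0 Pa]] := F_algebraic trj spanF a.
  by apply/integral_algebraic; exists P.
by move=> b; apply/ratsub_integralOver/iota_ratsub/ratsub_ratinj.
Qed.

Lemma algs : is_algebraic_closure (ratinj f sL).
Proof.
apply: (@closure_trans _ _ _ _ (ratinj f0 j) iota (ratinj f sL)) => //.
  move=> a; have [P [P0 Pa]] := F_algebraic trj spanF a.
  by apply/integral_algebraic; exists P.
apply: ratsub_integral => [c|]; first exact/ratsub_integralOver/ratsub_const.
exact/ratsub_integralOver/iota_ratsub/j_in_s.
Qed.

Lemma trsL P : (map_poly f P).[sL] = 0 -> P = 0.
Proof.
move=> Ps; apply: contrapT => /eqP P0.
have sI : integralOver f sL.
  by apply/integral_algebraic; exists P => //; apply/rootP.
have [Q Qm /rootP/trjL Q0] : integralOver f jL.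
  rewrite -sj rmorphD fmorphV rmorph_nat; apply: integral_add; first exact: integral_inv.
  exact: integral_nat.
by move: (monic_neq0 Qm); rewrite Q0 eqxx.
Qed.

Local Notation fixes_j := (fixes (ratinj f jL)).

Lemma fixes_jP (e : {rmorphism L -> L}) x : fixes_j e -> x \in ratsub f jL -> e x = x.
Proof. by move=> ej /ratinj_in[b ->]. Qed.

Lemma fixes_js e : fixes_j e -> e sL = sL.
Proof. by move=> ej; apply: fixes_jP => //; apply/iota_ratsub/s_in_j. Qed.

(** Automorphisms over [F] act on points, because the curve and the coordinate [X] are defined over
    [F]; this is not asked of those over [k(j)]. *)
Hypothesis conj_pt : forall e, fixes iota e -> exists g : M -> M,
  {morph g : P Q / P + Q} /\ forall P, P != 0 -> g P != 0 /\ X (g P) = e (X P).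

Section Valued.
Variable w : L -> rat.
Hypotheses (hw : is_val w) (ws : w sL = 1).

Lemma val_comp_s e : fixes_j e -> (w \o e) sL = 1.
Proof. by move=> ej; rewrite /= fixes_js. Qed.

Lemma val_nat (v : L -> rat) n : is_val v -> n%:R != 0 :> L -> ~ vmax (fun x => vge v x 0) n%:R.
Proof. by move=> hv n0; apply: (vr_natU pL (valring_val hv)). Qed.

Lemma val_disc (v : L -> rat) : is_val v -> v sL = 1 -> v (sL * (1 + 1728%:R * sL) ^+ 2) = 1.
Proof.
move=> hv vs; have sL0 : sL != 0 by rewrite fmorph_eq0.
have u0 : 1 + 1728%:R * sL != 0 by rewrite -(rmorph_nat iota) -rmorphM -(rmorph1 iota) -rmorphD fmorph_eq0.
have vsV : vge v sL 1 by right; rewrite vs.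
have [_ v1] : 1 + 1728%:R * sL != 0 /\ v (1 + 1728%:R * sL) = v 1.
  apply: (val_dom hv); first exact: oner_neq0.
  by rewrite (val1 hv); vgts hv.
by rewrite (valM hv) ?expf_neq0 // (valX hv) // v1 (val1 hv) mul0rn addr0.
Qed.

Definition prime_torsion (P : M) := exists2 n, n%:R != 0 :> L & P *+ n = 0.

Section Average.
Variables (S : seq L) (N : nat) (sg : 'I_N -> {rmorphism L -> L}).
Hypothesis sgF : forall i, fixes_j (sg i).
Hypothesis sgT : forall e, fixes_j e -> exists i, {in S, sg i =1 e}.
Hypothesis sgI : forall i i', {in S, sg i =1 sg i'} -> i = i'.

Definition height P i := cap w (sg i (X P)).

Lemma capE P i : height P i = cap (w \o sg i) (X P).
Proof. by rewrite /height /cap fmorph_eq0. Qed.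

Lemma height01 P i : P != 0 -> prime_torsion P -> 0 <= height P i <= 2%:R^-1.
Proof.
move=> P0 [n n0 nP]; have hv := is_val_comp (sg i) hw; have sL0 : sL != 0 by rewrite fmorph_eq0.
rewrite capE cap_le andbT; apply: cap_ge0.
exact: (torsion_vge hv (val_comp_s (sgF i)) kX (val_nat hv n0) P0 nP).
Qed.

Let sL0 : sL != 0. Proof. by rewrite fmorph_eq0. Qed.
Let u0 : 1 + 1728%:R * sL != 0.
Proof. by rewrite -(rmorph_nat iota) -rmorphM -(rmorph1 iota) -rmorphD fmorph_eq0. Qed.
Let D := sL * (1 + 1728%:R * sL) ^+ 2.
Let D0 : D != 0. Proof. by rewrite mulf_neq0 ?expf_neq0. Qed.

Let fixes_D e : fixes_j e -> e D = D.
Proof.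
by move=> ej; rewrite /D rmorphM rmorphXn rmorphD rmorphM rmorph1 rmorph_nat (fixes_js ej).
Qed.

(** [D] has valuation 1 at every conjugate of [w], so the product formula for [x ^+ n / D] gives [x]
    the mean valuation [1 / n]. *)
Lemma sum_unit x n : x != 0 -> determined f jL S x -> unit_above jL (x ^+ n / D) ->
  \sum_i n%:R * w (sg i x) = N%:R.
Proof.
move=> x0 dx ue; have e0 : x ^+ n / D != 0 by rewrite mulf_neq0 ?expf_neq0 ?invr_eq0.
have de : determined f jL S (x ^+ n / D).
  move=> e1 e2 e1F e2F ee; rewrite !fmorph_div !rmorphXn (dx e1 e2) //.
  by rewrite !fixes_D.
have := product_formula trjL algj hw sgF sgT sgI e0 de ue.
have -> : \sum_i w (sg i (x ^+ n / D)) = \sum_i n%:R * w (sg i x) - N%:R.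
  rewrite -[X in _ - X%:R]card_ord -sumr_const -sumrB; apply: eq_bigr => i _.
  have hv := is_val_comp (sg i) hw; have := val_disc hv (val_comp_s (sgF i)); rewrite -/D => vD.
  rewrite -[w (sg i _)]/((w \o sg i) _) (valM hv) ?expf_neq0 ?invr_eq0 // (valV hv) // vD.
  by rewrite (valX hv) // mulr_natl.
by move/eqP; rewrite subr_eq0 => /eqP.
Qed.

Lemma average_min P Q : P != 0 -> Q != 0 -> prime_torsion P -> prime_torsion Q ->
  X P != X Q -> X P \in S -> X Q \in S ->
  \sum_i Num.min (height P i) (height Q i) = N%:R / 6%:R.
Proof.
move=> P0 Q0 [n n0 nP] [n' n'0 nQ] ne PS QS.
have nn0 : (n * n')%:R != 0 :> L by rewrite natrM mulf_neq0.
have nnP : P *+ (n * n') = 0 by rewrite mulrnA nP mul0rn.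
have nnQ : Q *+ (n * n') = 0 by rewrite mulnC mulrnA nQ mul0rn.
have d0 : X P - X Q != 0 by rewrite subr_eq0.
have : 6%:R * \sum_i Num.min (height P i) (height Q i) = N%:R; last first.
  by move=> <-; rewrite mulrAC divff ?mul1r.
rewrite mulr_sumr -[RHS](@sum_unit (X P - X Q) 6) //.
- apply: eq_bigr => i _; have hv := is_val_comp (sg i) hw; rewrite !capE.
  by rewrite -(local_min hv sL0 (val_comp_s (sgF i)) kX (val_nat hv nn0) P0 Q0 nnP nnQ ne).
- by move=> e1 e2 e1F e2F ee; rewrite !rmorphB !ee.
- move=> O vO Oj; apply: (good_units pL vO sL0 u0 _ kX nn0 P0 Q0 nnP nnQ ne).
  by rewrite -fmorphV -(rmorph_nat iota) -rmorphD sj.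
Qed.

(** The unit is [km_psi^2 / D] and [km_psi] has valuation twice the height, whence the mean height
    1/4. *)
Lemma average_dbl P : P != 0 -> P + P != 0 -> prime_torsion P -> X P \in S ->
  \sum_i height P i = N%:R / 4%:R /\
  \sum_i qf (height (P + P) i) = 4%:R * (\sum_i qf (height P i)) - N%:R / 2%:R.
Proof.
move=> P0 P2 [n n0 nP] PS.
have loc i : w (sg i (km_psi 1 (- 72%:R * sL) (- 4%:R * sL) (X P))) = 2%:R * height P i /\
    qf (height (P + P) i) = 4%:R * qf (height P i) - 2%:R * height P i.
  have hv := is_val_comp (sg i) hw; rewrite /qf !capE.
  have [h1 h2] := local_dbl hv sL0 (val_comp_s (sgF i)) kX (val_nat hv n0) P0 P2 nP.
  by split=> //; rewrite h2; ring.
have psi0 : km_psi 1 (- 72%:R * sL) (- 4%:R * sL) (X P) != 0.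
  by have [_ _ _ _ /(_ _ P0)] := kX; rewrite (negPf P2) => -[].
have sumE : \sum_i height P i = N%:R / 4%:R.
  have : 4%:R * \sum_i height P i = N%:R; last first.
    by move=> <-; rewrite mulrAC divff ?mul1r.
  rewrite mulr_sumr -[RHS](@sum_unit (km_psi 1 (- 72%:R * sL) (- 4%:R * sL) (X P)) 2) //.
  - by apply: eq_bigr => i _; rewrite (loc i).1 mulrA -natrM.
  - have h e : fixes_j e -> e (km_psi 1 (- 72%:R * sL) (- 4%:R * sL) (X P)) =
      km_psi 1 (- 72%:R * sL) (- 4%:R * sL) (e (X P)).
      move=> ej; rewrite rmorph_km_psi; congr (km_psi _ _ _ _); first exact: rmorph1.
        by rewrite rmorphM rmorphN rmorph_nat (fixes_js ej).
      by rewrite rmorphM rmorphN rmorph_nat (fixes_js ej).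
    by move=> e1 e2 e1F e2F ee; rewrite !h // ee.
  - move=> O vO Oj; apply: (good_psi_units pL vO sL0 u0 _ kX n0 P0 P2 nP).
    by rewrite -fmorphV -(rmorph_nat iota) -rmorphD sj.
split=> //; under eq_bigr do rewrite (loc _).2.
by rewrite sumrB -!mulr_sumr sumE; field.
Qed.

(** If the mean of [qf] falls short of 1/6 by [e], doubling makes it fall short by [4 e]. After [m]
    doublings the mean is still nonnegative, so [4^m e <= 1/6]. *)
Lemma average_lower m P : P != 0 -> P *+ (2 ^ m) != 0 -> prime_torsion P ->
  (forall l, (l <= m)%N -> X (P *+ (2 ^ l)) \in S) ->
  N%:R * (6%:R^-1 - (6%:R * 4%:R ^+ m)^-1) <= \sum_i qf (height P i).
Proof.
elim: m P => [|m IH] P P0 mP tP PS.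
  rewrite expr0 mulr1 subrr mulr0; apply: sumr_ge0 => i _.
  have := height01 i P0 tP; rewrite /qf; move: (height P i) => x /andP[x0 x2].
  by rewrite subr_ge0 expr2 ler_piMl //; lra.
have P2 : P + P != 0.
  by apply: contraNneq mP => h; rewrite expnS mulrnA mulr2n h mul0rn.
have [_ e] := average_dbl P0 P2 tP (PS 0%N (leq0n _)).
have := IH (P + P); rewrite e -mulr2n -mulrnA -expnS => /(_ _ mP); rewrite mulr2n => /(_ P2) h.
have {h} : N%:R * (6%:R^-1 - (6%:R * 4%:R ^+ m)^-1) <= 4%:R * (\sum_i qf (height P i)) - N%:R / 2%:R.
  apply: h.
    by case: tP => n n0 nP; exists n => //; rewrite mulrnDl nP addr0.
  by move=> l lm; rewrite -mulr2n -mulrnA -expnS; apply: PS.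
rewrite exprS; have : (4%:R ^+ m : rat) != 0 by rewrite expf_neq0.
move: (\sum_i _) (N%:R : rat) (4%:R ^+ m) => q n x x0.
rewrite (_ : (6%:R * (4%:R * x))^-1 = (6%:R * x)^-1 / 4%:R); last by field.
by move: ((6%:R * x)^-1) => y; lra.
Qed.

End Average.

Lemma agree_on_base (e e' : {rmorphism L -> L}) : fixes_j e -> fixes_j e' ->
  {in iota t :: map iota bs, e =1 e'} -> forall a, e (iota a) = e' (iota a).
Proof.
move=> ej e'j ee a; have [c ->] := spanF a.
have h x : x \in ratsub f0 t -> e (iota x) = e' (iota x).
  apply: (@ratsub_gen _ _ f0 t (fun x => e (iota x) = e' (iota x))).
  - by move=> b; rewrite -[iota (f0 b)]/(f b) !fixes_jP ?ratsub_const.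
  - by apply: ee; rewrite mem_head.
  - by move=> x1 x2 h1 h2; rewrite !rmorphB h1 h2.
  - by move=> x1 x2 h1 h2; rewrite !rmorphM h1 h2.
  - by move=> x1 h1; rewrite !fmorphV h1.
rewrite !rmorph_sum; apply: eq_bigr => l _; rewrite !rmorphM h ?ratsub_ratinj //.
by congr (_ * _); apply: ee; rewrite in_cons map_f ?orbT // mem_nth.
Qed.

Lemma morph_add_mulrn (g : M -> M) P n : {morph g : P Q / P + Q} -> g (P *+ n) = g P *+ n.
Proof.
move=> gD; have g0 : g 0 = 0 by apply: (addrI (g 0)); rewrite -gD !addr0.
by elim: n => [|n IH]; rewrite ?mulr0n // !mulrS gD IH.
Qed.

Lemma conj_torsion e P m : fixes iota e -> P != 0 -> prime_torsion P -> P *+ m != 0 ->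
  exists Q, [/\ Q != 0, prime_torsion Q, Q *+ m != 0 & X Q = e (X P)].
Proof.
move=> /conj_pt[g [gD gX]] P0 [n n0 nP] mP; have [gP0 gPX] := gX _ P0.
exists (g P); split=> //.
  exists n => //; rewrite -morph_add_mulrn // nP.
  by apply: (addrI (g 0)); rewrite -gD !addr0.
by rewrite -morph_add_mulrn //; case: (gX _ mP).
Qed.

Definition doublings m n (pt : 'I_n -> M) : seq L :=
  [seq X (pt c.1 *+ 2 ^ (c.2 : 'I_m.+1)) | c <- enum (('I_n * 'I_m.+1)%type : finType)].

Lemma doublings_mem m n (pt : 'I_n -> M) l i : (i <= m)%N ->
  X (pt l *+ 2 ^ i) \in doublings m pt.
Proof.
rewrite -ltnS => im; apply/mapP; exists (l, Ordinal im) => //.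
by rewrite mem_enum.
Qed.

Lemma pow4_eps b : (0 < b)%N -> (6%:R * 4%:R ^+ b)^-1 <= (6%:R * b%:R)^-1 :> rat.
Proof.
move=> b0; rewrite lef_pV2 ?posrE ?mulr_gt0 ?exprn_gt0 ?ltr0n //.
by rewrite ler_pM2l // -natrX ler_nat ltnW // ltn_expl.
Qed.

(* Galois conjugates over [F] of [X P] inside an abelian extension have the same
   height at the places of a whole class, which bounds their number. *)
Lemma dec_orbit_bound : exists2 d, (0 < d)%N & forall K e0 P r,
  finite_abelian_galois iota K -> fixes_j e0 -> P != 0 -> prime_torsion P -> P *+ (2 ^ d) != 0 ->
  K (X P) -> uniq r ->
  (forall y, y \in r <-> exists e, [/\ fixes iota e, dec K (w \o e0) e & y = e (X P)]) ->
  (size r <= d)%N.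
Proof.
pose S0 := iota t :: map iota bs.
have [d [sg0 [sg0F sg0T _]]] := finite_restrictions algj S0.
have d0 : (0 < d)%N by have [i _] := sg0T idfun (fun=> erefl); case: d i {sg0 sg0F sg0T} => // -[].
(* [16 d] is the bound from [energy_const_bound]; as a number [m] of doublings it also suffices for
   the error, since [4^m >= m] gives [1 / (6 * 4^m) <= 1 / (96 d)]. *)
exists (16 * d)%N; first by rewrite muln_gt0.
move=> K e0 P r hK e0F P0 tP mP KP ur hr; set m := (16 * d)%N in mP *.
have hpt (l : 'I_(size r)) : exists Q, [/\ Q != 0, prime_torsion Q, Q *+ 2 ^ m != 0 & X Q = r`_l].
  have /hr[e [eF _ ->]] := mem_nth 0 (ltn_ord l).
  exact: conj_torsion.
pose pt l := sval (cid (hpt l)).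
have ptP l : [/\ pt l != 0, prime_torsion (pt l), pt l *+ 2 ^ m != 0 & X (pt l) = r`_l] := svalP (cid (hpt l)).
pose S := S0 ++ doublings m pt.
have [N [sg [sgF sgT sgI]]] := finite_restrictions algj S.
have N0 : (0 < N)%N by have [i _] := sgT idfun (fun=> erefl); case: N i {sg sgF sgT sgI} => // -[].
have Sin l i : (i <= m)%N -> X (pt l *+ 2 ^ i) \in S.
  by move=> im; rewrite mem_cat doublings_mem ?orbT.
have Sin0 l : X (pt l) \in S by have := Sin l 0%N (leq0n _); rewrite mulr1n.
have sub : {subset S0 <= S} by move=> x xS; rewrite mem_cat xS.
pose C := [set l | `[< {in S0, sg l =1 e0} >]].
have hgt01 l i : 0 <= height sg (pt l) i <= 2%:R^-1.
  by have [h1 h2 _ _] := ptP l; apply: height01.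
have hmin l l' : l != l' -> \sum_i Num.min (height sg (pt l) i) (height sg (pt l') i) = N%:R / 6%:R.
  move=> ne; have [h1 h2 _ h4] := ptP l; have [h1' h2' _ h4'] := ptP l'.
  by apply: (average_min sgF sgT sgI) => //; rewrite h4 h4' nth_uniq.
have hq l : N%:R * (6%:R^-1 - (6%:R * 4%:R ^+ m)^-1) <= \sum_i qf (height sg (pt l) i).
  have [h1 h2 h3 _] := ptP l; apply: (average_lower sgF sgT sgI) => //.
  by move=> i; apply: Sin.
have hC := restriction_class algj sub sg0F sg0T sgF sgT sgI e0F.
have heps : (6%:R * 4%:R ^+ m)^-1 <= (96%:R * d%:R)^-1 :> rat.
  rewrite (_ : 96%:R * d%:R = 6%:R * m%:R); first by apply: pow4_eps; rewrite muln_gt0.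
  by rewrite /m natrM; ring.
apply: (energy_const_bound hgt01 hmin hq N0 hC heps (phi := fun i => cap w (sg i (X P)))) => l i.
rewrite inE => /asboolP ie; have [_ _ _ ptX] := ptP l.
have /hr[e [eF de ye]] := mem_nth 0 (ltn_ord l).
have [e1 [e1F e1l e1r]] := fixes_inv algj e0F.
(* [sg i] and [e0] agree on [F], so they differ by an automorphism [h] over [F], which commutes with
   [e] on [K]; then [e] preserves the valuation [w \o e0]. *)
pose h : {rmorphism L -> L} := e1 \o sg i.
have hF : fixes iota h by move=> a; rewrite /= (agree_on_base (sgF i) e0F ie) e1l.
have sgE x : sg i x = e0 (h x) by rewrite /= e1r.
have KhP : K (h (X P)) := K_stable hK hF KP.
rewrite /height ptX ye /cap !fmorph_eq0 !sgE (K_comm algL hK hF eF KP).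
by have := de _ KhP; rewrite /= => ->.
Qed.

Lemma discrete_base : exists2 m, (0 < m)%N & forall e0 K z,
  fixes_j e0 -> finite_abelian_galois iota K -> K z -> z != 0 ->
  (forall e, fixes iota e -> dec K (w \o e0) e -> e z = z) ->
  exists c : int, m%:R * w (e0 z) = c%:~R.
Proof.
have [m m0 hm] := discrete_values trj spanF; exists m => // e0 K z e0F hK Kz z0 zfix.
have hv := is_val_comp e0 hw.
have [a a0 ->] : exists2 a, a != 0 & w (e0 z) = w (e0 (iota a)) by apply: (dec_value algL hK hv Kz z0 zfix).
apply: (hm (fun a => w (e0 (iota a)))) => //.
  exact: (is_val_comp iota hv).
move=> x xj x0; apply: (@val_ratsub _ _ f sL trsL (w \o e0) (iota x) hv (val_comp_s e0F)).
  apply: (@ratsub_gen _ _ f0 j (fun x => iota x \in ratsub f sL)) xj => //.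
  - by move=> b; exact: (ratsub_const sL b).
  - exact/iota_ratsub/j_in_s.
  - by move=> x1 x2 h1 h2; rewrite rmorphB rpredB.
  - by move=> x1 x2 h1 h2; rewrite rmorphM rpredM.
  - by move=> x1 h1; rewrite fmorphV rpredV.
by rewrite fmorph_eq0.
Qed.

Lemma cap_grid m x (c : int) : (0 < m)%N -> 0 <= cap w x -> (x != 0 -> m%:R * w x = c%:~R) ->
  exists2 a : nat, (a <= m)%N & cap w x = a%:R / (2 * m)%N%:R.
Proof.
move=> m0 x0 hx; have mr : 0 < (m%:R : rat) by rewrite ltr0n.
have mr0 : (m%:R : rat) != 0 by rewrite gt_eqF.
have [lt|ge] := ltP (cap w x) 2%:R^-1; last first.
  (* The grid has step [1 / (2 m)] so that the cap 1/2 itself lies on it. *)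
  exists m => //; rewrite natrM invfM mulrCA divff // mulr1.
  by apply/eqP; rewrite eq_le ge cap_le.
have [xn wx] := cap_lt lt; have := hx xn; rewrite wx => hc.
have c0 : 0 <= c by rewrite -(ler0z rat) -hc mulr_ge0 // ltW.
have cE : c = `|c|%N by rewrite gez0_abs.
exists (2 * `|c|)%N; last first.
  rewrite !natrM -[(`|c|%N)%:R]/((`|c|%N)%:Z%:~R) -cE -hc.
  by rewrite -mulf_div divff // mul1r mulrC mulKf.
rewrite -(ler_nat rat) natrM -[(`|c|%N)%:R]/((`|c|%N)%:Z%:~R) -cE -hc.
by move: lt; rewrite -(ltr_pM2l mr); move: (_ * cap w x) => y; lra.
Qed.

Lemma height_grid : exists m d, (0 < m)%N /\ forall K e0 P,
  finite_abelian_galois iota K -> fixes_j e0 -> P != 0 -> prime_torsion P -> P *+ (2 ^ d) != 0 ->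
  K (X P) -> exists2 a : nat, (a <= m)%N & cap w (e0 (X P)) = a%:R / (2 * m)%N%:R.
Proof.
have [d d0 hd] := dec_orbit_bound; have [m m0 hm] := discrete_base.
(* The value of [X P] is that of the orbit product divided by the orbit size, which is at most [d]
   and so divides the factorial. *)
exists (m * d`!)%N, d; split; first by rewrite muln_gt0 m0 fact_gt0.
move=> K e0 P hK e0F P0 tP dP KP; have hv := is_val_comp e0 hw.
have c0 : 0 <= cap w (e0 (X P)).
  have sL0 : sL != 0 by rewrite fmorph_eq0.
  have [n n0 nP] := tP; have := cap_ge0 (torsion_vge hv (val_comp_s e0F) kX (val_nat hv n0) P0 nP).
  by rewrite /cap fmorph_eq0.
have [c hc] : exists c : int, e0 (X P) != 0 -> (m * d`!)%N%:R * w (e0 (X P)) = c%:~R.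
  have [X0|X0] := eqVneq (X P) 0; first by exists 0; rewrite X0 rmorph0 eqxx.
  have [r [ur hr]] := dec_orbit algL hK (w \o e0) KP.
  have [KN N0 Nfix wN] := dec_orbit_prod algL hK hv KP X0 ur hr.
  have [c hc] := hm e0 K _ e0F hK KN N0 Nfix.
  have r0 : (0 < size r)%N.
    have : X P \in r by apply/hr; exists idfun.
    by case: (r).
  have /dvdnP[u uE] : (size r %| d`!)%N by apply: dvdn_fact; rewrite r0 (hd K e0 P r).
  exists (u%:Z * c) => _; rewrite intrM -hc -[w (e0 _)]/((w \o e0) _).
  by have := wN idfun (fun=> erefl); rewrite /= => ->; rewrite uE !natrM; ring.
by apply: cap_grid hc; rewrite ?muln_gt0 ?m0 ?fact_gt0.
Qed.

Lemma prime_torsion_finite : exists r : seq L, exists d : nat, forall P,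
  P != 0 -> prime_torsion P -> P *+ (2 ^ d) != 0 -> in_Fab iota (X P) -> X P \in r.
Proof.
(* [d1] doublings bring the error below [1 / (96 m^2)], as [energy_grid_bound] requires, and
   [d1 >= d] gives access to [height_grid]. *)
have [m [d [m0 hm]]] := height_grid; pose d1 := maxn d (16 * m ^ 2).
have d10 : (0 < d1)%N by rewrite leq_max muln_gt0 expn_gt0 m0 orbT.
pose A (x : L) := exists P, [/\ P != 0, prime_torsion P, P *+ (2 ^ d1) != 0 & in_Fab iota (X P) /\ x = X P].
have [r hr] : exists r : seq L, forall x, A x -> x \in r; last first.
  by exists r, d1 => P P0 tP dP KP; apply: hr; exists P.
apply: (@bounded_finite L A (16 * m ^ 2)) => r ur rA.
have hpt (l : 'I_(size r)) : A r`_l by apply/rA/mem_nth.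
pose pt l := sval (cid (hpt l)).
have ptP l : [/\ pt l != 0, prime_torsion (pt l), pt l *+ (2 ^ d1) != 0 &
  in_Fab iota (X (pt l)) /\ r`_l = X (pt l)] := svalP (cid (hpt l)).
have [N [sg [sgF sgT sgI]]] := finite_restrictions algj (doublings d1 pt).
have N0 : (0 < N)%N by have [i _] := sgT idfun (fun=> erefl); case: N i {sg sgF sgT sgI} => // -[].
have Sin l i : (i <= d1)%N -> X (pt l *+ 2 ^ i) \in doublings d1 pt by apply: doublings_mem.
have Sin0 l : X (pt l) \in doublings d1 pt by have := Sin l 0%N (leq0n _); rewrite mulr1n.
have hgt01 l i : 0 <= height sg (pt l) i <= 2%:R^-1.
  by have [h1 h2 _ _] := ptP l; apply: height01.
have hmin l l' : l != l' -> \sum_i Num.min (height sg (pt l) i) (height sg (pt l') i) = N%:R / 6%:R.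
  move=> ne; have [h1 h2 _ [_ h4]] := ptP l; have [h1' h2' _ [_ h4']] := ptP l'.
  by apply: (average_min sgF sgT sgI) => //; rewrite -h4 -h4' nth_uniq.
have hq l : N%:R * (6%:R^-1 - (6%:R * 4%:R ^+ d1)^-1) <= \sum_i qf (height sg (pt l) i).
  have [h1 h2 h3 _] := ptP l; apply: (average_lower sgF sgT sgI) => //.
  by move=> i; apply: Sin.
have heps : (6%:R * 4%:R ^+ d1)^-1 <= (96%:R * m%:R ^+ 2)^-1 :> rat.
  apply: le_trans (pow4_eps d10) _.
  rewrite (_ : 96%:R * m%:R ^+ 2 = 6%:R * (16 * m ^ 2)%N%:R); last by rewrite natrM natrX; ring.
  have h : ((16 * m ^ 2)%N%:R : rat) <= d1%:R by rewrite ler_nat leq_maxr.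
  have h0 : 0 < ((16 * m ^ 2)%N%:R : rat) by rewrite ltr0n muln_gt0 expn_gt0 m0.
  move: ((16 * m ^ 2)%N%:R) (d1%:R) h h0 => x y h h0.
  by rewrite lef_pV2 ?ler_pM2l // posrE mulr_gt0 // (lt_le_trans h0 h).
apply: (energy_grid_bound hgt01 hmin hq N0 m0 heps) => l i.
have [h1 h2 h3 [[K [hK KP]] _]] := ptP l; apply: (hm K (sg i)) => //.
apply: contraNneq h3 => h3; rewrite /d1 -(subnKC (leq_maxl d (16 * m ^ 2))) expnD.
by rewrite mulrnA h3 mul0rn.
Qed.

Lemma ptorsion_finite : exists r : seq L, forall P a,
  P != 0 -> P *+ (p ^ a) = 0 -> in_Fab iota (X P) -> X P \in r.
Proof.
have sL0 : sL != 0 by rewrite fmorph_eq0.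
have [m m0 hm] := discrete_base.
pose A (x : L) := exists P, exists a, [/\ P != 0, P *+ (p ^ a) = 0, in_Fab iota (X P) & x = X P].
have [r hr] : exists r : seq L, forall x, A x -> x \in r; last first.
  by exists r => P a P0 aP KP; apply: hr; exists P, a.
have capA x : A x -> cap w x \in [seq (a%:R / (2 * m)%N%:R : rat) | a <- seq.iota 0 m.+1].
  move=> [P [a [P0 aP [K [hK KP]] ->]]].
  have c0 : 0 <= cap w (X P) by apply: cap_ge0; apply: vgt_vge; exact: (ptorsion_vgt kX pL hw ws P0 aP).
  have [c hc] : exists c : int, X P != 0 -> m%:R * w (X P) = c%:~R.
    have [X0|X0] := eqVneq (X P) 0; first by exists 0.
    have [|c hc] := hm idfun K (X P) (fun=> erefl) hK KP X0; last by exists c.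
    move=> e eF de; have [g [gD gX]] := conj_pt eF; have [gP0 gPX] := gX _ P0.
    rewrite -gPX; apply: (ptorsion_cap_inj kX pL hw sL0 ws gP0 P0 _ aP).
      rewrite -morph_add_mulrn // aP; apply: (addrI (g 0)); by rewrite -gD !addr0.
    by rewrite gPX /cap fmorph_eq0; have := de _ KP; rewrite /= => ->.
  have [b bm ->] := cap_grid m0 c0 hc; apply/mapP; exists b => //.
  by rewrite mem_iota.
(* The cap is injective on these values of [X] and takes at most [m + 1] values, [a / (2 m)] with
   [a <= m]. *)
apply: (@bounded_finite L A m.+1) => r ur rA.
rewrite -[X in (X <= _)%N](size_map (cap w)) -[X in (_ <= X)%N](size_iota 0).
rewrite -[X in (_ <= X)%N](size_map (fun a => a%:R / (2 * m)%N%:R : rat)).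
apply: uniq_leq_size; last by move=> _ /mapP[x /rA Ax ->]; apply: capA.
rewrite map_inj_in_uniq // => x y /rA[P [a [P0 aP _ ->]]] /rA[Q [b [Q0 bQ _ ->]]].
apply: (@ptorsion_cap_inj _ _ _ _ p kX pL w hw sL0 ws P Q (a + b)) => //.
  by rewrite expnD mulrnA aP mul0rn.
by rewrite expnD mulnC mulrnA bQ mul0rn.
Qed.

End Valued.

(** These points escape the averages. Each doubling value [c] comes from finitely many [X P], the
    roots of [phi - c psi]. *)
Lemma two_torsion_finite d : exists r : seq L, forall P, P != 0 -> P *+ (2 ^ d) = 0 -> X P \in r.
Proof.
have [_ _ _ _ hD] := kX.
elim: d => [|d [r hr]]; first by exists [::] => P P0; rewrite mulr1n => e; rewrite e eqxx in P0.
pose psi : {poly L} := 4%:R *: 'X^3 + 'X^2 + (2%:R * (- 72%:R * sL)) *: 'X + (- 4%:R * sL)%:P.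
pose phi : {poly L} := 'X^4 - (- 72%:R * sL) *: 'X^2 - (2%:R * (- 4%:R * sL)) *: 'X - (- sL - 1296%:R * sL ^+ 2)%:P.
have psiE x : psi.[x] = km_psi 1 (- 72%:R * sL) (- 4%:R * sL) x.
  by rewrite /psi /km_psi !hornerE /=; ring.
have phiE x : phi.[x] = km_phi (- 72%:R * sL) (- 4%:R * sL) (- sL - 1296%:R * sL ^+ 2) x.
  by rewrite /phi /km_phi !hornerE /=; ring.
have psi0 : psi != 0.
  apply/eqP => /polyP/(_ 2%N); rewrite /psi !coefD !coefZ !coefXn coefX coefC coef0 /=.
  by rewrite !mulr0 !addr0 add0r => /eqP; rewrite oner_eq0.
have q0 c : phi - c *: psi != 0.
  apply/eqP => /polyP/(_ 4%N); rewrite /psi /phi !(coefB, coefD, coefN, coefZ, coefXn, coefX, coefC, coef0) /=.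
  by rewrite !(mulr0, addr0, subr0, oppr0) => /eqP; rewrite oner_eq0.
have [r1 [_ h1]] := root_list psi0.
have hc c : exists rs : seq L, forall x, root (phi - c *: psi) x = (x \in rs).
  by have [rs [_ h]] := root_list (q0 c); exists rs.
pose rs c := sval (cid (hc c)); have rsP c x : root (phi - c *: psi) x = (x \in rs c) := svalP (cid (hc c)) x.
exists (r1 ++ flatten [seq rs c | c <- r]) => P P0; rewrite expnS mulrnA mulr2n => PP.
have := hD _ P0; rewrite mem_cat; case: ifP => [_ e|/negbT P2 [p0 e]].
  by apply/orP; left; rewrite -h1; apply/rootP; rewrite psiE.
apply/orP; right; apply/flattenP; exists (rs (X (P + P))); first by apply: map_f; apply: hr.
by rewrite -rsP; apply/rootP; rewrite hornerD hornerN hornerZ psiE phiE e subrr.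
Qed.

(** A differential ladder: [X] of a sum is computed from [X] of both points and of their difference,
    without the other coordinate. *)
Lemma K_multiples K P n : finite_abelian_galois iota K -> P != 0 -> K (X P) ->
  P *+ n != 0 -> K (X (P *+ n)).
Proof.
move=> [[K1 KB KM KV] Kb _ _ _] P0 KP; have [_ hN hI hS hD] := kX.
have K0 : K 0 by rewrite -(subrr 1); apply: (KB).
have KN x : K x -> K (- x) by move=> h; rewrite -sub0r; apply: (KB).
have KD x y : K x -> K y -> K (x + y).
  by move=> h1 h2; rewrite -(opprK y); apply: (KB) => //; apply: KN.
have Kn m : K m%:R by elim: m => [|m IH] //; rewrite mulrS; apply: KD.
have KX x m : K x -> K (x ^+ m).
  by move=> h; elim: m => [|m IH]; rewrite ?expr0 // exprS; apply: (KM).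
have Ks : K sL := Kb s.
elim/ltn_ind: n => -[|[|n]] IH; rewrite ?mulr0n ?eqxx // ?mulr1n // => nP.
have [e|P1] := eqVneq (P *+ n.+1) 0; first by rewrite mulrS e addr0.
have KP1 := IH n.+1 (ltnSn _) P1.
have [e|ne] := eqVneq (X P) (X (P *+ n.+1)); last first.
  have Pn : P *+ n != 0.
    apply: contraNneq ne => z; by rewrite mulrS z addr0.
  have [eS _] := hS _ _ P1 P0 ltac:(by rewrite eq_sym).
  rewrite -mulrSr [P *+ n.+1 - P](_ : _ = P *+ n) in eS; last by rewrite mulrSr addrK.
  have d0 : X (P *+ n.+1) - X P != 0 by rewrite subr_eq0 eq_sym.
  rewrite (_ : X (P *+ n.+2) = km_S 1 (- 72%:R * sL) (- 4%:R * sL) (X (P *+ n.+1)) (X P) *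
     ((X (P *+ n.+1) - X P) ^+ 2)^-1 - X (P *+ n)).
    have Kn0 := IH n (leqW (leqnn _)) Pn.
    by apply: (KB) => //; apply: (KM); [rewrite /km_S|apply: (KV); apply: (KX); apply: (KB)];
      repeat (first [assumption | apply: (Kn) | apply: (KX) | apply: (KM) | apply: (KN) | apply: (KD)]).
  by rewrite -eS mulfK ?expf_neq0 // addrK.
have [e1|e1] := hI _ _ P0 P1 e.
  have e2 : P *+ n.+2 = P + P by rewrite mulrS -e1.
  rewrite e2 in nP *; have := hD _ P0; rewrite (negPf nP) => -[p0 eq2].
  rewrite -(mulfK p0 (X (P + P))) eq2 /km_phi /km_psi.
  apply: (KM); [|apply: (KV)];
    repeat (first [assumption | apply: (Kn) | apply: (KX) | apply: (KM) | apply: (KN) | apply: (KD)]).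
by move: nP; rewrite mulrS {1}e1 addNr eqxx.
Qed.

Lemma points_of_values (r : seq L) : exists lp : seq M, forall P, P != 0 -> X P \in r -> P \in lp.
Proof.
have [_ hN hI _ _] := kX; elim: r => [|x r [lp hlp]]; first by exists [::].
have [[P0 [P0n xP]]|no] := pselect (exists P0, P0 != 0 /\ X P0 = x); last first.
  exists lp => P Pn; rewrite in_cons => /orP[/eqP e|]; last exact: hlp.
  by case: no; exists P.
exists (P0 :: - P0 :: lp) => P Pn; rewrite !in_cons => /orP[/eqP e|h]; last by rewrite hlp ?orbT.
by have [->|->] := hI _ _ Pn P0n (etrans e (esym xP)); rewrite eqxx ?orbT.
Qed.

Lemma torsion_finite : exists lp : seq M, forall P n,
  (0 < n)%N -> P *+ n = 0 -> (P != 0 -> in_Fab iota (X P)) -> P \in lp.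
Proof.
have [w [hw ws]] := exists_val trsL algs.
have [r1 [d hr1]] := prime_torsion_finite hw ws; have [r2 hr2] := two_torsion_finite d.
have [r3 hr3] := ptorsion_finite hw ws.
have [l1 hl1] := points_of_values (r1 ++ r2); have [l2 hl2] := points_of_values r3.
(* Bezout writes [P] as a point of order prime to [p] minus one of [p]-power order; 0 is added to
   both lists because [X] says nothing about the origin. *)
exists [seq P - Q | P <- 0 :: l1, Q <- 0 :: l2] => P n n0 nP hP.
have pp := pcharf_prime pL; pose q := (p ^ logn p n)%N; pose m := (n %/ q)%N.
have q0 : (0 < q)%N by rewrite expn_gt0 prime_gt0.
have nE : n = (m * q)%N by rewrite divnK // pfactor_dvdnn.
have pm : ~~ (p %| m)%N.
  apply/negP => /dvdnP[u uE]; have : (p ^ (logn p n).+1 %| n)%N.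
    by rewrite {2}nE uE expnS -mulnA dvdn_mull.
  by rewrite pfactor_dvdn // ltnn.
have m0 : m%:R != 0 :> L by rewrite -(dvdn_pcharf pL).
have cop : coprime q m by rewrite coprimeXl // prime_coprime.
have [u v e _] := egcdnP m q0; rewrite (eqP cop) in e.
have PE : P = P *+ (u * q) - P *+ (v * m) by rewrite e mulrnDr addrAC subrr add0r.
have P_Fab i : P *+ i != 0 -> in_Fab iota (X (P *+ i)).
  move=> kP; have P0 : P != 0 by apply: contraNneq kP => ->; rewrite mul0rn.
  by have [K [hK KP]] := hP P0; exists K; split=> //; apply: K_multiples.
rewrite [X in X \in _]PE; apply: (allpairs_f (fun P Q : M => P - Q)); rewrite in_cons.
  have [//|P1] := eqVneq (P *+ (u * q)) 0; apply: hl1 => //; rewrite mem_cat.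
  have tP : prime_torsion (P *+ (u * q)).
    by exists m => //; rewrite -mulrnA -mulnA [(q * m)%N]mulnC -nE mulnC mulrnA nP mul0rn.
  have [z|nz] := eqVneq (P *+ (u * q) *+ 2 ^ d) 0; first by rewrite hr2 ?orbT.
  by rewrite hr1 //; exact: P_Fab.
have [//|P2] := eqVneq (P *+ (v * m)) 0; apply: hl2 => //.
apply: (hr3 _ (logn p n)) => //; last exact: P_Fab.
by rewrite -/q -mulrnA -mulnA -nE mulnC mulrnA nP mul0rn.
Qed.

End Core.

(** * The curve over the function field *)

Section Conversion.
Variables (F L : fieldType) (iota : {rmorphism F -> L}) (a1 a2 a3 a4 a6 : F).

Lemma rmorph_b2 : ec_b2 (iota a1) (iota a2) = iota (ec_b2 a1 a2).
Proof. by rewrite /ec_b2 rmorphD rmorphM rmorphXn rmorph_nat. Qed.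
Lemma rmorph_b4 : ec_b4 (iota a1) (iota a3) (iota a4) = iota (ec_b4 a1 a3 a4).
Proof. by rewrite /ec_b4 rmorphD !rmorphM rmorph_nat. Qed.
Lemma rmorph_b6 : ec_b6 (iota a3) (iota a6) = iota (ec_b6 a3 a6).
Proof. by rewrite /ec_b6 rmorphD rmorphM rmorphXn rmorph_nat. Qed.
Lemma rmorph_b8 : ec_b8 (iota a1) (iota a2) (iota a3) (iota a4) (iota a6) = iota (ec_b8 a1 a2 a3 a4 a6).
Proof. by rewrite /ec_b8 !rmorphD !rmorphN !rmorphM ?rmorphXn !rmorph_nat. Qed.
Lemma rmorph_disc : ec_disc (iota a1) (iota a2) (iota a3) (iota a4) (iota a6) = iota (ec_disc a1 a2 a3 a4 a6).
Proof.
rewrite /ec_disc rmorph_b2 rmorph_b4 rmorph_b6 rmorph_b8.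
move: (ec_b2 _ _) (ec_b4 _ _ _) (ec_b6 _ _) (ec_b8 _ _ _ _ _) => b2 b4 b6 b8.
by rewrite !rmorphD !rmorphN !rmorphM ?rmorphN ?rmorphXn !rmorph_nat.
Qed.

Lemma rmorph_ec_add (P Q : option (F * F)) :
  let g P := omap (fun c : F * F => (iota c.1, iota c.2)) P in
  g (ec_add a1 a2 a3 a4 a6 P Q) =
  ec_add (iota a1) (iota a2) (iota a3) (iota a4) (iota a6) (g P) (g Q).
Proof.
case: P => [[x1 y1]|] //; case: Q => [[x2 y2]|] //=.
rewrite -!rmorphM -!rmorphD !fmorph_eq0 !(inj_eq (fmorph_inj iota)).
case: ifP => // _; case: ifP => _ /=.
  by congr (Some (_, _)); rewrite !(rmorphXn, rmorphD, rmorphN, rmorphM, fmorphV).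
by congr (Some (_, _)); rewrite !(rmorph_nat, rmorphXn, rmorphD, rmorphN, rmorphM, fmorphV).
Qed.

Lemma rmorph_on_curve (P : option (F * F)) :
  on_curve a1 a2 a3 a4 a6 P ->
  on_curve (iota a1) (iota a2) (iota a3) (iota a4) (iota a6) (omap (fun c : F * F => (iota c.1, iota c.2)) P).
Proof.
case: P => [[x y]|] //= /eqP e; rewrite -!rmorphM -!rmorphXn -!rmorphM -!rmorphD.
by rewrite e.
Qed.
End Conversion.

Lemma ieval_prime (F : fieldType) p (f : {rmorphism 'F_p -> F}) (P : {poly int}) x :
  ieval P x = (map_poly f (map_poly intr P)).[x].
Proof.
rewrite /ieval -map_poly_comp_id0 ?rmorph0 //; congr (_.[_]).
by apply: eq_map_poly => z /=; rewrite rmorph_int.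
Qed.

(** Transcendence is stated with integer polynomials; coefficients in ['F_p] are lifted to their
    least representatives to meet it. *)
Lemma transcendental_prime_poly (F : fieldType) p (f : {rmorphism 'F_p -> F}) x :
  transcendental_prime x -> forall Q : {poly 'F_p}, (map_poly f Q).[x] = 0 -> Q = 0.
Proof.
move=> trx Q Qx; pose P := map_poly (fun a : 'F_p => (a : nat)%:Z) Q.
have PQ : map_poly intr P = Q.
  apply/polyP => i; rewrite !coef_map_id0 //=.
  by rewrite -[RHS]natr_Zp.
have := trx P; rewrite (ieval_prime f) PQ => /(_ Qx) e.
apply/eqP; rewrite -(map_poly_eq0 f); apply/eqP; rewrite -[RHS]e -[in LHS]PQ -map_poly_comp_id0 ?rmorph0 //.
by apply: eq_map_poly => z /=; rewrite rmorph_int.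
Qed.

Lemma in_prime_rat_ratsub (F : fieldType) p (f : {rmorphism 'F_p -> F}) t c :
  in_prime_rat t c -> c \in ratsub f t.
Proof.
move=> [P [Q [Q0 ->]]]; apply/ratsubP; exists (map_poly intr P), (map_poly intr Q).
by rewrite -!ieval_prime.
Qed.

Theorem theorem4p2 (F : fieldType) (L : closedFieldType)
  (iota : {rmorphism F -> L}) (a1 a2 a3 a4 a6 : F) :
  global_function_field F ->
  is_algebraic_closure iota ->
  ec_disc a1 a2 a3 a4 a6 != 0 ->
  (* non-isotrivial: j(E) is not in \bar F_r, i.e. transcendental over F_p *)
  transcendental_prime (ec_j a1 a2 a3 a4 a6) ->
  exists s : seq (option (L * L)),
    forall P : option (L * L),
      in_tors_over (iota a1) (iota a2) (iota a3) (iota a4) (iota a6)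
        (in_Fab iota) P -> P \in s.
Proof.
move=> [[p [pp pF]] [t [_ [bs spanF]]]] algL D0 trj.
have [f _] := prime_morphism pF.
pose b2 := ec_b2 a1 a2; pose b4 := ec_b4 a1 a3 a4; pose b6 := ec_b6 a3 a6.
pose b8 := ec_b8 a1 a2 a3 a4 a6.
pose D := ec_disc a1 a2 a3 a4 a6; pose j := ec_j a1 a2 a3 a4 a6; pose c4 := b2 ^+ 2 - 24%:R * b4.
pose c6 := - b2 ^+ 3 + 36%:R * b2 * b4 - 216%:R * b6.
have trp := transcendental_prime_poly (f := f) trj; rewrite -/j in trp.
have jE : j = c4 ^+ 3 / D by [].
have c46 : c4 ^+ 3 - c6 ^+ 2 = 1728%:R * D.
  apply: (@c4_c6 _ b2 b4 b6 b8) => //.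
  by rewrite /b8 /b2 /b4 /b6 /ec_b8 /ec_b2 /ec_b4 /ec_b6; ring.
have j0 : j != 0 := transcendental_neq0 trp.
have c40 : c4 != 0 by apply: contraNneq j0 => e; rewrite jE e expr0n mul0r.
have c60 : c6 != 0.
  apply/eqP => e; have jn : j = 1728%:R.
    by move: c46; rewrite jE e expr0n subr0 => ->; rewrite mulfK.
  have : 'X - 1728%:R%:P = 0 :> {poly 'F_p}.
    by apply: trp; rewrite rmorphB /= map_polyX map_polyC hornerXsubC /= rmorph_nat jn subrr.
  by move/eqP; rewrite polyXsubC_eq0.
pose s := D / c6 ^+ 2.
have s0 : s != 0 by rewrite mulf_neq0 ?invr_eq0 ?expf_neq0.
have sj : s^-1 + 1728%:R = j.
  rewrite jE (_ : c4 ^+ 3 = 1728%:R * D + c6 ^+ 2); last by rewrite -c46 subrK.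
  by rewrite /s; field; rewrite D0 c60.
have s1 : 1 + 1728%:R * s != 0.
  have -> : 1 + 1728%:R * s = j * s by rewrite -sj [RHS]mulrDl mulVf.
  by rewrite mulf_neq0.
have D0L : ec_disc (iota a1) (iota a2) (iota a3) (iota a4) (iota a6) != 0.
  by rewrite rmorph_disc fmorph_eq0.
pose M := ec_pt D0L.
pose r := (18%:R * b6 - b2 * b4) / c4; pose u := - c6 / c4.
pose X (P : M) := (@pt_x _ _ _ _ _ _ D0L P - iota r) / iota u.
have kX : normal_kummer (iota s) X.
  have := pt_kummer D0L; rewrite rmorph_b2 rmorph_b4 rmorph_b6 rmorph_b8 -/b2 -/b4 -/b6 -/b8.
  have e4 : iota c4 = iota b2 ^+ 2 - 24%:R * iota b4 by rewrite rmorphB rmorphXn rmorphM rmorph_nat.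
  have e6 : iota c6 = - iota b2 ^+ 3 + 36%:R * iota b2 * iota b4 - 216%:R * iota b6.
    by rewrite rmorphB rmorphD rmorphN rmorphXn !rmorphM !rmorph_nat.
  have eD : iota D = km_disc (iota b2) (iota b4) (iota b6) (iota b8).
    by rewrite /D -rmorph_disc ec_discE rmorph_b2 rmorph_b4 rmorph_b6 rmorph_b8.
  have [c40' c60'] : iota c4 != 0 /\ iota c6 != 0 by rewrite !fmorph_eq0.
  move/(kummer_normal e4 e6 eD c40' c60').
  rewrite -rmorphXn -fmorph_div -/s -rmorphN -fmorph_div -/u.
  by rewrite -[18%:R](rmorph_nat iota) -!rmorphM -rmorphB -fmorph_div.
have pL : p \in [pchar L] by rewrite (fmorph_pchar iota).
have spanF' y : exists c : nat -> ratfield f t, y = \sum_(l < size bs) ratinj f t (c l) * bs`_l.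
  have [cs [sz csr ->]] := spanF y.
  have h l : exists b, cs`_l = ratinj f t b.
    apply: ratinj_in; have [lt|ge] := ltnP l (size cs).
      by apply/in_prime_rat_ratsub/csr/mem_nth.
    by rewrite nth_default // rpred0.
  exists (fun l => sval (cid (h l))); apply: eq_bigr => l _.
  by rewrite -(svalP (cid (h l))).
have conj e : fixes iota e -> exists g : M -> M, {morph g : P Q / P + Q} /\
    forall P, P != 0 -> g P != 0 /\ X (g P) = e (X P).
  move=> eF; pose h := omap (fun c : L * L => (e c.1, e c.2)).
  have hC P : on_curve (iota a1) (iota a2) (iota a3) (iota a4) (iota a6) P ->
      on_curve (iota a1) (iota a2) (iota a3) (iota a4) (iota a6) (h P).
    by move/(rmorph_on_curve e); rewrite !eF.
  exists (fun P : M => exist (on_curve _ _ _ _ _) _ (hC _ (svalP P))); split=> [P Q|P].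
    by apply/val_inj; have := rmorph_ec_add e (iota a1) (iota a2) (iota a3) (iota a4) (iota a6) (val P) (val Q); rewrite !eF.
  case: P => -[[x y]|] cP; last by case/eqP; apply/val_inj.
  by move=> _; split; rewrite // /X /pt_x /= [RHS]fmorph_div [X in _ = X / _]rmorphB !eF.
have [lp hlp] := torsion_finite algL trp spanF' s0 s1 sj pL kX conj.
exists (map val lp) => P [[cP [n [n0 nP]]] HP].
pose P' : M := exist _ P cP; apply/mapP; exists P' => //.
apply: (hlp P' n n0); first by apply/val_inj; rewrite pt_mulrn.
case: P cP nP HP @P' => [[x y]|] cP nP HP P' P0; last by case/eqP: P0; apply/val_inj.
have [[K [hK Kx]] _] := HP; exists K; split=> //.
have [[_ KB KM KV] Kb _ _ _] := hK.
by apply: (KM); [apply: (KB)|apply: (KV)].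
Qed.
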